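(* There is a universal constant $C>0$ such that the following holds. Let $\mathcal{M}=(\mathcal{X},\mathcal{A},P,r)$ be any layered episodic MDP with episode length $L$, $X=|\mathcal{X}|$ states and $A=|\mathcal{A}|$ actions, with reward realizations in $[0,1]$, let $T\ge 1$ be the number of episodes and let $\delta\in(0,1)$. If the learner runs the UCRL-LP algorithm with inputs $\mathcal{X},\mathcal{A},T,\delta$, then with probability at least $1-5\delta$ the total regret $\mathrm{Reg}_T = T\cdot V(\pi^* )-\sum_{t=1}^T V(\pi_{i(t)})$ satisfies $$\mathrm{Reg}_T\le C\, L X\sqrt{T A\log\left(\frac{TXA}{\delta}\right)} .$$
   Context: **Layered episodic MDP.** $\mathcal{X}$ (states) and $\mathcal{A}$ (actions) are finite, $P:\mathcal{X}\times\mathcal{A}\times\mathcal{X}\to[0,1]$ is the transition function, $r:\mathcal{X}\times\mathcal{A}\to[0,1]$ the expected reward function; both are time-invariant and unknown to the learner. $\mathcal{X}$ is partitioned into layers $\mathcal{X}_0,\dots,\mathcal{X}_L$ (known to the learner) with $\mathcal{X}_0=\{x_0\}$, $\mathcal{X}_L=\{x_L\}$, and $P(x'|x,a)>0$ only if $x\in\mathcal{X}_h$, $x'\in\mathcal{X}_{h+1}$ for some $0\le h\le L-1$; for $x\ne x_L$, $P(\cdot|x,a)$ is a probability distribution on the next layer. $h(x)$ is the index of the layer of $x$; $X=|\mathcal{X}|$, $X_h=|\mathcal{X}_h|$, $A=|\mathcal{A}|$. All transition functions considered respect this layer structure. A policy is a map $\pi:\mathcal{X}\to\Delta(\mathcal{A})$.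 In an episode under $\pi$, one starts at $x_0$, and for $h=0,\dots,L-1$ draws $a_h\sim\pi(\cdot|x_h)$, receives a realized reward drawn from a fixed unknown distribution on $[0,1]$ (depending on $(x_h,a_h)$) with mean $r(x_h,a_h)$, and moves to $x_{h+1}\sim P(\cdot|x_h,a_h)$. The learner observes the trajectory and the realized rewards only. **Value.** $V(\pi)=\mathbb{E}\big[\sum_{h=0}^{L-1}r(x_h,a_h)\,\big|\,P,\pi\big]$, and $\pi^*\in\arg\max_\pi V(\pi)$. **Occupancy measures.** For a transition function $P'$ and policy $\pi$, $q^{P',\pi}(x,a,x')=\mathbb{P}\{x_{h(x)}=x,a_{h(x)}=a,x_{h(x)+1}=x'\mid P',\pi\}$. $Q$ is the set of all such $q^{P',\pi}$; $Q^{P'}$ is the set of $q^{P',\pi}$ over all $\pi$ with $P'$ fixed; for a set $\mathcal{P}$ of transition functions, $Q^{\mathcal{P}}=\bigcup_{P'\in\mathcal{P}}Q^{P'}$. Each $q\in Q$ induces the policy $\pi^q(a|x)=\frac{\sum_{x'}q(x,a,x')}{\sum_{b}\sum_{x'}q(x,b,x')}$ (sums over $x'\in\mathcal{X}_{h(x)+1}$, $b\in\mathcal{A}$; arbitrary when the denominator is $0$). For $f:\mathcal{X}\times\mathcal{A}\to\mathbb{R}$, $\langle q,f\rangle=\sum_{x,a,x'}q(x,a,x')f(x,a)$. **UCRL-LP algorithm.** Episodes $t=1,\dots,T$ are grouped into consecutive epochs $i=1,2,\dots$; $t(i)$ is the first episode of epoch $i$ ($t(1)=1$) and $i(t)$ is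 the epoch containing episode $t$. Let $N_i(x,a)$, $N_i(x,a,x')$ be the numbers of visits to $(x,a)$ and $(x,a,x')$ in episodes $1,\dots,t(i)-1$, and let $n_i(x,a)$ count the visits to $(x,a)$ during epoch $i$. Epoch $i$ ends after the first episode at whose end $n_i(x,a)\ge\max\{1,N_i(x,a)\}$ for some $(x,a)\in\mathcal{X}\times\mathcal{A}$. At the beginning of epoch $i\geq 2$ define: - $\bar P_i(x'|x,a)=\frac{N_i(x,a,x')}{\max\{1,N_i(x,a)\}}$, $\epsilon_i(x,a)=\sqrt{\frac{2X_{h(x)+1}\log(TXA/\delta)}{\max\{1,N_i(x,a)\}}}$, and $\mathcal{P}_i=\{P':\|P'(\cdot|x,a)-\bar P_i(\cdot|x,a)\|_1\le\epsilon_i(x,a)\ \forall x\in\mathcal{X}\setminus\{x_L\},a\in\mathcal{A}\}$; - $\bar r_i(x,a)$ = (sum of realized rewards received at visits to $(x,a)$ in episodes $1,\dots,t(i)-1$) divided by $\max\{1,N_i(x,a)\}$, $b_i(x,a)=\sqrt{\frac{2\log(TXA/\delta)}{\max\{1,N_i(x,a)\}}}$, $\hat r_i(x,a)=\min\{1,\bar r_i(x,a)+b_i(x,a)\}$; - $\hat q_i\in\arg\max_{q\in Q^{\mathcal{P}_i}}\langle q,\hat r_i\rangle$ (any maximizer). For epoch $1$: $\mathcal{P}_1$ is the set of all transition functions, $\hat r_1\equiv1$, and $\hat q_1(x,a,x')=\frac{1}{X_hAX_{h+1}}$ for $x\in\mathcal{X}_h,x'\in\mathcal{X}_{h+1}$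 (zero otherwise). In every episode of epoch $i$ the learner executes $\pi_i=\pi^{\hat q_i}$. *)

(* Defs.v *)
From HB Require Import structures.
From mathcomp Require Import all_boot all_order all_algebra.
From mathcomp Require Import all_classical all_reals all_analysis.

Set Implicit Arguments.
Unset Strict Implicit.
Unset Printing Implicit Defensive.

Import Order.TTheory GRing.Theory Num.Theory.
Import numFieldNormedType.Exports.

Local Open Scope classical_set_scope.
Local Open Scope ring_scope.

(* What the learner knows: the states, their layers 0, ..., len, the actions. *)
Record layered_space := LayeredSpace {
  state : finType;
  action : finType;
  len : nat;
  layer : state -> 'I_len.+1;
  x_first : state;
  x_last : state;
  layer_first : forall x, (layer x == ord0) = (x == x_first);
  layer_last : forall x, (layer x == ord_max) = (x == x_last) }.

Definition layer_size (S : layered_space) (k : nat) : nat :=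
  #|[set x : state S | layer x == k :> nat]|.

Definition next_layer (S : layered_space) (x x' : state S) : bool :=
  layer x' == (layer x).+1 :> nat.

(* P x a x' stands for P(x' | x, a). Positivity only across consecutive layers
   forces P x_last a = 0. *)
Definition is_transition (R : realType) (S : layered_space)
    (P : state S -> action S -> state S -> R) : Prop :=
  [/\ forall x a x', 0 <= P x a x',
      forall x a x', 0 < P x a x' -> next_layer x x' &
      forall x a, x != x_last S -> \sum_x' P x a x' = 1].

(* pi x a stands for pi(a | x). *)
Definition is_policy (R : realType) (S : layered_space)
    (pi : state S -> action S -> R) : Prop :=
  (forall x a, 0 <= pi x a) /\ (forall x, \sum_a pi x a = 1).

(* reward x a is the mean of the law reward_law x a of the realized rewards,
   which is carried by [0, 1]. *)
Record layered_mdp (R : realType) (S : layered_space) := LayeredMDP {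
  trans : state S -> action S -> state S -> R;
  reward : state S -> action S -> R;
  reward_law : state S -> action S -> probability (measurableTypeR R) R;
  trans_transition : is_transition trans;
  reward01 : forall x a, 0 <= reward x a <= 1;
  reward_law01 : forall x a, reward_law x a `[0%R, 1%R]%classic = 1%E;
  reward_mean : forall x a,
    (\int[reward_law x a]_y y%:E)%E = (reward x a)%:E }.

(* An episode: the states x_0, ..., x_L and the actions a_0, ..., a_(L-1). *)
Definition traj (S : layered_space) : finType :=
  ({ffun 'I_(len S).+1 -> state S} * {ffun 'I_(len S) -> action S})%type.

Definition st (S : layered_space) (tau : traj S) (h : 'I_(len S)) : state S :=
  tau.1 (widen_ord (leqnSn _) h).

Definition ac (S : layered_space) (tau : traj S) (h : 'I_(len S)) : action S :=
  tau.2 h.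

Definition st_next (S : layered_space) (tau : traj S) (h : 'I_(len S)) :
    state S :=
  tau.1 (lift ord0 h).

(* Probability of the trajectory tau in one episode under (P, pi). *)
Definition traj_prob (R : realType) (S : layered_space)
    (P : state S -> action S -> state S -> R) (pi : state S -> action S -> R)
    (tau : traj S) : R :=
  (tau.1 ord0 == x_first S)%:R *
  \prod_(h < len S)
    (pi (st tau h) (ac tau h) * P (st tau h) (ac tau h) (st_next tau h)).

Definition value (R : realType) (S : layered_space) (M : layered_mdp R S)
    (pi : state S -> action S -> R) : R :=
  \sum_(tau : traj S) traj_prob (trans M) pi tau *
    \sum_(h < len S) reward M (st tau h) (ac tau h).

Definition optimal_policy (R : realType) (S : layered_space)
    (M : layered_mdp R S) (pistar : state S -> action S -> R) : Prop :=
  is_policy pistar /\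
  forall pi, is_policy pi -> value M pi <= value M pistar.

Definition occupancy (R : realType) (S : layered_space)
    (P : state S -> action S -> state S -> R) (pi : state S -> action S -> R)
    (x : state S) (a : action S) (x' : state S) : R :=
  \sum_(tau : traj S | [exists h : 'I_(len S),
      [&& h == layer x :> nat, st tau h == x, ac tau h == a
        & st_next tau h == x']])
    traj_prob P pi tau.

(* Q^Ps, the occupancy measures of the transition functions in Ps. *)
Definition occupancy_set (R : realType) (S : layered_space)
    (Ps : set (state S -> action S -> state S -> R)) :
    set (state S -> action S -> state S -> R) :=
  [set q | exists P pi, [/\ is_transition P, Ps P, is_policy pi
                          & q = occupancy P pi]].

Definition inner (R : realType) (S : layered_space)
    (q : state S -> action S -> state S -> R) (f : state S -> action S -> R) :
    R :=
  \sum_x \sum_a \sum_x' q x a x' * f x a.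

(* pi is a version of pi^q: it is unconstrained at the states of zero mass. *)
Definition induced_policy (R : realType) (S : layered_space)
    (q : state S -> action S -> state S -> R) (pi : state S -> action S -> R) :
    Prop :=
  is_policy pi /\
  forall x a,
    let mass := \sum_b \sum_(x' | next_layer x x') q x b x' in
    mass != 0 -> pi x a = (\sum_(x' | next_layer x x') q x a x') / mass.

(* The observations of the learner. Episodes are numbered from 1; in episode t,
   run_st t h (h <= len S) is the h-th state, and run_ac t h and run_rw t h
   (h < len S) are the h-th action and realized reward. Values at other indices
   are irrelevant. *)
Record run (R : realType) (S : layered_space) := Run {
  run_st : nat -> nat -> state S;
  run_ac : nat -> nat -> action S;
  run_rw : nat -> nat -> R }.

(* Visits to (x, a), resp. (x, a, x'), in the episodes s, ..., t - 1. *)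
Definition visits2 (R : realType) (S : layered_space) (w : run R S)
    (s t : nat) (x : state S) (a : action S) : nat :=
  (\sum_(s <= u < t) \sum_(h < len S)
     ((run_st w u h == x) && (run_ac w u h == a)))%N.

Definition visits3 (R : realType) (S : layered_space) (w : run R S)
    (s t : nat) (x : state S) (a : action S) (x' : state S) : nat :=
  (\sum_(s <= u < t) \sum_(h < len S)
     [&& run_st w u h == x, run_ac w u h == a & run_st w u h.+1 == x'])%N.

Definition reward_sum (R : realType) (S : layered_space) (w : run R S)
    (s t : nat) (x : state S) (a : action S) : R :=
  \sum_(s <= u < t)
    \sum_(h < len S | (run_st w u h == x) && (run_ac w u h == a)) run_rw w u h.

(* Whether an epoch that starts with episode s is over after episode t. *)
Definition epoch_over (R : realType) (S : layered_space) (w : run R S)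
    (s t : nat) : bool :=
  [exists x : state S, exists a : action S,
     maxn 1 (visits2 w 1 s x a) <= visits2 w s t.+1 x a]%N.

(* For episode n + 1: the index of its epoch, and the first episode of that
   epoch. *)
Fixpoint epoch_rec (R : realType) (S : layered_space) (w : run R S) (n : nat) :
    nat * nat :=
  if n is m.+1 then
    let: (i, s) := epoch_rec w m in
    if epoch_over w s m.+1 then (i.+1, m.+2) else (i, s)
  else (1, 1)%N.

(* i(t) and t(i(t)), for t >= 1. *)
Definition epoch (R : realType) (S : layered_space) (w : run R S) (t : nat) :
    nat :=
  (epoch_rec w t.-1).1.

Definition epoch_start (R : realType) (S : layered_space) (w : run R S)
    (t : nat) : nat :=
  (epoch_rec w t.-1).2.

Definition log_term (R : realType) (S : layered_space) (T : nat) (delta : R) :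
    R :=
  ln (T%:R * #|state S|%:R * #|action S|%:R / delta).

(* The estimates below are those of the epoch that starts with episode s. *)
Definition trans_est (R : realType) (S : layered_space) (w : run R S) (s : nat)
    (x : state S) (a : action S) (x' : state S) : R :=
  (visits3 w 1 s x a x')%:R / (maxn 1 (visits2 w 1 s x a))%:R.

Definition trans_radius (R : realType) (S : layered_space) (T : nat)
    (delta : R) (w : run R S) (s : nat) (x : state S) (a : action S) : R :=
  Num.sqrt (2 * (layer_size S (layer x).+1)%:R * log_term S T delta
            / (maxn 1 (visits2 w 1 s x a))%:R).

Definition conf_set (R : realType) (S : layered_space) (T : nat) (delta : R)
    (w : run R S) (s : nat) : set (state S -> action S -> state S -> R) :=
  [set P | is_transition P /\
     forall x a, x != x_last S ->
       \sum_x' `|P x a x' - trans_est w s x a x'|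
         <= trans_radius T delta w s x a].

Definition reward_ucb (R : realType) (S : layered_space) (T : nat) (delta : R)
    (w : run R S) (s : nat) (x : state S) (a : action S) : R :=
  let N := (maxn 1 (visits2 w 1 s x a))%:R in
  Num.min 1 (reward_sum w 1 s x a / N
             + Num.sqrt (2 * log_term S T delta / N)).

Definition uniform_occupancy (R : realType) (S : layered_space)
    (x : state S) (a : action S) (x' : state S) : R :=
  if next_layer x x' then
    ((layer_size S (layer x))%:R * #|action S|%:R
     * (layer_size S (layer x).+1)%:R)^-1
  else 0.

(* qhat i and pol i are the occupancy measure and the policy chosen by UCRL-LP
   for epoch i, on the observations w; only the epochs entered during the first
   T episodes are constrained. *)
Definition ucrl_lp (R : realType) (S : layered_space) (T : nat) (delta : R)
    (w : run R S) (qhat : nat -> state S -> action S -> state S -> R)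
    (pol : nat -> state S -> action S -> R) : Prop :=
  forall t : nat, (1 <= t <= T)%N ->
    let i := epoch w t in
    let s := epoch_start w t in
    [/\ i = 1%N -> qhat i = @uniform_occupancy R S,
        (2 <= i)%N ->
          occupancy_set (conf_set T delta w s) (qhat i) /\
          forall q, occupancy_set (conf_set T delta w s) q ->
            inner q (reward_ucb T delta w s)
              <= inner (qhat i) (reward_ucb T delta w s)
      & induced_policy (qhat i) (pol i)].

(* The random observations w are generated by the MDP M when the (random) policy
   mu t is executed in episode t. F t h is the information available in episode t
   once the h-th state is known and before the h-th action is drawn; it may
   contain more than the observations, e.g. the randomization used to break
   ties. [interact_law] says that, conditionally on F t h, the action, the
   realized reward and the next state have the law
   mu t (a | x_h) * reward_law x_h a * P (x' | x_h, a). *)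
Record interaction (R : realType) (S : layered_space) (M : layered_mdp R S)
    (T : nat) (d : measure_display) (Omega : measurableType d)
    (Pr : probability Omega R) (F : nat -> nat -> set (set Omega))
    (w : Omega -> run R S) (mu : nat -> Omega -> state S -> action S -> R) :
    Prop := Interaction {
  interact_sigma : forall t h, (1 <= t <= T)%N -> (h <= len S)%N ->
    sigma_algebra [set: Omega] (F t h) /\ F t h `<=` measurable;
  interact_step : forall t h, (1 <= t <= T)%N -> (h < len S)%N ->
    F t h `<=` F t h.+1;
  interact_episode : forall t, (1 <= t < T)%N -> F t (len S) `<=` F t.+1 0%N;
  interact_state : forall t h x, (1 <= t <= T)%N -> (h <= len S)%N ->
    F t h [set o | run_st (w o) t h = x];
  interact_action : forall t h a, (1 <= t <= T)%N -> (h < len S)%N ->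
    F t h.+1 [set o | run_ac (w o) t h = a];
  interact_reward : forall t h (B : set (measurableTypeR R)),
    (1 <= t <= T)%N -> (h < len S)%N -> measurable B ->
    F t h.+1 [set o | B (run_rw (w o) t h)];
  interact_policy : forall t x a (B : set (measurableTypeR R)),
    (1 <= t <= T)%N -> measurable B -> F t 0%N [set o | B (mu t o x a)];
  interact_start : forall t o, (1 <= t <= T)%N ->
    run_st (w o) t 0%N = x_first S;
  interact_law : forall t h x a x' (E : set Omega) (B : set (measurableTypeR R)),
    (1 <= t <= T)%N -> (h < len S)%N -> F t h E -> measurable B ->
    Pr (E `&` [set o | [/\ run_st (w o) t h = x, run_ac (w o) t h = a,
                           B (run_rw (w o) t h)
                         & run_st (w o) t h.+1 = x']])
    = ((\int[Pr]_(o in E `&` [set o | run_st (w o) t h = x]) (mu t o x a)%:E)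
       * reward_law M x a B * (trans M x a x')%:E)%E }.

Definition regret (R : realType) (S : layered_space) (M : layered_mdp R S)
    (T : nat) (pistar : state S -> action S -> R)
    (mu : nat -> state S -> action S -> R) : R :=
  T%:R * value M pistar - \sum_(1 <= t < T.+1) value M (mu t).

(* Main.v *)
(** By optimism, the regret of an episode run with the policy [pi] of an optimistic
    pair [(P', r')] is at most the difference of the values of [pi] under [(P', r')]
    and under the true model. Replacing [P'] by [P] one step at a time bounds it by
    the expectation, in the true model, of the sum of the errors [r' - r] plus
    [len S] times the L1 errors in the transitions at the visited pairs. These errors
    are at most a bonus of order [sqrt (1 / n)] after [n] visits, on the event that
    the true model lies in all confidence sets; for each pair, each [n] and each set
    of next states, Hoeffding's inequality for the process stopped at the [n]-th
    visit, and a union bound (an L1 distance is twice the largest excess over a set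
    of states), show that this event is likely. Finally, Azuma's inequality over the
    episodes turns expected bonuses into bonuses at the pairs actually visited, whose
    sum is controlled by [sum 1 / sqrt n <= 3 sqrt n] and by
    [sqrt (X_h X_(h+1)) <= (X_h + X_(h+1)) / 2]. *)
Require Import Defs.
From HB Require Import structures.
From mathcomp Require Import all_boot all_order all_algebra.
From mathcomp Require Import all_classical all_reals all_analysis.
From mathcomp Require Import measurable_realfun.
From mathcomp Require Import ring lra zify.

Set Implicit Arguments.
Unset Strict Implicit.
Unset Printing Implicit Defensive.

Import Order.TTheory GRing.Theory Num.Theory.
Import numFieldNormedType.Exports.

Local Open Scope classical_set_scope.
Local Open Scope ring_scope.

(** * Hoeffding's lemma *)

(** No conditional expectation appears. Conditioning is expressed by identities and inequalities
    between integrals against arbitrary nonnegative adapted weights; their integrands are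
    nonnegative, so integrability need not be discussed, and an exponential supermartingale arises
    by taking the exponential of the past as the weight. Randomness is confined to two bad sets:
    outside the first, the run satisfies deterministic inequalities on its counts ([good_run]);
    outside the second, Azuma's inequality holds. The bonus fed to Azuma's inequality must be known
    before the episode. It is a function of the current visit count alone, so that its measurability
    reduces to that of the counts and never involves the epochs or [qhat]; the doubling rule pays
    for passing from the count at the start of an epoch to the current one. The failure probability
    [5 * delta] splits into [delta] for each side of the reward bounds, [2 * delta] for the
    transitions and [delta] for Azuma's inequality. The constant 27 is 24 + 3: 24 = 8 * 3 comes from
    the bonus and the sum of inverse roots, 3 from the range of the bonuses in Azuma's
    inequality. *)

Section hoeffding_lemma.
Variable R : realType.

Lemma is_derive_ge0_le (f f' : R -> R) (x : R) :
  (forall y : R, 0 <= y -> is_derive y 1 f (f' y)) -> (forall y : R, 0 <= y -> 0 <= f' y) ->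
  0 <= x -> f 0 <= f x.
Proof.
move=> df f'0; rewrite le_eqVlt => /predU1P[<-//|x0].
have [| |c] := @MVT R f f' 0 x x0.
- by move=> y; rewrite in_itv/= => /andP[/ltW y0 _]; exact: df.
- apply: derivable_within_continuous => y; rewrite in_itv/= => /andP[y0 _].
  by have [] := df y y0.
rewrite in_itv/= => /andP[/ltW c0 _] fxE.
by rewrite -subr_ge0 fxE subr0 mulr_ge0 ?f'0// ltW.
Qed.

(** The gap [f] between the two exponents and its derivative [g] vanish at 0, and the second
    derivative is nonnegative: with [u = p * expR x], it is
    [1/4 - u * (1 - p) / (u + (1 - p)) ^+ 2], which is the inequality between the arithmetic and
    geometric means. *)
Lemma hoeffding_bernoulli_ge0 (p s : R) : 0 <= p <= 1 -> 0 <= s ->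
  (1 - p) + p * expR s <= expR (p * s + s ^+ 2 / 8).
Proof.
move=> /andP[p0 p1] s0.
pose D (x : R) := (1 - p) + p * expR x.
have D0 x : 0 <= x -> 0 < D x.
  move=> x0; have : 1 <= expR x by rewrite -expR0 ler_expR.
  rewrite /D; nra.
have dD (x : R) : is_derive x 1 D (p * expR x).
  by apply: is_derive_eq; rewrite add0r mul1r.
pose f x : R := x ^+ 2 / 8 + p * x - ln (D x).
pose g x : R := x / 4 + p - p * expR x / D x.
have df (x : R) : 0 <= x -> is_derive x 1 f (g x).
  move=> x0; have Dx := D0 x x0.
  have dl : is_derive x 1 (fun y : R => ln (D y)) ((D x)^-1 * (p * expR x)).
    exact: (@is_derive1_comp R (@ln R) D _ _ _ (is_derive1_ln Dx) (dD x)).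
  apply: is_derive_eq.
  rewrite /g /= !scaler0 ?add0r ?addr0 /GRing.scale /=; lra.
have dg (x : R) : 0 <= x -> is_derive x 1 g (4^-1 - p * expR x * (1 - p) / D x ^+ 2).
  move=> x0; have Dx := lt0r_neq0 (D0 x x0).
  have dV : is_derive x 1 (fun y : R => (D y)^-1) (- D x ^- 2 *: (p * expR x)).
    exact: is_deriveV.
  apply: is_derive_eq.
  rewrite /= !scaler0 ?add0r ?addr0 /GRing.scale /=.
  move: Dx; rewrite /D => Dx; field.
  exact: Dx.
have g0 x : 0 <= x -> 0 <= g x.
  move=> x0; apply: le_trans (_ : g 0 <= _).
    by rewrite /g /D expR0 mul0r !mulr1 subrK divr1 add0r subrr.
  apply: is_derive_ge0_le dg _ x0 => y y0; have Dy := D0 y y0.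
  rewrite subr_ge0 ler_pdivrMr ?exprn_gt0// /D.
  by set u := p * expR y; have := sqr_ge0 (1 - p - u); rewrite !expr2; lra.
have f0 : f 0 <= f s by apply: is_derive_ge0_le df _ s0.
rewrite -/(D s) -(lnK (D0 s s0)) ler_expR.
move: f0; rewrite /f {1}/D expR0 mulr1 subrK ln1; lra.
Qed.

(* The case [s < 0] reduces to the other one by exchanging the two outcomes. *)
Lemma hoeffding_bernoulli (p s : R) : 0 <= p <= 1 ->
  (1 - p) + p * expR s <= expR (p * s + s ^+ 2 / 8).
Proof.
move=> /andP[p0 p1]; have [|/ltW s0] := leP 0 s.
  by apply: hoeffding_bernoulli_ge0; rewrite p0.
have -> : 1 - p + p * expR s = expR s * (1 - (1 - p) + (1 - p) * expR (- s)).
  by rewrite expRN; field; rewrite gt_eqF ?expR_gt0.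
rewrite (_ : p * s + _ = s + ((1 - p) * (- s) + (- s) ^+ 2 / 8)); last by field.
rewrite expRD ler_wpM2l ?expR_ge0//; apply: hoeffding_bernoulli_ge0; lra.
Qed.

Lemma expR_chord (s y : R) : 0 <= y <= 1 -> expR (s * y) <= 1 - y + y * expR s.
Proof.
move=> /andP[y0 y1].
have := @convex_expR R (Itv01 y0 y1) s 0.
rewrite !convRE /= /unstable.onem expR0 mulr0 addr0 mulr1 addrC mulrC.
by [].
Qed.

(** The chord of the exponential over [[0, c]] replaces [Y] by a two-valued variable with the same
    mean, which reduces the claim to the Bernoulli case with parameter [m / c]. The sign, mean minus
    value, is the one in which Azuma's inequality bounds expected bonuses by realized ones. *)
Lemma hoeffding_sum (I : finType) (q Y : I -> R) (c s : R) :
  (forall i, 0 <= q i) -> \sum_i q i = 1 -> 0 < c -> (forall i, 0 <= Y i <= c) ->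
  \sum_i q i * expR (s * (\sum_j q j * Y j - Y i)) <= expR (s ^+ 2 * c ^+ 2 / 8).
Proof.
move=> q0 q1 c0 Yc; set m := \sum_j q j * Y j.
have mE : \sum_i q i * (Y i / c) = m / c.
  by rewrite /m mulr_suml; apply: eq_bigr => i _; rewrite mulrA.
clearbody m.
have Yc1 i : 0 <= Y i / c <= 1.
  have /andP[? ?] := Yc i; rewrite ler_pdivrMr// mul1r divr_ge0//=; exact: ltW.
have m01 : 0 <= m / c <= 1.
  rewrite -mE; apply/andP; split.
    by apply: sumr_ge0 => i _; rewrite mulr_ge0//; have /andP[] := Yc1 i.
  by rewrite -q1; apply: ler_sum => i _; rewrite ler_piMr//; have /andP[] := Yc1 i.
have -> : s ^+ 2 * c ^+ 2 / 8 = s * m + (m / c * (- s * c) + (- s * c) ^+ 2 / 8).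
  by field; exact: lt0r_neq0.
rewrite expRD; have [em emE] : exists em, em = expR (s * m) by eexists.
have em0 : 0 <= em by rewrite emE expR_ge0.
rewrite -emE.
apply: le_trans (ler_wpM2l em0 (hoeffding_bernoulli _ m01)).
rewrite -mE mulrDr -[X in _ * (X - _)]q1 -sumrB mulr_suml !mulr_sumr -big_split/=.
apply: ler_sum => i _.
have := expR_chord (- s * c) (Yc1 i).
rewrite (_ : - s * c * (Y i / c) = - s * Y i); last by field; exact: lt0r_neq0.
move=> h; rewrite mulrBr expRD -mulNr -emE.
apply: le_trans (_ : q i * (em * (1 - Y i / c + Y i / c * expR (- s * c))) <= _).
  by rewrite ler_wpM2l// ler_wpM2l.
rewrite le_eqVlt; apply/orP; left; apply/eqP; ring.
Qed.

End hoeffding_lemma.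

(** * Integrals against a sub-sigma-algebra *)

Section sub_sigma_algebra.
Context d (T : measurableType d) (R : realType).

(** Stated through the measurable type generated by [G], so that the general closure properties of
    measurable functions and the approximation by simple functions apply to a sub-sigma-algebra. *)
Definition adapted (G : set (set T)) (W : T -> R) : Prop :=
  measurable_fun setT (W : g_sigma_algebraType G -> R).

Lemma adaptedP (G : set (set T)) (W : T -> R) : sigma_algebra setT G ->
  adapted G W <-> forall B, measurable B -> G (W @^-1` B).
Proof.
move=> sG; have GE := measurable_g_measurableTypeE sG.
split=> [mW B mB|mW _ B mB]; last by rewrite setTI GE; exact: mW.
by have := mW measurableT B mB; rewrite setTI GE.
Qed.

Lemma adapted_sub (G G' : set (set T)) (W : T -> R) : sigma_algebra setT G ->
  sigma_algebra setT G' -> G `<=` G' -> adapted G W -> adapted G' W.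
Proof. by move=> sG sG' GG' /(adaptedP _ sG) mW; apply/adaptedP => // B /mW /GG'. Qed.

Lemma adapted_measurable (G : set (set T)) (W : T -> R) : sigma_algebra setT G ->
  G `<=` measurable -> adapted G W -> measurable_fun setT W.
Proof.
by move=> sG GT /(adaptedP _ sG) mW _ B mB; rewrite setTI; exact/GT/mW.
Qed.

Import HBNNSimple.

(** The substitute for conditional expectations: two functions with equal integrals over all events
    of [G] have equal integrals against all nonnegative adapted weights. The identity passes from
    indicators to simple weights by linearity, then to [W] by monotone convergence, infinite
    integrals included. *)
Lemma subsigma_integral (mu : {measure set T -> \bar R}) (G : set (set T))
    (f g W : T -> R) :
  sigma_algebra setT G -> G `<=` measurable ->
  measurable_fun setT f -> measurable_fun setT g ->
  (forall x, 0 <= f x) -> (forall x, 0 <= g x) ->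
  (forall E, G E -> (\int[mu]_(x in E) (f x)%:E = \int[mu]_(x in E) (g x)%:E)%E) ->
  adapted G W -> (forall x, 0 <= W x) ->
  (\int[mu]_x (W x * f x)%:E = \int[mu]_x (W x * g x)%:E)%E.
Proof.
move=> sG GT mf mg f0 g0 fg mW W0.
have GE := measurable_g_measurableTypeE sG.
have mW' : measurable_fun setT (EFin \o (W : g_sigma_algebraType G -> R)).
  exact/measurable_EFinP.
(* The approximation is taken in the type generated by [G], so that the level sets of [h n] lie in
   [G], where [fg] applies. *)
pose h := nnsfun_approx measurableT mW'.
have mh n : measurable_fun setT (h n : T -> R).
  by apply: (adapted_measurable sG GT); exact: measurable_funP.
have hI (k : T -> R) : measurable_fun setT k -> (forall x, 0 <= k x) ->
  (\int[mu]_x (W x * k x)%:E = limn (fun n => \int[mu]_x (h n x * k x)%:E))%E.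
  move=> mk k0; rewrite -monotone_convergence//.
  - apply: eq_integral => x _; apply/esym/cvg_lim => //.
    apply: cvg_EFin; first by near=> n.
    apply: cvgM; last exact: cvg_cst.
    have := cvg_nnsfun_approx measurableT mW' (fun y _ => W0 y) (I : setT x).
    by move/fine_cvg.
  - by move=> n; apply/measurable_EFinP/measurable_funM.
  - by move=> n x _; rewrite lee_fin mulr_ge0.
  - move=> x _ m n mn; rewrite lee_fin ler_wpM2r//.
    by have /lefP/(_ x) := nd_nnsfun_approx measurableT mW' mn.
rewrite (hI f)// (hI g)//; congr (limn _); apply/funext => n.
have hG r : G (h n @^-1` [set r]).
  have /(_ (h n) _ (measurable_set1 r)) := @measurable_funPTI _ _ (g_sigma_algebraType G) R.
  by rewrite GE.
have mS r : measurable (h n @^-1` [set r] : set T) by exact/GT/hG.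
have hS (k : T -> R) : measurable_fun setT k -> (forall x, 0 <= k x) ->
  (\int[mu]_x (h n x * k x)%:E = \sum_(y \in range (h n)) (y%:E * \int[mu]_(x in h n @^-1` [set y]) (k x)%:E))%E.
  move=> mk k0.
  pose F y (x : T) := (y * \1_(h n @^-1` [set y]) x * k x)%:E.
  have mF y : measurable_fun setT (F y).
    apply/measurable_EFinP/measurable_funM => //; apply: measurable_funM => //; exact: measurable_indic.
  transitivity (\int[mu]_x (\sum_(y \in range (h n)) F y x))%E.
    apply: eq_integral => x _; rewrite fsumEFin// (fimfunE (h n) x).
    by rewrite !fsbig_finite//= mulr_suml.
  rewrite ge0_integral_fsum//; last first.
    by move=> y x _; rewrite lee_fin mulr_ge0// -lee_fin nnfun_muleindic_ge0.
  apply: eq_fsbigr => y; rewrite inE => -[z _ hz].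
  under eq_integral do rewrite /F -mulrA EFinM.
  rewrite ge0_integralZl//; last 3 first.
  - by apply/measurable_EFinP/measurable_funM => //; exact: measurable_indic.
  - by move=> x _; rewrite lee_fin mulr_ge0.
  - by rewrite lee_fin -hz.
  congr (_ * _)%E; rewrite [RHS]integral_mkcond; apply: eq_integral => x _.
  by rewrite epatch_indic/= muleC.
rewrite (hS f)// (hS g)//; apply: eq_fsbigr => y _; congr (_ * _)%E.
exact: fg.
Unshelve. all: end_near. Qed.
End sub_sigma_algebra.

(** * Values and occupancy measures *)

Section trajectory_sums.
Variables (X A : finType).

Definition path_type n : finType := ({ffun 'I_n.+1 -> X} * {ffun 'I_n -> A})%type.

Definition path_cons n (x : X) (a : A) (tau : path_type n) : path_type n.+1 :=
  ([ffun i => oapp tau.1 x (unlift ord0 i)], [ffun i => oapp tau.2 a (unlift ord0 i)]).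

Definition path_behead n (tau : path_type n.+1) : path_type n :=
  ([ffun i => tau.1 (lift ord0 i)], [ffun i => tau.2 (lift ord0 i)]).

Arguments path_cons : simpl never.

Lemma path_cons1_0 n x a (tau : path_type n) : (path_cons x a tau).1 ord0 = x.
Proof. by rewrite ffunE unlift_none. Qed.

Lemma path_cons2_0 n x a (tau : path_type n) : (path_cons x a tau).2 ord0 = a.
Proof. by rewrite ffunE unlift_none. Qed.

Lemma path_cons1_lift n x a (tau : path_type n) i :
  (path_cons x a tau).1 (lift ord0 i) = tau.1 i.
Proof. by rewrite ffunE liftK. Qed.

Lemma path_cons2_lift n x a (tau : path_type n) i :
  (path_cons x a tau).2 (lift ord0 i) = tau.2 i.
Proof. by rewrite ffunE liftK. Qed.

Lemma path_behead_cons n x a (tau : path_type n) : path_behead (path_cons x a tau) = tau.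
Proof.
by case: tau => s b; congr pair; apply/ffunP => i; rewrite ffunE ?path_cons1_lift ?path_cons2_lift.
Qed.

Lemma path_cons_behead n (tau : path_type n.+1) :
  path_cons (tau.1 ord0) (tau.2 ord0) (path_behead tau) = tau.
Proof.
case: tau => s b; congr pair; apply/ffunP => i; rewrite ffunE;
  by case: unliftP => [j|] -> //=; rewrite ffunE.
Qed.

(** Splitting off the first state and action turns sums over trajectories into the recursion of
    [value_to_go]. The inner sum is grouped by the next state because the induction hypotheses fix
    the initial state. *)
Lemma sum_path_recl (R : nmodType) n (x : X) (Phi : path_type n.+1 -> R) :
  \sum_(tau : path_type n.+1 | tau.1 ord0 == x) Phi tau =
  \sum_a \sum_x' \sum_(tau : path_type n | tau.1 ord0 == x') Phi (path_cons x a tau).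
Proof.
rewrite (reindex_onto (fun p : A * path_type n => path_cons x p.1 p.2)
  (fun tau => (tau.2 ord0, path_behead tau))); last first.
  by move=> tau /eqP <-; rewrite path_cons_behead.
rewrite (eq_bigl xpredT) => [|[a tau]]; last first.
  by rewrite path_behead_cons path_cons1_0 path_cons2_0 !eqxx.
rewrite -(pair_bigA _ (fun a tau => Phi (path_cons x a tau)))/=.
apply: eq_bigr => a _.
by rewrite (partition_big (fun tau : path_type n => tau.1 ord0) predT).
Qed.
End trajectory_sums.

Section layered_values.
Variables (R : realType) (S : layered_space).
Implicit Types (P : state S -> action S -> state S -> R)
  (pi : state S -> action S -> R) (f g : state S -> action S -> R).

(** The Bellman recursion over [n] remaining steps. Rewards, bonuses and indicators of visits all
    take the place of [f], so that regret, expected bonuses and occupancy measures are compared in a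
    single form. *)
Fixpoint value_to_go P pi f (n : nat) (x : state S) : R :=
  if n is m.+1 then
    \sum_a pi x a * (f x a + \sum_x' P x a x' * value_to_go P pi f m x')
  else 0.

Definition path_weight P pi n (tau : path_type (state S) (action S) n) : R :=
  \prod_(h < n) (pi (tau.1 (widen_ord (leqnSn _) h)) (tau.2 h) *
    P (tau.1 (widen_ord (leqnSn _) h)) (tau.2 h) (tau.1 (lift ord0 h))).

Definition path_sum f n (tau : path_type (state S) (action S) n) : R :=
  \sum_(h < n) f (tau.1 (widen_ord (leqnSn _) h)) (tau.2 h).

Lemma widen_lift0 n (h : 'I_n) :
  widen_ord (leqnSn n.+1) (lift ord0 h) = lift ord0 (widen_ord (leqnSn n) h).
Proof. exact: val_inj. Qed.

Lemma widen_ord0 n : widen_ord (leqnSn n.+1) ord0 = ord0.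
Proof. exact: val_inj. Qed.

Lemma path_weight_cons P pi n x a (tau : path_type (state S) (action S) n) :
  path_weight P pi (path_cons x a tau) =
  pi x a * P x a (tau.1 ord0) * path_weight P pi tau.
Proof.
rewrite /path_weight big_ord_recl; congr (_ * _).
  by rewrite widen_ord0 path_cons1_0 path_cons2_0 path_cons1_lift.
by apply: eq_bigr => h _; rewrite widen_lift0 !path_cons1_lift path_cons2_lift.
Qed.

Lemma path_sum_cons f n x a (tau : path_type (state S) (action S) n) :
  path_sum f (path_cons x a tau) = f x a + path_sum f tau.
Proof.
rewrite /path_sum big_ord_recl; congr (_ + _).
  by rewrite widen_ord0 path_cons1_0 path_cons2_0.
by apply: eq_bigr => h _; rewrite widen_lift0 path_cons1_lift path_cons2_lift.
Qed.

Lemma layer_lt_neq_last (x : state S) : (layer x < len S)%N -> x != x_last S.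
Proof. by rewrite -layer_last -val_eqE/= => /ltn_eqF ->. Qed.

Lemma trans_next P x a x' : is_transition P -> P x a x' != 0 ->
  layer x' = (layer x).+1 :> nat.
Proof. by move=> [P0 Pn _] Pne0; apply/eqP/(Pn x a x'); rewrite lt0r Pne0 P0. Qed.

Lemma trans_last P a x' : is_transition P -> P (x_last S) a x' = 0.
Proof.
move=> tP; apply/eqP/negP => /negP /(trans_next tP) h.
have /eqP lE : layer (x_last S) == ord_max by rewrite layer_last.
by have := ltn_ord (layer x'); rewrite h lE ltnn.
Qed.

Lemma trans_sum1 P x a : is_transition P -> (layer x < len S)%N -> \sum_x' P x a x' = 1.
Proof. by move=> [_ _ P1] xl; apply/P1/layer_lt_neq_last. Qed.

Lemma trans_sum_le1 P x a : is_transition P -> \sum_x' P x a x' <= 1.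
Proof.
move=> tP; have [->|xl] := eqVneq x (x_last S).
  by rewrite big1 ?ler01// => x' _; rewrite trans_last.
by have [_ _ ->] := tP.
Qed.

(** The hypothesis on [layer x] makes the path end exactly in the last layer. A longer path would
    have to leave [x_last], where the transition function is zero and the mass is lost. *)
Lemma path_weight_sum1 P pi n x : is_transition P -> is_policy pi ->
  (layer x + n = len S)%N ->
  \sum_(tau : path_type (state S) (action S) n | tau.1 ord0 == x) path_weight P pi tau = 1.
Proof.
move=> tP [p0 p1]; elim: n x => [|n IHn] x xn.
  rewrite (big_pred1 ([ffun=> x], ffun0 (card_ord 0))).
    by rewrite /path_weight big_ord0.
  move=> [s b] /=; apply/eqP/eqP => [sx|[-> _]]; last by rewrite ffunE.
  congr pair; apply/ffunP => i; last by case: i.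
  by rewrite ffunE (ord1 i).
rewrite sum_path_recl -[RHS](p1 x); apply: eq_bigr => a _.
rewrite -[RHS]mulr1 -[X in _ = _ * X](trans_sum1 a tP (x := x)); last by move: xn; lia.
rewrite mulr_sumr; apply: eq_bigr => x' _.
transitivity (pi x a * P x a x' *
    \sum_(tau : path_type (state S) (action S) n | tau.1 ord0 == x') path_weight P pi tau).
  by rewrite mulr_sumr; apply: eq_bigr => tau /eqP <-; rewrite path_weight_cons.
have [->|/(trans_next tP) xx'] := eqVneq (P x a x') 0; first by rewrite !mulr0 mul0r.
by rewrite IHn ?mulr1// xx' addSnnS.
Qed.

Lemma path_value P pi f n x : is_transition P -> is_policy pi ->
  (layer x + n = len S)%N ->
  \sum_(tau : path_type (state S) (action S) n | tau.1 ord0 == x)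
     path_weight P pi tau * path_sum f tau = value_to_go P pi f n x.
Proof.
move=> tP pip; elim: n x => [|n IHn] x xn.
  by rewrite big1// => tau _; rewrite /path_sum big_ord0 mulr0.
rewrite sum_path_recl /=; apply: eq_bigr => a _.
rewrite -[f x a]mulr1 -(trans_sum1 a tP (x := x)); last by move: xn; lia.
rewrite mulr_sumr -big_split mulr_sumr; apply: eq_bigr => x' _ /=.
transitivity (pi x a * P x a x' * (f x a *
    \sum_(tau : path_type (state S) (action S) n | tau.1 ord0 == x') path_weight P pi tau
    + \sum_(tau : path_type (state S) (action S) n | tau.1 ord0 == x')
         path_weight P pi tau * path_sum f tau)).
  rewrite mulr_sumr -big_split mulr_sumr; apply: eq_bigr => tau /eqP <- /=.
  by rewrite path_weight_cons path_sum_cons; ring.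
have [->|/(trans_next tP) xx'] := eqVneq (P x a x') 0.
  by rewrite !(mulr0, mul0r, addr0).
by rewrite path_weight_sum1 ?IHn//; [ring| |]; rewrite xx' addSnnS.
Qed.

Lemma layer_x_first : layer (x_first S) = 0%N :> nat.
Proof. by have /eqP -> : layer (x_first S) == ord0 by rewrite layer_first. Qed.

Lemma traj_probE P pi (tau : traj S) :
  traj_prob P pi tau = if tau.1 ord0 == x_first S then path_weight P pi tau else 0.
Proof. by rewrite /traj_prob; case: eqP => _; rewrite ?mul1r ?mul0r. Qed.

Lemma traj_prob_ge0 P pi tau : is_transition P -> is_policy pi -> 0 <= traj_prob P pi tau.
Proof.
move=> [P0 _ _] [p0 _]; rewrite /traj_prob mulr_ge0//.
by apply: prodr_ge0 => h _; rewrite mulr_ge0.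
Qed.

Lemma traj_prob_sum1 P pi : is_transition P -> is_policy pi ->
  \sum_(tau : traj S) traj_prob P pi tau = 1.
Proof.
move=> tP pip; under eq_bigr do rewrite traj_probE.
by rewrite -big_mkcond/= (path_weight_sum1 tP pip)// layer_x_first.
Qed.

Lemma traj_value P pi f : is_transition P -> is_policy pi ->
  \sum_(tau : traj S) traj_prob P pi tau * \sum_(h < len S) f (st tau h) (ac tau h) =
  value_to_go P pi f (len S) (x_first S).
Proof.
move=> tP pip; rewrite -(path_value f tP pip) ?layer_x_first// [RHS]big_mkcond/=.
by apply: eq_bigr => tau _; rewrite traj_probE; case: ifP; rewrite ?mul0r.
Qed.

Lemma traj_prob_layer P pi tau : is_transition P -> traj_prob P pi tau != 0 ->
  forall k : 'I_(len S).+1, layer (tau.1 k) = k :> nat.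
Proof.
move=> tP; rewrite /traj_prob mulf_eq0 negb_or => /andP[].
rewrite pnatr_eq0 eqb0 negbK => /eqP t0 tn0.
move=> [k]; elim: k => [|k IHk] kl.
  by rewrite (_ : Ordinal kl = ord0) ?t0 ?layer_x_first//; exact: val_inj.
have kl' : (k < len S)%N by [].
have Pn0 : P (st tau (Ordinal kl')) (ac tau (Ordinal kl')) (st_next tau (Ordinal kl')) != 0.
  move: tn0; rewrite (bigD1 (Ordinal kl'))//= !mulf_eq0 !negb_or.
  by move=> /andP[/andP[]].
rewrite (_ : Ordinal kl = lift ord0 (Ordinal kl')); last exact: val_inj.
rewrite (trans_next tP Pn0) /st (_ : widen_ord _ _ = Ordinal (ltnW kl)) ?IHk//.
exact: val_inj.
Qed.

Definition visit_indic (x : state S) (a : action S) (y : state S) (b : action S) : R :=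
  ((y == x) && (b == a))%:R.

(** On a trajectory of nonzero probability, [x] can occur only at step [layer x]. Hence the event
    defining [occupancy] holds for exactly one [x'] if the trajectory visits [(x, a)] and for none
    otherwise, which is the number of visits. *)
Lemma occupancy_sum P pi x a : is_transition P -> is_policy pi ->
  \sum_x' occupancy P pi x a x' =
  value_to_go P pi (visit_indic x a) (len S) (x_first S).
Proof.
move=> tP pip; rewrite -traj_value// /occupancy.
under eq_bigr do rewrite big_mkcond/=.
rewrite exchange_big/=; apply: eq_bigr => tau _; rewrite -big_mkcond/=.
have [->|/(traj_prob_layer tP) lt] := eqVneq (traj_prob P pi tau) 0.
  by rewrite mul0r big1.
rewrite sumr_const -mulr_natr; congr (_ * _).
have hE h : st tau h = x -> h = layer x :> nat.
  by move=> <-; rewrite /st lt.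
case: (pickP (fun h => (st tau h == x) && (ac tau h == a))) => [h /andP[/eqP hx /eqP ha]|hn].
  rewrite (bigD1 h)//= big1 => [|k kh]; last first.
    rewrite /visit_indic; case: eqP => //= kx; case/negP: kh; apply/eqP/val_inj.
    by rewrite /= (hE k kx) (hE h hx).
  rewrite /visit_indic hx ha !eqxx addr0 (_ : #|_| = 1%N)//.
  rewrite -(card1 (st_next tau h)); apply: eq_card => x'; rewrite !inE unfold_in.
  apply/existsP/eqP => [[k /and4P[/eqP kl /eqP kx _ /eqP <-]]|->].
    by congr (st_next tau _); apply: val_inj; rewrite /= kl (hE h hx).
  by exists h; rewrite hx ha !eqxx (hE h hx) eqxx.
rewrite big1 => [|h _]; last by rewrite /visit_indic hn.
rewrite (_ : #|_| = 0%N)//; apply: eq_card0 => x'; rewrite unfold_in.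
by apply/existsP => -[k /and4P[_ kx ka _]]; have := hn k; rewrite kx ka.
Qed.

Lemma occupancy_next P pi x a x' : is_transition P ->
  ~~ next_layer x x' -> occupancy P pi x a x' = 0.
Proof.
move=> tP xx'; rewrite /occupancy big1// => tau /existsP[h /and4P[_ /eqP hx _ /eqP hx']].
apply/eqP; apply: contraR xx' => /(traj_prob_layer tP) lt.
by rewrite /next_layer -hx -hx' /st /st_next !lt.
Qed.

Lemma value_to_go_sum P pi (I : finType) (c : I -> R) (F : I -> state S -> action S -> R) n x :
  value_to_go P pi (fun y b => \sum_i c i * F i y b) n x =
  \sum_i c i * value_to_go P pi (F i) n x.
Proof.
elim: n x => [|n IHn] x /=; first by rewrite big1// => i _; rewrite mulr0.
under [RHS]eq_bigr do rewrite mulr_sumr.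
rewrite [RHS]exchange_big/=; apply: eq_bigr => a _.
under [RHS]eq_bigr do rewrite mulrCA.
rewrite -mulr_sumr; congr (_ * _).
under [RHS]eq_bigr do rewrite mulrDr.
rewrite big_split/=; congr (_ + _).
under [RHS]eq_bigr do rewrite mulr_sumr.
rewrite [RHS]exchange_big/=; apply: eq_bigr => x' _.
by rewrite IHn mulr_sumr; apply: eq_bigr => i _; rewrite mulrCA.
Qed.

Lemma eq_value_to_go P pi f g n x : (forall y b, f y b = g y b) ->
  value_to_go P pi f n x = value_to_go P pi g n x.
Proof.
move=> fg; elim: n x => //= n IHn x; apply: eq_bigr => a _.
by rewrite fg; congr (_ * (_ + _)); apply: eq_bigr => x' _; rewrite IHn.
Qed.

(** By linearity of [value_to_go]: [f] is the combination of the indicators of the pairs, with its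
    own values as coefficients. *)
Lemma inner_occupancy P pi f : is_transition P -> is_policy pi ->
  inner (occupancy P pi) f = value_to_go P pi f (len S) (x_first S).
Proof.
move=> tP pip.
transitivity (\sum_(p : state S * action S) f p.1 p.2 *
    value_to_go P pi (visit_indic p.1 p.2) (len S) (x_first S)).
  rewrite -(pair_bigA _ (fun x a => f x a * value_to_go P pi (visit_indic x a) _ _))/=.
  apply: eq_bigr => x _; apply: eq_bigr => a _.
  by rewrite -occupancy_sum// -mulr_suml mulrC.
rewrite -value_to_go_sum; apply: eq_value_to_go => y b.
rewrite (bigD1 (y, b))//= big1 => [|[x a]]; rewrite /visit_indic/=.
  by rewrite !eqxx mulr1 addr0.
by rewrite xpair_eqE ![y == x]eq_sym ![b == a]eq_sym => /negbTE ->; rewrite mulr0.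
Qed.

End layered_values.

(** * Simulation and optimism *)

Section optimism.
Variables (R : realType) (S : layered_space).
Implicit Types (P : state S -> action S -> state S -> R)
  (pi : state S -> action S -> R) (f g : state S -> action S -> R).

Lemma value_to_go_ge0 P pi f n x : is_transition P -> is_policy pi ->
  (forall y b, 0 <= f y b) -> 0 <= value_to_go P pi f n x.
Proof.
move=> [P0 _ _] [p0 _] f0; elim: n x => //= n IHn x.
apply: sumr_ge0 => a _; rewrite mulr_ge0// addr_ge0//.
by apply: sumr_ge0 => x' _; rewrite mulr_ge0.
Qed.

Lemma value_to_go_le P pi f n x : is_transition P -> is_policy pi ->
  (forall y b, f y b <= 1) -> value_to_go P pi f n x <= n%:R.
Proof.
move=> tP pip f1; have [P0 _ _] := tP; have [p0 p1] := pip.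
elim: n x => [|n IHn] x //; rewrite -[leRHS]mul1r -[X in X * _](p1 x) mulr_suml.
apply: ler_sum => a _; rewrite ler_wpM2l// -natr1 addrC lerD//.
apply: le_trans (_ : \sum_x' P x a x' * n%:R <= _).
  by apply: ler_sum => x' _; rewrite ler_wpM2l.
by rewrite -mulr_suml ler_piMl// trans_sum_le1.
Qed.

Lemma ler_value_to_go P pi f g n x : is_transition P -> is_policy pi ->
  (forall y b, f y b <= g y b) -> value_to_go P pi f n x <= value_to_go P pi g n x.
Proof.
move=> [P0 _ _] [p0 _] fg; elim: n x => //= n IHn x.
apply: ler_sum => a _; rewrite ler_wpM2l// lerD//.
by apply: ler_sum => x' _; rewrite ler_wpM2l.
Qed.

(* Replacing [P'] by [P] one step at a time costs [len S] times the L1 distance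
   of the transitions at every visited state. *)
Lemma simulation P P' pi f f' g n x :
  is_transition P -> is_transition P' -> is_policy pi ->
  (forall y b, 0 <= f' y b <= 1) ->
  (forall y b, y != x_last S ->
    f' y b - f y b + (len S)%:R * \sum_x' `|P' y b x' - P y b x'| <= g y b) ->
  (layer x + n = len S)%N ->
  value_to_go P' pi f' n x <= value_to_go P pi f n x + value_to_go P pi g n x.
Proof.
move=> tP tP' pip f'01 fg; have [P0 _ _] := tP; have [p0 _] := pip.
elim: n x => [|n IHn] x xn /=; first by rewrite addr0.
rewrite -big_split/=; apply: ler_sum => a _; rewrite -mulrDr ler_wpM2l//.
set J' := value_to_go P' pi f' n; set J := value_to_go P pi f n.
set Jg := value_to_go P pi g n.
have xl : x != x_last S by apply: layer_lt_neq_last; move: xn; lia.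
have J'len y : `|J' y| <= (len S)%:R.
  rewrite ger0_norm; last first.
    by apply: value_to_go_ge0 => // z b; have /andP[] := f'01 z b.
  apply: le_trans (_ : n%:R <= _); last by rewrite ler_nat; move: xn; lia.
  by apply: value_to_go_le => // z b; have /andP[] := f'01 z b.
have step1 : \sum_x' P' x a x' * J' x' <=
    (len S)%:R * \sum_x' `|P' x a x' - P x a x'| + \sum_x' P x a x' * J' x'.
  rewrite mulr_sumr -big_split/=; apply: ler_sum => x' _.
  rewrite -lerBlDr -mulrBl; apply: le_trans (ler_norm _) _.
  by rewrite normrM mulrC ler_wpM2r.
have step2 : \sum_x' P x a x' * J' x' <=
    \sum_x' P x a x' * J x' + \sum_x' P x a x' * Jg x'.
  rewrite -big_split/=; apply: ler_sum => x' _; rewrite -mulrDr.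
  have [->|/(trans_next tP) xx'] := eqVneq (P x a x') 0; first by rewrite !mul0r.
  by rewrite ler_wpM2l// IHn// xx' addSnnS.
have := fg x a xl; lra.
Qed.

(** The induced policy is [pi] wherever the mass [rho] is nonzero and arbitrary elsewhere. The point
    is that a state of zero mass is never reached, so that the arbitrary choice does not affect the
    value. *)
Lemma value_to_go_induced P pi pol f : is_transition P -> is_policy pi ->
  induced_policy (occupancy P pi) pol ->
  value_to_go P pol f (len S) (x_first S) = value_to_go P pi f (len S) (x_first S).
Proof.
move=> tP pip [polp polE]; have [P0 _ _] := tP; have [p0 p1] := pip.
pose rho x := value_to_go P pi (fun y _ => (y == x)%:R) (len S) (x_first S).
have visitE x a : value_to_go P pi (visit_indic R x a) (len S) (x_first S) = pi x a * rho x.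
  rewrite /rho; elim: (len S) (x_first S) => [|n IHn] y /=; first by rewrite mulr0.
  under eq_bigr do rewrite mulrDr.
  under [in RHS]eq_bigr do rewrite mulrDr.
  rewrite !big_split/= mulrDr; congr (_ + _).
    rewrite -mulr_suml p1 mul1r (bigD1 a)//= big1 => [|b /negbTE ba].
      by rewrite /visit_indic eqxx andbT addr0; case: eqP => [->//|]; rewrite !mulr0.
    by rewrite /visit_indic ba andbF mulr0.
  rewrite mulr_sumr; apply: eq_bigr => b _; rewrite mulrCA; congr (_ * _).
  by rewrite mulr_sumr; apply: eq_bigr => x' _; rewrite IHn mulrCA.
have occE x a : \sum_(x' | next_layer x x') occupancy P pi x a x' = pi x a * rho x.
  rewrite -visitE -occupancy_sum// [RHS](bigID (next_layer x))/= [X in _ = _ + X]big1 ?addr0//.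
  by move=> x'; exact: occupancy_next.
have polpi x a : rho x != 0 -> pol x a = pi x a.
  move=> rx; have := polE x a; under eq_bigr do rewrite occE.
  by rewrite -mulr_suml p1 mul1r occE => ->//; rewrite mulfK.
(* The expected number of visits to states of zero mass is a sum of terms [(rho x == 0)%:R * rho x],
   hence zero. Being a sum of nonnegative terms, it stays zero after every step of positive
   probability; the induction thus meets only states with [rho y != 0], where [pol] and [pi]
   agree. *)
pose bad (y : state S) (_ : action S) : R := (rho y == 0)%:R.
have bad0 y b : 0 <= bad y b by rewrite /bad ler0n.
have : value_to_go P pi bad (len S) (x_first S) = 0.
  rewrite (@eq_value_to_go _ _ _ _ _ (fun y b => \sum_x (rho x == 0)%:R * (y == x)%:R)).
    rewrite (value_to_go_sum P pi (fun x => (rho x == 0)%:R) (fun x y _ => (y == x)%:R)).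
    by rewrite big1// => x _; rewrite -/(rho x); case: eqP => [->|]; rewrite ?mulr0 ?mul0r.
  move=> y b; rewrite (bigD1 y)//= eqxx mulr1 big1 ?addr0// => x /negbTE xy.
  by rewrite [y == x]eq_sym xy mulr0.
elim: (len S) (x_first S) => //= n IHn y.
have Jge0 x' := value_to_go_ge0 n x' tP pip bad0.
have Pge0 a : 0 <= \sum_x' P y a x' * value_to_go P pi bad n x'.
  by apply: sumr_ge0 => x' _; rewrite mulr_ge0.
move=> /eqP; rewrite psumr_eq0; last by move=> a _; rewrite mulr_ge0// addr_ge0.
move=> /allP h.
have ha a : (pi y a == 0) || ((rho y != 0) &&
    [forall x', (P y a x' == 0) || (value_to_go P pi bad n x' == 0)]).
  have /= := h a (mem_index_enum a); rewrite mulf_eq0; case: eqP => //= _.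
  rewrite paddr_eq0// /bad pnatr_eq0 eqb0 => /andP[->/=].
  rewrite psumr_eq0; last by move=> x' _; rewrite mulr_ge0.
  move=> /allP hx; apply/forallP => x'.
  by have := hx x' (mem_index_enum x'); rewrite mulf_eq0.
have ry : rho y != 0.
  apply/eqP => /eqP ry.
  have : \sum_a pi y a = 0.
    by apply: big1 => a _; have := ha a; rewrite ry/= orbF => /eqP.
  by rewrite p1 => /eqP; rewrite oner_eq0.
apply: eq_bigr => a _; rewrite polpi//.
have /orP[/eqP->|/andP[_ /forallP hx]] := ha a; first by rewrite !mul0r.
congr (_ * (_ + _)); apply: eq_bigr => x' _.
by have /orP[/eqP->|/eqP/IHn->//] := hx x'; rewrite !mul0r.
Qed.

(** The transition function behind the maximizer [q] is some unknown element of [Ps], so [g] has to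
    dominate the error uniformly over [Ps]. The executed policy is first evaluated under that
    function, where it is worth as much as the policy generating [q], and only then moved to the
    true model by [simulation]. *)
Lemma optimistic_regret (M : layered_mdp R S)
    (Ps : set (state S -> action S -> state S -> R)) (f g : state S -> action S -> R)
    pistar q pol :
  optimal_policy M pistar -> Ps (trans M) ->
  (forall x a, reward M x a <= f x a <= 1) ->
  (forall P x a, Ps P -> x != x_last S ->
    f x a - reward M x a + (len S)%:R * \sum_x' `|P x a x' - trans M x a x'| <= g x a) ->
  occupancy_set Ps q ->
  (forall q', occupancy_set Ps q' -> inner q' f <= inner q f) ->
  induced_policy q pol ->
  value M pistar - value M pol <= value_to_go (trans M) pol g (len S) (x_first S).
Proof.
move=> [pistarp _] PsM fr1 fg [P [pi [tP PsP pip qE]]] qmax qpol.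
have tM := trans_transition M; have [polp _] := qpol.
have value_to_goE p : is_policy p ->
    value M p = value_to_go (trans M) p (reward M) (len S) (x_first S).
  by move=> pp; rewrite -traj_value.
rewrite !value_to_goE// lerBlDl.
apply: le_trans (_ : value_to_go (trans M) pistar f (len S) (x_first S) <= _).
  by apply: ler_value_to_go => // x a; have /andP[] := fr1 x a.
rewrite -inner_occupancy//; apply: le_trans (qmax _ _) _.
  by exists (trans M), pistar.
rewrite qE inner_occupancy// -(value_to_go_induced f tP pip (pol := pol)) -?qE//.
apply: simulation => // [x a|x a xl|]; last by rewrite layer_x_first.
- have /andP[rf ->] := fr1 x a; rewrite andbT (le_trans _ rf)//.
  by have /andP[] := reward01 M x a.
- exact: fg.
Qed.

End optimism.

(** * Closure properties of adapted functions *)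

Section adapted_theory.
Context d (T : measurableType d) (R : realType).
Implicit Types (G : set (set T)) (W : T -> R).

Lemma adapted_cst G (c : R) : adapted G (fun=> c).
Proof. exact: measurable_cst. Qed.

Lemma adaptedD G W W' : adapted G W -> adapted G W' -> adapted G (fun o => W o + W' o).
Proof. exact: measurable_funD. Qed.

Lemma adaptedM G W W' : adapted G W -> adapted G W' -> adapted G (fun o => W o * W' o).
Proof. exact: measurable_funM. Qed.

Lemma adaptedB G W W' : adapted G W -> adapted G W' -> adapted G (fun o => W o - W' o).
Proof. exact: measurable_funB. Qed.

Lemma adapted_expR G W : adapted G W -> adapted G (fun o => expR (W o)).
Proof. by move=> mW; apply: measurableT_comp mW; exact: measurable_expR. Qed.

Lemma adapted_sum G (I : Type) (s : seq I) (P : pred I) (W : I -> T -> R) :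
  (forall i, P i -> adapted G (W i)) -> adapted G (fun o => \sum_(i <- s | P i) W i o).
Proof.
move=> mW; rewrite (_ : (fun o => _) = (\sum_(i <- s | P i) W i : T -> R)); last first.
  by apply/funext => o; rewrite fct_sumE.
by elim/big_ind : _ => //; [exact: adapted_cst|exact: adaptedD].
Qed.

Lemma adapted_prod G (I : Type) (s : seq I) (P : pred I) (W : I -> T -> R) :
  (forall i, P i -> adapted G (W i)) -> adapted G (fun o => \prod_(i <- s | P i) W i o).
Proof.
move=> mW; rewrite (_ : (fun o => _) = (\big[(fun f g o => f o * g o)/(fun=> 1)]_(i <- s | P i) W i : T -> R)); last first.
  apply/funext => o; elim/big_rec2 : _ => // i y1 y2 Pi <- //.
by elim/big_ind : _ => //; [exact: adapted_cst|exact: adaptedM].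
Qed.

Lemma adapted_bool G (b : T -> bool) : sigma_algebra setT G ->
  G [set o | b o] -> adapted G (fun o => (b o)%:R : R).
Proof.
move=> sG Gb; apply/adaptedP => // B mB.
have [G0 GC GU] := sG; have GT : G setT by rewrite -(setD0 setT); exact: GC.
have GbC : G [set o | ~~ b o].
  rewrite (_ : [set _ | _] = setT `\` [set o | b o]); first exact: GC.
  by apply/seteqP; split => o /=; [move/negP|move=> [_ /negP]].
have [B1|B1] := pselect (B 1); have [B0|B0] := pselect (B 0).
- by rewrite (_ : _ @^-1` _ = setT)//; apply/seteqP; split=> // o _ /=; case: (b o).
- rewrite (_ : _ @^-1` _ = [set o | b o])//.
  by apply/seteqP; split=> o /=; case: (b o).
- rewrite (_ : _ @^-1` _ = [set o | ~~ b o])//.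
  by apply/seteqP; split=> o /=; case: (b o).
- by rewrite (_ : _ @^-1` _ = set0)//; apply/seteqP; split=> // o /=; case: (b o).
Qed.

(** The preimages are countable unions of level sets of [N], whatever [phi] is. This makes
    thresholds and bonuses adapted as soon as the visit counts are. *)
Lemma adapted_nat G (N : T -> nat) (phi : nat -> R) : sigma_algebra setT G ->
  adapted G (fun o => (N o)%:R : R) -> adapted G (fun o => phi (N o)).
Proof.
move=> sG /(adaptedP _ sG) mN; apply/adaptedP => // B mB; have [G0 GC GU] := sG.
rewrite (_ : _ @^-1` _ = \bigcup_k
    (if `[< B (phi k) >] then [set o | N o = k] else set0)).
  apply: GU => k; case: ifPn => // _.
  have := mN [set k%:R] (measurable_set1 _); congr (G _).
  by apply/seteqP; split=> o /=; [move/eqP; rewrite eqr_nat => /eqP|move=> ->].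
apply/seteqP; split=> o /=.
  by move=> Bo; exists (N o) => //; rewrite ifT//; exact/asboolP.
by move=> [k _]; case: ifPn => // /asboolP Bk /= ->.
Qed.


End adapted_theory.

(** * Integrals of nonnegative real functions and Markov's inequality *)

Section real_integrals.
Context d (T : measurableType d) (R : realType) (mu : {measure set T -> \bar R}).
Implicit Types f g : T -> R.
Local Open Scope ereal_scope.

Lemma ge0_real_integralD f g : (forall x, 0 <= f x)%R -> (forall x, 0 <= g x)%R ->
  measurable_fun setT f -> measurable_fun setT g ->
  \int[mu]_x (f x + g x)%:E = \int[mu]_x (f x)%:E + \int[mu]_x (g x)%:E.
Proof.
move=> f0 g0 mf mg; under eq_integral do rewrite EFinD.
by rewrite ge0_integralD//; (try exact/measurable_EFinP) => x _; rewrite lee_fin.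
Qed.

Lemma ge0_real_integralZl c f : (0 <= c)%R -> (forall x, 0 <= f x)%R ->
  measurable_fun setT f -> \int[mu]_x (c * f x)%:E = c%:E * \int[mu]_x (f x)%:E.
Proof.
move=> c0 f0 mf; under eq_integral do rewrite EFinM.
by rewrite ge0_integralZl//; (try exact/measurable_EFinP) => x _; rewrite lee_fin.
Qed.

Lemma ge0_real_integral_sum (I : finType) (f : I -> T -> R) :
  (forall i x, 0 <= f i x)%R -> (forall i, measurable_fun setT (f i)) ->
  \int[mu]_x (\sum_i f i x)%R%:E = \sum_i \int[mu]_x (f i x)%:E.
Proof.
move=> f0 mf; under eq_integral do rewrite -sumEFin.
by rewrite ge0_integral_sum// => [i|i x _]; [exact/measurable_EFinP|rewrite lee_fin].
Qed.

Lemma ge0_le_real_integral f g : (forall x, 0 <= f x)%R -> (forall x, f x <= g x)%R ->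
  measurable_fun setT f -> measurable_fun setT g ->
  \int[mu]_x (f x)%:E <= \int[mu]_x (g x)%:E.
Proof.
move=> f0 fg mf mg; apply: ge0_le_integral => //.
- by move=> x _; rewrite lee_fin.
- exact/measurable_EFinP.
- exact/measurable_EFinP.
- by move=> x _; rewrite lee_fin.
Qed.

Lemma measurable_boolR (b : T -> bool) : measurable [set x | b x] ->
  measurable_fun setT (fun x => (b x)%:R : R).
Proof.
move=> mb; rewrite (_ : (fun _ => _) = \1_[set x | b x]); first exact: measurable_indic.
by apply/funext => x; rewrite indicE; case: (boolP (b x)) => bx;
  [rewrite mem_set|rewrite memNset//; apply/negP].
Qed.

Lemma integral_bool (b : T -> bool) (E : set T) : measurable [set x | b x] -> measurable E ->
  \int[mu]_(x in E) ((b x)%:R : R)%:E = mu (E `&` [set x | b x]).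
Proof.
move=> mb mE; rewrite setIC -[RHS]integral_indic//; apply: eq_integral => x _.
by rewrite indicE; case: (boolP (b x)) => bx;
  [rewrite mem_set|rewrite memNset//; apply/negP].
Qed.

Lemma exp_markov f l : measurable_fun setT f -> \int[mu]_x (expR (f x))%:E <= 1 ->
  mu [set x | (l <= f x)%R] <= (expR (- l))%:E.
Proof.
move=> mf fl.
have mA : measurable [set x | l <= f x]%R.
  have := mf measurableT `[l, +oo[%classic (measurable_itv _); rewrite setTI.
  by congr measurable; apply/seteqP; split=> x /=; rewrite in_itv/= andbT.
rewrite -(setTI [set _ | _]) -integral_bool//.
have -> : \int[mu]_x (((l <= f x)%R%:R : R))%:E =
    (expR (- l))%:E * \int[mu]_x ((expR l * (l <= f x)%R%:R))%:E.
  rewrite -ge0_real_integralZl ?expR_ge0//.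
  - by apply: eq_integral => x _; rewrite mulrA -expRD addNr expR0 mul1r.
  - by apply: measurable_funM => //; exact: measurable_boolR.
rewrite -[leRHS]mule1 lee_wpmul2l ?lee_fin ?expR_ge0//; apply: le_trans fl.
apply: ge0_le_real_integral => [x|x||].
- by rewrite mulr_ge0 ?expR_ge0.
- by case: (boolP (l <= f x)%R) => lf; rewrite ?mulr1 ?mulr0 ?expR_ge0 ?ler_expR.
- by apply: measurable_funM => //; exact: measurable_boolR.
- exact: measurableT_comp.
Qed.
End real_integrals.

(** * The law of an interaction *)

Lemma measure_fin_partition d (T : measurableType d) (R : realType)
    (mu : {measure set T -> \bar R}) (I : finType) (Y : T -> I) (A : set T) :
  measurable A -> (forall i, measurable [set o | Y o = i]) ->
  mu A = (\sum_i mu (A `&` [set o | Y o = i]))%E.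
Proof.
move=> mA mY.
have mb i : measurable [set o | Y o == i].
  rewrite (_ : [set _ | _] = [set o | Y o = i])//.
  by apply/seteqP; split=> o /= /eqP.
transitivity (\sum_i \int[mu]_(o in A) ((Y o == i)%:R : R)%:E)%E; last first.
  apply: eq_bigr => i _; rewrite integral_bool//; congr (mu (_ `&` _)).
  by apply/seteqP; split=> o /= /eqP.
rewrite -ge0_integral_sum//; last first.
  by move=> i; apply/measurable_EFinP/measurable_funTS; exact: measurable_boolR.
rewrite -[LHS]mul1e -integral_cst//; apply: eq_integral => o _.
rewrite sumEFin (bigD1 (Y o))//= eqxx big1 ?addr0// => i.
by rewrite eq_sym => /negbTE ->.
Qed.

Section interaction_theory.
Context (R : realType) (S : layered_space) (M : layered_mdp R S) (T : nat)
  (d : measure_display) (Omega : measurableType d) (Pr : probability Omega R)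
  (F : nat -> nat -> set (set Omega)) (w : Omega -> run R S)
  (mu : nat -> Omega -> state S -> action S -> R).
Hypothesis IM : interaction M T Pr F w mu.
Hypothesis mup : forall t o, (1 <= t <= T)%N -> is_policy (mu t o).

Lemma F_sigma t h : (1 <= t <= T)%N -> (h <= len S)%N -> sigma_algebra setT (F t h).
Proof. by move=> tT hL; have [] := interact_sigma IM tT hL. Qed.

Lemma F_measurable t h : (1 <= t <= T)%N -> (h <= len S)%N -> F t h `<=` measurable.
Proof. by move=> tT hL; have [] := interact_sigma IM tT hL. Qed.

Lemma F_le_step t h h' : (1 <= t <= T)%N -> (h <= h' <= len S)%N -> F t h `<=` F t h'.
Proof.
move=> tT /andP[+ +]; elim: h' => [|h' IHh]; first by rewrite leqn0 => /eqP-> _ o.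
rewrite leq_eqVlt ltnS => /predU1P[-> _ o//|hh'] h'L.
exact: subset_trans (IHh hh' (ltnW h'L)) (interact_step IM tT h'L).
Qed.

(* [F T.+1 0] is unconstrained, hence the special case after the last episode. *)
Definition history (t : nat) : set (set Omega) :=
  if (t <= T)%N then F t 0%N else F T (len S).

Lemma historyE t : (t <= T)%N -> history t = F t 0%N.
Proof. by rewrite /history => ->. Qed.

Lemma F_history u t h : (1 <= u < t)%N -> (t <= T.+1)%N -> (h <= len S)%N ->
  F u h `<=` history t.
Proof.
move=> /andP[u1 ut] tT hL; have uT : (u <= T)%N by rewrite -ltnS (leq_trans ut).
apply: (@subset_trans _ (F u (len S))); first by apply: F_le_step; rewrite ?u1 ?uT ?hL ?leqnn.
elim: t ut tT => // t IHt; rewrite ltnS leq_eqVlt => /predU1P[<-{IHt t} _|ut tT].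
  rewrite /history; case: ltnP => [uT'|Tu]; first by apply: (interact_episode IM); rewrite u1.
  by have -> : T = u by lia.
apply: (subset_trans (IHt ut (ltnW tT))).
have t1 : (1 <= t)%N by rewrite (leq_trans u1)// ltnW.
have tT' : (1 <= t <= T)%N by rewrite t1.
rewrite historyE//; apply: (@subset_trans _ (F t (len S))); first by apply: F_le_step; rewrite ?leqnn.
rewrite /history; case: ltnP => [tT''|Tt]; first by apply: (interact_episode IM); rewrite t1.
by have -> : T = t by lia.
Qed.

Lemma history_sigma t : (1 <= T)%N -> (1 <= t)%N -> sigma_algebra setT (history t).
Proof.
move=> T1 t1; rewrite /history; case: ifP => tT; apply: F_sigma => //.
- by rewrite t1.
- by rewrite T1/=.
Qed.

Lemma history_measurable t : (1 <= T)%N -> (1 <= t)%N -> history t `<=` measurable.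
Proof.
move=> T1 t1; rewrite /history; case: ifP => tT; apply: F_measurable => //.
- by rewrite t1.
- by rewrite T1/=.
Qed.

Definition visit t h x a o : bool := (run_st (w o) t h == x) && (run_ac (w o) t h == a).

Lemma F_state t h x : (1 <= t <= T)%N -> (h <= len S)%N ->
  F t h [set o | run_st (w o) t h == x].
Proof.
move=> tT hL; rewrite (_ : [set _ | _] = [set o | run_st (w o) t h = x]).
  exact: (interact_state IM).
by apply/seteqP; split=> o /= /eqP.
Qed.

Lemma F_setI t h A B : (1 <= t <= T)%N -> (h <= len S)%N -> F t h A -> F t h B ->
  F t h (A `&` B).
Proof.
move=> tT hL; have sF := F_sigma tT hL.
rewrite -(measurable_g_measurableTypeE sF); exact: measurableI.
Qed.

Lemma F_visit t h x a : (1 <= t <= T)%N -> (h < len S)%N ->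
  F t h.+1 [set o | visit t h x a o].
Proof.
move=> tT hL; rewrite (_ : [set _ | _] =
    [set o | run_st (w o) t h == x] `&` [set o | run_ac (w o) t h = a]).
  apply: F_setI => //; last exact: (interact_action IM).
  by apply: (interact_step IM tT hL); apply: F_state => //; exact: ltnW.
by apply/seteqP; split=> o /=; rewrite /visit; [move=> /andP[-> /eqP]|move=> [-> /eqP]].
Qed.

Lemma F_transition t h x a x' : (1 <= t <= T)%N -> (h < len S)%N ->
  F t h.+1 [set o | visit t h x a o && (run_st (w o) t h.+1 == x')].
Proof.
move=> tT hL; rewrite (_ : [set _ | _] = [set o | visit t h x a o] `&`
    [set o | run_st (w o) t h.+1 == x']).
  by apply: F_setI => //; [exact: F_visit|exact: F_state].
by apply/seteqP; split=> o /=; [move=> /andP[-> ->]|move=> [-> ->]].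
Qed.

Lemma adapted_state t h x : (1 <= t <= T)%N -> (h <= len S)%N ->
  adapted (F t h) (fun o => (run_st (w o) t h == x)%:R : R).
Proof. by move=> tT hL; apply: adapted_bool; [exact: F_sigma|exact: F_state]. Qed.

Lemma adapted_visit t h x a : (1 <= t <= T)%N -> (h < len S)%N ->
  adapted (F t h.+1) (fun o => (visit t h x a o)%:R : R).
Proof. by move=> tT hL; apply: adapted_bool; [exact: F_sigma|exact: F_visit]. Qed.

Lemma adapted_reward t h : (1 <= t <= T)%N -> (h < len S)%N ->
  adapted (F t h.+1) (fun o => run_rw (w o) t h).
Proof.
move=> tT hL; apply/adaptedP; first exact: F_sigma.
by move=> B mB; exact: (interact_reward IM).
Qed.

Lemma adapted_policy t h x a : (1 <= t <= T)%N -> (h <= len S)%N ->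
  adapted (F t h) (fun o => mu t o x a).
Proof.
move=> tT hL; apply: (adapted_sub (F_sigma tT (leq0n _)) (F_sigma tT hL)).
  exact: F_le_step.
apply/adaptedP; first exact: F_sigma.
by move=> B mB; exact: (interact_policy IM).
Qed.

Lemma adapted_mfun t h W : (1 <= t <= T)%N -> (h <= len S)%N ->
  adapted (F t h) W -> measurable_fun setT (W : Omega -> R).
Proof. by move=> tT hL; apply: adapted_measurable; [exact: F_sigma|exact: F_measurable]. Qed.

(** The weighted form of [interact_law], with the reward left free by taking the whole line for
    [B]. *)
Lemma visit_step_law t h x a x' (W : Omega -> R) : (1 <= t <= T)%N -> (h < len S)%N ->
  adapted (F t h) W -> (forall o, 0 <= W o) ->
  (\int[Pr]_o (W o * (visit t h x a o && (run_st (w o) t h.+1 == x'))%:R)%:E =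
   \int[Pr]_o (W o * ((run_st (w o) t h == x)%:R * mu t o x a * trans M x a x'))%:E)%E.
Proof.
move=> tT hL mW W0; have hL' := ltnW hL.
have [P0 _ _] := trans_transition M.
have mu0 o : 0 <= mu t o x a by have [] := mup o tT.
have mX := adapted_state x tT hL'; have mmu := adapted_policy x a tT hL'.
apply: (@subsigma_integral _ _ _ _ (F t h)) => //.
- exact: F_sigma.
- exact: F_measurable.
- by apply: measurable_boolR; apply: (F_measurable tT hL); exact: F_transition.
- apply: (adapted_mfun tT hL'); apply: adaptedM; last exact: adapted_cst.
  exact: adaptedM.
- by move=> o; rewrite !mulr_ge0.
move=> E FE; have mE := F_measurable tT hL' FE.
have mXs := F_measurable tT hL' (F_state x tT hL').
rewrite integral_bool//; last by apply: (F_measurable tT hL); exact: F_transition.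
transitivity (Pr (E `&` [set o | [/\ run_st (w o) t h = x, run_ac (w o) t h = a,
    setT (run_rw (w o) t h) & run_st (w o) t h.+1 = x']])).
  congr (Pr (_ `&` _)); apply/seteqP; split=> o /=; rewrite /visit.
    by move=> /andP[/andP[/eqP ? /eqP ?] /eqP ?].
  by move=> [-> -> _ ->]; rewrite !eqxx.
rewrite (interact_law IM)// probability_setT mule1.
have mEX : measurable (E `&` [set o | run_st (w o) t h = x]).
  apply: measurableI => //; move: mXs; congr measurable.
  by apply/seteqP; split=> o /= /eqP.
rewrite -ge0_integralZr//; last 3 first.
- by apply/measurable_funTS/measurable_EFinP; exact: adapted_mfun mmu.
- by move=> o _; rewrite lee_fin.
- by rewrite lee_fin.
rewrite integral_mkcondr; apply: eq_integral => o _.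
rewrite patchE; case: ifPn => [|]; rewrite ?inE ?notin_setE/= => /eqP.
  by move=> ->; rewrite mul1r.
by move=> /negbTE ->; rewrite !mul0r.
Qed.

Lemma visit_law t h x a (W : Omega -> R) : (1 <= t <= T)%N -> (h < len S)%N ->
  (layer x < len S)%N -> adapted (F t h) W -> (forall o, 0 <= W o) ->
  (\int[Pr]_o (W o * (visit t h x a o)%:R)%:E =
   \int[Pr]_o (W o * ((run_st (w o) t h == x)%:R * mu t o x a))%:E)%E.
Proof.
move=> tT hL xL mW W0; have hL' := ltnW hL.
have [P0 _ _] := trans_transition M.
have mu0 o : 0 <= mu t o x a by have [] := mup o tT.
have mW' := adapted_mfun tT hL' mW.
have mX := adapted_state x tT hL'; have mmu := adapted_policy x a tT hL'.
transitivity (\sum_x' \int[Pr]_o (W o * (visit t h x a o && (run_st (w o) t h.+1 == x'))%:R)%:E)%E.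
  rewrite -ge0_real_integral_sum.
  - apply: eq_integral => o _; rewrite -mulr_sumr; congr (_ * _)%:E.
    rewrite (bigD1 (run_st (w o) t h.+1))//= eqxx andbT big1 ?addr0// => x'.
    by rewrite eq_sym => /negbTE ->; rewrite andbF.
  - by move=> x' o; rewrite mulr_ge0.
  - move=> x'; apply: measurable_funM => //; apply: measurable_boolR.
    by apply: (F_measurable tT hL); exact: F_transition.
under eq_bigr do rewrite visit_step_law//.
rewrite -ge0_real_integral_sum.
- apply: eq_integral => o _; congr (_%:E).
  by rewrite -mulr_sumr -mulr_sumr (trans_sum1 a (trans_transition M) xL) mulr1.
- by move=> x' o; rewrite !mulr_ge0.
- move=> x'; apply: (adapted_mfun tT hL'); apply: adaptedM => //.
  by apply: adaptedM; [exact: adaptedM|exact: adapted_cst].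
Qed.

(** The law of the next state given the past and the visit. Both sides contain the same integral of
    [W] times the probability, under the executed policy, of playing [a] in [x]; only the factor
    coming from the transition differs. *)
Lemma next_state_law t h x a (W : Omega -> R) (phi : state S -> R) :
  (1 <= t <= T)%N -> (h < len S)%N ->
  (layer x < len S)%N -> adapted (F t h) W -> (forall o, 0 <= W o) ->
  (forall x', 0 <= phi x') ->
  (\int[Pr]_o (W o * (visit t h x a o)%:R * phi (run_st (w o) t h.+1))%:E =
   (\sum_x' trans M x a x' * phi x')%:E * \int[Pr]_o (W o * (visit t h x a o)%:R)%:E)%E.
Proof.
move=> tT hL xL mW W0 phi0; have hL' := ltnW hL.
have [P0 _ _] := trans_transition M.
have mu0 o : 0 <= mu t o x a by have [] := mup o tT.
have mW' := adapted_mfun tT hL' mW.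
have mX := adapted_state x tT hL'; have mmu := adapted_policy x a tT hL'.
have mV x' : measurable_fun setT
    (fun o => W o * (visit t h x a o && (run_st (w o) t h.+1 == x'))%:R).
  apply: measurable_funM => //; apply: measurable_boolR.
  by apply: (F_measurable tT hL); exact: F_transition.
have V0 x' o : 0 <= W o * (visit t h x a o && (run_st (w o) t h.+1 == x'))%:R.
  by rewrite mulr_ge0.
transitivity (\sum_x' \int[Pr]_o (phi x' *
    (W o * (visit t h x a o && (run_st (w o) t h.+1 == x'))%:R))%:E)%E.
  rewrite -ge0_real_integral_sum.
  - apply: eq_integral => o _; congr (_%:E).
    rewrite (bigD1 (run_st (w o) t h.+1))//= eqxx andbT big1 ?addr0 1?mulrC// => x'.
    by rewrite eq_sym => /negbTE ->; rewrite andbF !mulr0.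
  - by move=> x' o; rewrite mulr_ge0.
  - by move=> x'; exact: measurable_funM.
rewrite -sumEFin ge0_sume_distrl; last by move=> x' _; rewrite lee_fin mulr_ge0.
apply: eq_bigr => x' _; rewrite ge0_real_integralZl// visit_step_law// visit_law//.
rewrite [(_ * phi x')%R]mulrC EFinM -muleA; congr (_ * _)%E.
rewrite -ge0_real_integralZl//.
- by apply: eq_integral => o _; congr (_%:E); ring.
- by move=> o; rewrite !mulr_ge0.
- by apply: (adapted_mfun tT hL'); apply: adaptedM => //; exact: adaptedM.
Qed.

(** Summing [interact_law] over the next state leaves a product of an integral of the policy and the
    reward law. The integral is then identified through the same formula with the whole line as
    reward set. *)
Lemma reward_set_law t h x a (E : set Omega) (B : set (measurableTypeR R)) :
  (1 <= t <= T)%N -> (h < len S)%N -> (layer x < len S)%N -> F t h E -> measurable B ->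
  Pr (E `&` [set o | visit t h x a o] `&` [set o | B (run_rw (w o) t h)]) =
  (Pr (E `&` [set o | visit t h x a o]) * reward_law M x a B)%E.
Proof.
move=> tT hL xL FE mB; have hL' := ltnW hL.
have [P0 _ _] := trans_transition M.
have mE := F_measurable tT hL' FE.
have key (C : set (measurableTypeR R)) : measurable C ->
    Pr (E `&` [set o | visit t h x a o] `&` [set o | C (run_rw (w o) t h)]) =
    ((\int[Pr]_(o in E `&` [set o | run_st (w o) t h = x]) (mu t o x a)%:E)
     * reward_law M x a C)%E.
  move=> mC; rewrite (@measure_fin_partition _ _ _ Pr _ (fun o => run_st (w o) t h.+1)).
  - transitivity (\sum_x' (\int[Pr]_(o in E `&` [set o | run_st (w o) t h = x])
        (mu t o x a)%:E) * reward_law M x a C * (trans M x a x')%:E)%E.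
      apply: eq_bigr => x' _; rewrite -(interact_law IM)//; congr (Pr _).
      apply/seteqP; split=> o /=; rewrite /visit.
        by move=> [[[? /andP[/eqP ? /eqP ?]] ?] ?].
      by move=> [? [-> -> ? ->]]; rewrite !eqxx.
    rewrite -ge0_sume_distrr; last by move=> x' _; rewrite lee_fin.
    by rewrite sumEFin (trans_sum1 a (trans_transition M) xL) mule1.
  - apply: measurableI; first apply: measurableI => //.
      by apply: (F_measurable tT hL); exact: F_visit.
    by apply: (F_measurable tT hL); exact: (interact_reward IM).
  - by move=> x'; apply: (F_measurable tT hL); exact: (interact_state IM).
rewrite key// -[X in (X * _)%E]mule1 -(probability_setT (reward_law M x a)) -key//.
by congr (Pr _ * _)%E; apply/seteqP; split=> o /= => [[]|].
Qed.


End interaction_theory.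

Lemma ge0_integral_mrestr d (T : measurableType d) (R : realType)
    (mu : {measure set T -> \bar R}) (D : set T) (mD : measurable D) (f : T -> \bar R) :
  measurable_fun setT f -> (forall x, (0 <= f x)%E) ->
  (\int[mrestr mu mD]_x f x = \int[mu]_(x in D) f x)%E.
Proof.
move=> mf f0; rewrite (@ge0_negligible_integral _ _ _ _ setT (~` D))//.
- rewrite setTD setCK; apply: eq_measure_integral => A mA AD /=.
  by rewrite /mrestr setIidl.
- exact: measurableC.
- by rewrite /= /mrestr setICl measure0.
Qed.

(** The chord bound holds on [[0, 1]] only, so the integrals are first restricted to this set of
    full measure. There the chord is kept as a combination of the nonnegative functions [1 - y] and
    [y], whose integrals are known from the mean. *)
Lemma hoeffding_law (R : realType) (nu : probability (measurableTypeR R) R) (m s : R) :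
  nu `[0%R, 1%R]%classic = 1%E -> (\int[nu]_y y%:E = m%:E)%E -> 0 <= m <= 1 ->
  (\int[nu]_y (expR (s * (y - m)))%:E <= (expR (s ^+ 2 / 8))%:E)%E.
Proof.
move=> nu01 num m01.
pose D : set (measurableTypeR R) := `[0%R, 1%R]%classic.
have mD : measurable D by exact: measurable_itv.
have nuDC : nu (~` D) = 0%E by rewrite probability_setC// -/D nu01 subee.
have De y : D y -> 0 <= y <= 1 by rewrite /D/= in_itv.
have mid : measurable_fun setT (fun y : measurableTypeR R => y : R) by exact: measurable_id.
have mE : measurable_fun setT (fun y : measurableTypeR R => y%:E).
  by have /measurable_EFinP := mid.
have intD : (\int[nu]_(y in D) y%:E = m%:E)%E.
  rewrite -num integral_mkcond; apply: ae_eq_integral => //.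
  - exact/(measurable_restrictT _ mD)/measurable_funTS.
  exists (~` D); split=> //; first exact: measurableC.
  by move=> y /= h Dy; apply: h => _; rewrite patchE ifT// inE.
have intD1 : (\int[nu]_(y in D) (1 - y)%:E = (1 - m)%:E)%E.
  have : (\int[nu]_(y in D) ((1 - y)%:E + y%:E) = 1%:E)%E.
    under eq_integral do rewrite -EFinD subrK.
    by rewrite integral_cst// mul1e.
  rewrite ge0_integralD//.
  - rewrite intD => h; rewrite -[LHS](addeK (x := m%:E))// h.
    by rewrite -EFinB.
  - by move=> y /De /andP[_ y1]; rewrite lee_fin subr_ge0.
  - by apply/measurable_funTS/measurable_EFinP; exact: measurable_funB.
  - by move=> y /De /andP[y0 _]; rewrite lee_fin.
have mexp : measurable_fun setT (fun y : measurableTypeR R => expR (s * (y - m))).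
  apply: measurableT_comp; first exact: measurable_expR.
  by apply: measurable_funM => //; exact: measurable_funB.
rewrite (@ge0_negligible_integral _ _ _ _ setT (~` D))//; last 2 first.
- exact: measurableC.
- exact/measurable_EFinP.
rewrite setTD setCK.
apply: (@le_trans _ _ (\int[nu]_(y in D) ((expR (- s * m))%:E * (1 - y)%:E
    + (expR (- s * m + s))%:E * y%:E))%E).
  apply: ge0_le_integral => //.
  - exact/measurable_funTS/measurable_EFinP.
  - apply/measurable_funTS; rewrite (_ : (fun _ => _) =
      EFin \o (fun y => expR (- s * m) * (1 - y) + expR (- s * m + s) * y))//.
    apply/measurable_EFinP; apply: measurable_funD; apply: measurable_funM => //.
    exact: measurable_funB.
  - move=> y /De y01; rewrite -!EFinM -EFinD lee_fin.
    rewrite (_ : s * (y - m) = - s * m + s * y); last by ring.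
    rewrite !expRD -mulrA -mulrDr ler_wpM2l ?expR_ge0// [expR s * y]mulrC.
    exact: expR_chord.
rewrite ge0_integralD//; last 4 first.
- by move=> y /De /andP[? ?]; rewrite -EFinM lee_fin mulr_ge0 ?expR_ge0 ?subr_ge0.
- apply/measurable_funTS; apply/measurable_EFinP.
  by apply: measurable_funM => //; exact: measurable_funB.
- by move=> y /De /andP[? ?]; rewrite -EFinM lee_fin mulr_ge0 ?expR_ge0.
- by apply/measurable_funTS; apply/measurable_EFinP; exact: measurable_funM.
rewrite !ge0_integralZl//; last 3 first.
- by move=> y /De /andP[? ?]; rewrite lee_fin.
- by apply/measurable_funTS/measurable_EFinP; exact: measurable_funB.
- by move=> y /De /andP[? ?]; rewrite lee_fin subr_ge0.
rewrite intD intD1 -!EFinM -EFinD lee_fin.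
have h := hoeffding_bernoulli s m01.
rewrite (_ : s ^+ 2 / 8 = - s * m + (m * s + s ^+ 2 / 8)); last by ring.
 rewrite !(expRD (- s * m)) -mulrA -mulrDr ler_wpM2l ?expR_ge0//.
by rewrite [expR s * m]mulrC.
Qed.

(** * Hoeffding's lemma at the visits of a pair *)

Section observables.
Context (R : realType) (S : layered_space) (M : layered_mdp R S) (T : nat)
  (d : measure_display) (Omega : measurableType d) (Pr : probability Omega R)
  (F : nat -> nat -> set (set Omega)) (w : Omega -> run R S)
  (mu : nat -> Omega -> state S -> action S -> R).
Hypothesis IM : interaction M T Pr F w mu.
Hypothesis mup : forall t o, (1 <= t <= T)%N -> is_policy (mu t o).

(** By [reward_set_law], the restriction of [Pr] to a visit within [E], pushed forward by the
    reward, is the multiple [Pr V] of [reward_law M x a]. Integrating [phi] against these equal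
    measures gives the identity on events of [F t h], and [subsigma_integral] extends it to
    weights. *)
Lemma reward_fun_law t h x a (W : Omega -> R) (phi : measurableTypeR R -> R) (c : R) :
  (1 <= t <= T)%N -> (h < len S)%N -> (layer x < len S)%N ->
  adapted (F t h) W -> (forall o, 0 <= W o) ->
  measurable_fun setT phi -> (forall y, 0 <= phi y) ->
  (\int[reward_law M x a]_y (phi y)%:E = c%:E)%E ->
  (\int[Pr]_o (W o * (visit w t h x a o)%:R * phi (run_rw (w o) t h))%:E =
   c%:E * \int[Pr]_o (W o * (visit w t h x a o)%:R)%:E)%E.
Proof.
move=> tT hL xL mW W0 mphi phi0 phic; have hL' := ltnW hL.
have c0 : 0 <= c.
  by rewrite -lee_fin -phic; apply: integral_ge0 => y _; rewrite lee_fin.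
have mW' := adapted_mfun IM tT hL' mW.
have mv : measurable [set o | visit w t h x a o].
  by apply: (F_measurable IM tT hL); exact: (F_visit IM).
have mrw : measurable_fun setT (fun o => run_rw (w o) t h : measurableTypeR R).
  by have := adapted_mfun IM tT hL (adapted_reward IM tT hL).
have mphirw : measurable_fun setT (fun o => phi (run_rw (w o) t h)).
  exact: (measurableT_comp mphi mrw).
have mvR := @measurable_boolR _ _ R _ mv.
transitivity (\int[Pr]_o (W o * (c * (visit w t h x a o)%:R))%:E)%E; last first.
  rewrite -ge0_real_integralZl//; last exact: measurable_funM.
    by apply: eq_integral => o _; rewrite mulrCA.
  by move=> o; rewrite mulr_ge0.
under eq_integral do rewrite -mulrA.
apply: (@subsigma_integral _ _ _ _ (F t h)) => //.
- exact: (F_sigma IM).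
- exact: (F_measurable IM).
- exact: measurable_funM.
- exact: measurable_funM.
- by move=> o; rewrite mulr_ge0.
- by move=> o; rewrite mulr_ge0.
move=> E FE; have mE := F_measurable IM tT hL' FE.
pose V := E `&` [set o | visit w t h x a o].
have mV : measurable V by exact: measurableI.
have restrictE (k : Omega -> R) :
    (\int[Pr]_(o in E) ((visit w t h x a o)%:R * k o)%:E = \int[Pr]_(o in V) (k o)%:E)%E.
  rewrite /V integral_mkcondr; apply: eq_integral => o _.
  rewrite patchE; case: (boolP (visit w t h x a o)) => vo.
    by rewrite ifT ?mul1r// inE.
  by rewrite ifF ?mul0r//; apply/negbTE; rewrite notin_setE; exact/negP.
rewrite restrictE; under [RHS]eq_integral do rewrite mulrC.
rewrite restrictE integral_cst//= muleC -phic.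
have -> : (\int[Pr]_(o in V) (phi (run_rw (w o) t h))%:E =
    \int[mrestr Pr mV]_o (phi (run_rw (w o) t h))%:E)%E.
  rewrite ge0_integral_mrestr//; first exact/measurable_EFinP.
  by move=> o; rewrite lee_fin.
have PrV : Pr V = (fine (Pr V))%:E by rewrite fineK// fin_num_measure.
have PrV0 : 0 <= fine (Pr V) by exact: fine_ge0.
have -> : (Pr V * \int[reward_law M x a]_y (phi y)%:E =
    \int[mscale (NngNum PrV0) (reward_law M x a)]_y (phi y)%:E)%E.
  rewrite ge0_integral_mscale//= -?PrV//; first exact/measurable_EFinP.
  by move=> y _; rewrite lee_fin.
have := @ge0_integral_pushforward _ _ _ _ R _ mrw (mrestr Pr mV) setT (fun y => (phi y)%:E) measurableT.
rewrite preimage_setT => <-; last 2 first.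
- exact/measurable_EFinP.
- by move=> y _; rewrite lee_fin.
apply: eq_measure_integral => B mB _; rewrite /= /pushforward /mrestr /mscale /= -PrV setIC.
exact: (reward_set_law IM).
Qed.

(* Hoeffding's lemma for [Y t] conditionally on [F t (layer x)], at the visits of
   [(x, a)]: the arbitrary adapted weight [W] expresses the conditioning. *)
Definition hoeffding_observable (x : state S) (a : action S) (Y : nat -> Omega -> R) (p : R) :=
  forall t, (1 <= t <= T)%N -> adapted (F t (layer x).+1) (Y t) /\
    forall (s : R) (W : Omega -> R), adapted (F t (layer x)) W -> (forall o, 0 <= W o) ->
    (\int[Pr]_o (W o * (visit w t (layer x) x a o)%:R * expR (s * (Y t o - p)))%:E <=
     (expR (s ^+ 2 / 8))%:E * \int[Pr]_o (W o * (visit w t (layer x) x a o)%:R)%:E)%E.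

Lemma reward_observable x a : (layer x < len S)%N ->
  hoeffding_observable x a (fun t o => run_rw (w o) t (layer x)) (reward M x a).
Proof.
move=> xL t tT; split=> [|s W mW W0]; first exact: (adapted_reward IM).
pose phi (y : measurableTypeR R) := expR (s * (y - reward M x a)).
have hle := hoeffding_law s (reward_law01 M x a) (reward_mean M x a) (reward01 M x a).
have phi0 : (0 <= \int[reward_law M x a]_y (phi y)%:E)%E.
  by apply: integral_ge0 => y _; rewrite lee_fin expR_ge0.
have phiE : (\int[reward_law M x a]_y (phi y)%:E =
    (fine (\int[reward_law M x a]_y (phi y)%:E))%:E)%E.
  by rewrite fineK// ge0_fin_numE// (le_lt_trans hle)// ltry.
have mphi : measurable_fun setT phi.
  apply: measurableT_comp; first exact: measurable_expR.
  by apply: measurable_funM => //; apply: measurable_funB => //; exact: measurable_id.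
rewrite (reward_fun_law (phi := phi) tT xL xL mW W0 mphi _ phiE) => [|y]; last exact: expR_ge0.
by rewrite -phiE lee_wpmul2r// integral_ge0// => o _; rewrite lee_fin mulr_ge0.
Qed.

(** The concentration bound is one-sided. Optimism needs the empirical mean not to be too low, the
    size of the bonus needs it not to be too high; this lemma provides the second direction. *)
Lemma reward_opp_observable x a : (layer x < len S)%N ->
  hoeffding_observable x a (fun t o => - run_rw (w o) t (layer x)) (- reward M x a).
Proof.
move=> xL t tT; have [mY HY] := reward_observable a xL tT; split=> [|s W mW W0].
  rewrite (_ : (fun o => _) = (fun o => -1 * run_rw (w o) t (layer x))); last first.
    by apply/funext => o; rewrite mulN1r.
  by apply: adaptedM => //; exact: adapted_cst.
have := HY (- s) W mW W0; rewrite sqrrN; congr (_ <= _)%E.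
by apply: eq_integral => o _; rewrite -opprB opprK mulrNN [- _ + _]addrC -?mulNr.
Qed.

Lemma next_observable x a (B : {pred state S}) : (layer x < len S)%N ->
  hoeffding_observable x a (fun t o => (run_st (w o) t (layer x).+1 \in B)%:R)
    (\sum_(x' in B) trans M x a x').
Proof.
move=> xL t tT; split=> [|s W mW W0].
  rewrite (_ : (fun o => _) =
      (fun o => \sum_(x' in B) (run_st (w o) t (layer x).+1 == x')%:R)); last first.
    apply/funext => o; case: (boolP (_ \in B)) => oB.
      rewrite (bigD1 (run_st (w o) t (layer x).+1))//= eqxx big1 ?addr0// => x' /andP[_].
      by rewrite eq_sym => /negbTE ->.
    rewrite big1// => x' x'B; case: eqP => // ox'; by rewrite ox' x'B in oB.
  by apply: adapted_sum => x' _; exact: (adapted_state IM).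
set p := \sum_(x' in B) _.
have [P0 _ _] := trans_transition M.
have p01 : 0 <= p <= 1.
  rewrite sumr_ge0//= -(trans_sum1 a (trans_transition M) xL) /p big_mkcond.
  by apply: ler_sum => x' _; case: ifP.
rewrite (@next_state_law _ _ _ _ _ _ _ _ _ _ IM mup _ _ _ _ _
  (fun x' => expR (s * ((x' \in B)%:R - p)))) => [|//|//|//|//|//|x']; last exact: expR_ge0.
rewrite lee_wpmul2r//; first by apply: integral_ge0 => o _; rewrite lee_fin mulr_ge0.
have qE : \sum_(x' | x' \notin B) trans M x a x' = 1 - p.
  apply: (addrI p); rewrite [RHS]addrC subrK -(trans_sum1 a (trans_transition M) xL).
  by rewrite [RHS](bigID (mem B)).
rewrite lee_fin (bigID (mem B))/=.
rewrite (eq_bigr (fun x' => trans M x a x' * expR (s * (1 - p)))); last first.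
  by move=> x' ->.
rewrite [X in _ + X](eq_bigr (fun x' => trans M x a x' * expR (s * (0 - p)))); last first.
  by move=> x' /negbTE ->.
rewrite -!mulr_suml qE -/p; clearbody p; have h := hoeffding_bernoulli s p01.
rewrite (_ : s ^+ 2 / 8 = s * (0 - p) + (p * s + s ^+ 2 / 8)); last by ring.
rewrite [leRHS]expRD; apply: le_trans (ler_wpM2l (expR_ge0 _) h).
rewrite (_ : s * (1 - p) = s * (0 - p) + s); last by ring.
by rewrite expRD le_eqVlt; apply/orP; left; apply/eqP; ring.
Qed.

End observables.

(** * Concentration *)

Section concentration.
Context (R : realType) (S : layered_space) (M : layered_mdp R S) (T : nat)
  (d : measure_display) (Omega : measurableType d) (Pr : probability Omega R)
  (F : nat -> nat -> set (set Omega)) (w : Omega -> run R S)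
  (mu : nat -> Omega -> state S -> action S -> R).
Hypothesis IM : interaction M T Pr F w mu.
Hypothesis mup : forall t o, (1 <= t <= T)%N -> is_policy (mu t o).
Hypothesis T1 : (1 <= T)%N.

Local Notation history := (history S T F).

Lemma history_le u t : (1 <= u <= t)%N -> (t <= T.+1)%N -> history u `<=` history t.
Proof.
move=> /andP[u1]; rewrite leq_eqVlt => /predU1P[-> _ A //|ut] tT.
rewrite historyE; last by lia.
by apply: (F_history IM) => //; rewrite u1.
Qed.

Lemma adapted_history u t (W : Omega -> R) : (1 <= u <= t)%N -> (t <= T.+1)%N ->
  adapted (history u) W -> adapted (history t) W.
Proof.
move=> /andP[u1 ut] tT; apply: adapted_sub.
- exact: (history_sigma IM).
- by apply: (history_sigma IM) => //; exact: leq_trans ut.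
- by apply: history_le => //; rewrite u1.
Qed.

Lemma adapted_F_history u t h (W : Omega -> R) : (1 <= u < t)%N -> (t <= T.+1)%N ->
  (h <= len S)%N -> adapted (F u h) W -> adapted (history t) W.
Proof.
move=> /andP[u1 ut] tT hL; apply: adapted_sub.
- by apply: (F_sigma IM) => //; rewrite u1/=; lia.
- by apply: (history_sigma IM) => //; exact: leq_trans (ltnW ut).
- by apply: (F_history IM) => //; rewrite u1.
Qed.

(** Induction from the last episode backwards: the exponential of the earlier increments is known at
    the start of episode [u], hence is an admissible weight. One increment per episode suffices,
    since in a layered run a pair is visited at most once per episode. *)
Lemma exp_supermartingale (xi : nat -> Omega -> R) t :
  (forall u, (1 <= u <= T)%N -> adapted (history u.+1) (xi u)) ->
  (forall u W, (1 <= u <= T)%N -> adapted (F u 0%N) W -> (forall o, 0 <= W o) ->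
     (\int[Pr]_o (W o * expR (xi u o))%:E <= \int[Pr]_o (W o)%:E)%E) ->
  (1 <= t <= T.+1)%N ->
  (\int[Pr]_o (expR (\sum_(1 <= u < t) xi u o))%:E <= 1)%E.
Proof.
move=> mxi sxi /andP[+ +]; elim: t => // t IHt _ tT.
have [->|t1] := posnP t.
  under eq_integral do rewrite big_nil expR0.
  rewrite integral_cst// mul1e; exact: probability_le1.
have tT' : (1 <= t <= T)%N by rewrite t1.
under eq_integral do rewrite big_nat_recr//= expRD.
apply: le_trans (IHt t1 (ltnW tT)); apply: sxi => //.
rewrite -(historyE S F (tT : (t <= T)%N)).
apply: adapted_expR; rewrite (_ : (fun o => _) =
    (fun o => \sum_(u <- index_iota 1 t | (1 <= u < t)%N) xi u o)); last first.
  by apply/funext => o; rewrite big_nat_cond [RHS]big_seq_cond/=; apply: eq_bigl => u;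
     rewrite mem_index_iota andbb andbT.
apply: adapted_sum => u /andP[u1 ut].
by apply: (@adapted_history u.+1) => //; [exact: ltnW|apply: mxi; rewrite u1/=; lia].
Qed.

Lemma adapted_history_sum (xi : nat -> Omega -> R) t : (1 <= t <= T.+1)%N ->
  (forall u, (1 <= u <= T)%N -> adapted (history u.+1) (xi u)) ->
  adapted (history t) (fun o => \sum_(1 <= u < t) xi u o).
Proof.
move=> /andP[t1 tT] mxi; rewrite (_ : (fun o => _) =
    (fun o => \sum_(u <- index_iota 1 t | (1 <= u < t)%N) xi u o)); last first.
  apply/funext => o; rewrite big_nat_cond [RHS]big_seq_cond; apply: eq_bigl => u.
  by rewrite mem_index_iota andbb andbT.
apply: adapted_sum => u /andP[u1 ut].
by apply: (@adapted_history u.+1) => //; apply: mxi; rewrite u1/=; lia.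
Qed.

Lemma supermartingale_tail (xi : nat -> Omega -> R) l :
  (forall u, (1 <= u <= T)%N -> adapted (history u.+1) (xi u)) ->
  (forall u W, (1 <= u <= T)%N -> adapted (F u 0%N) W -> (forall o, 0 <= W o) ->
     (\int[Pr]_o (W o * expR (xi u o))%:E <= \int[Pr]_o (W o)%:E)%E) ->
  measurable [set o | l <= \sum_(1 <= u < T.+1) xi u o] /\
  (Pr [set o | (l <= \sum_(1 <= u < T.+1) xi u o)%R] <= (expR (- l))%:E)%E.
Proof.
move=> mxi sxi; have TT : (1 <= T.+1 <= T.+1)%N by rewrite leqnn.
have mS : measurable_fun setT (fun o => \sum_(1 <= u < T.+1) xi u o).
  apply: (adapted_measurable (history_sigma IM T1 (ltn0Sn T))).
    exact: (history_measurable IM).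
  exact: adapted_history_sum.
split; last by apply: exp_markov => //; exact: exp_supermartingale.
have := mS measurableT `[l, +oo[%classic (measurable_itv _); rewrite setTI.
by congr measurable; apply/seteqP; split=> o /=; rewrite in_itv/= andbT.
Qed.

Section counts.
Variables (x : state S) (a : action S).
Hypothesis xL : (layer x < len S)%N.

Let I u o : bool := visit w u (layer x) x a o.

(* Only step [layer x] is counted: almost surely, [x] occurs at no other step. *)
Definition layer_visits (t : nat) (o : Omega) : nat := \sum_(1 <= u < t) I u o.

Lemma adapted_layer_visits t : (1 <= t <= T.+1)%N ->
  adapted (history t) (fun o => (layer_visits t o)%:R : R).
Proof.
move=> tT; rewrite (_ : (fun o => _) = (fun o => \sum_(1 <= u < t) (I u o)%:R)); last first.
  by apply/funext => o; rewrite natr_sum.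
apply: (adapted_history_sum (xi := fun u o => (I u o)%:R)) => // u uT.
apply: (@adapted_F_history u u.+1 (layer x).+1); rewrite ?ltnSn ?andbT//; try lia.
exact: (adapted_visit IM).
Qed.

Lemma layer_visits_le u t o : (1 <= u <= t)%N -> (layer_visits u o <= layer_visits t o)%N.
Proof.
by move=> /andP[u1 ut]; rewrite /layer_visits (big_cat_nat u1 ut)/= leq_addr.
Qed.

Variables (Y : nat -> Omega -> R) (p : R).
Hypothesis HY : hoeffding_observable T Pr F w x a Y p.

(* Stopping after [n] visits freezes the exponent, so that Markov's inequality at
   the final time replaces a maximal inequality. *)
Let xi n s u o : R :=
  (I u o && (layer_visits u o < n)%N)%:R * (s * (Y u o - p) - s ^+ 2 / 8).

Lemma stopped_adapted n s u : (1 <= u <= T)%N -> adapted (history u.+1) (xi n s u).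
Proof.
move=> /[dup] uT /andP[u1 uT'].
have [mY _] := HY uT.
have uu : (1 <= u < u.+1)%N by rewrite u1 ltnSn.
have uTS : (u.+1 <= T.+1)%N by [].
have mI : adapted (history u.+1) (fun o => (I u o)%:R : R).
  exact: (adapted_F_history uu uTS xL (adapted_visit IM x a uT xL)).
have mN : adapted (history u.+1) (fun o => (layer_visits u o < n)%N%:R : R).
  apply: (@adapted_history u) => //; first by rewrite u1 leqnSn.
  apply: (adapted_nat (fun k => (k < n)%N%:R)); first exact: (history_sigma IM).
  by apply: adapted_layer_visits; rewrite u1 ltnW.
rewrite (_ : xi n s u = fun o => ((I u o)%:R * (layer_visits u o < n)%N%:R) *
    (s * (Y u o - p) - s ^+ 2 / 8)); last first.
  by apply/funext => o; rewrite /xi -natrM mulnb.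
apply: adaptedM; first exact: adaptedM.
apply: adaptedB; last exact: adapted_cst.
apply: adaptedM; first exact: adapted_cst.
apply: adaptedB; last exact: adapted_cst.
exact: (adapted_F_history uu uTS xL mY).
Qed.

(** The exponent vanishes unless a visit is counted, so [W] splits into an untouched part
    [W o - V o * (I u o)%:R] and the part [V o * (I u o)%:R]. On the latter Hoeffding's lemma loses
    the factor [expR (s ^+ 2 / 8)], which the compensator in [xi] cancels. *)
Lemma stopped_supermartingale n s u W : (1 <= u <= T)%N -> adapted (F u 0%N) W ->
  (forall o, 0 <= W o) ->
  (\int[Pr]_o (W o * expR (xi n s u o))%:E <= \int[Pr]_o (W o)%:E)%E.
Proof.
move=> /[dup] uT /andP[u1 uT'] mW W0; have [mY HYu] := HY uT.
have xL' := ltnW xL.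
pose V o := W o * (layer_visits u o < n)%N%:R.
have mN : adapted (F u 0%N) (fun o => (layer_visits u o < n)%N%:R : R).
  rewrite -(historyE S F uT'); apply: (adapted_nat (fun k => (k < n)%N%:R)).
    exact: (history_sigma IM).
  by apply: adapted_layer_visits; rewrite u1 ltnW.
have mV0 : adapted (F u 0%N) V by exact: adaptedM.
have mV : adapted (F u (layer x)) V.
  apply: adapted_sub mV0; [exact: (F_sigma IM)|exact: (F_sigma IM)|].
  exact: (F_le_step IM).
have V0 o : 0 <= V o by rewrite mulr_ge0.
have mIR : measurable_fun setT (fun o => (I u o)%:R : R).
  exact: (adapted_mfun IM uT xL (adapted_visit IM x a uT xL)).
have mWm := adapted_mfun IM uT (leq0n _) mW.
have mVm := adapted_mfun IM uT xL' mV.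
have mYm := adapted_mfun IM uT xL mY.
have mE : measurable_fun setT (fun o => expR (s * (Y u o - p))).
  apply: measurableT_comp; first exact: measurable_expR.
  by apply: measurable_funM => //; exact: measurable_funB.
have VI o : V o * (I u o)%:R <= W o.
  by rewrite /V -mulrA -natrM mulnb; case: (_ && _); rewrite ?mulr1 ?mulr0.
have mVI : measurable_fun setT (fun o => V o * (I u o)%:R) by exact: measurable_funM.
have mVIE : measurable_fun setT (fun o => V o * (I u o)%:R * expR (s * (Y u o - p))).
  exact: measurable_funM.
have -> : (\int[Pr]_o (W o * expR (xi n s u o))%:E =
    \int[Pr]_o (W o - V o * (I u o)%:R)%:E +
    (expR (- (s ^+ 2 / 8)))%:E * \int[Pr]_o (V o * (I u o)%:R * expR (s * (Y u o - p)))%:E)%E.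
  rewrite -ge0_real_integralZl//; last by move=> o; rewrite !mulr_ge0 ?expR_ge0.
  rewrite -ge0_real_integralD//.
  - apply: eq_integral => o _; congr (_%:E); rewrite /xi /V.
    case: (I u o); case: (_ < _)%N; rewrite /= ?(mul0r, mulr0, mulr1, mul1r, expR0, subr0, addr0)//.
    by rewrite subrr add0r addrC expRD mulrCA.
  - by move=> o; rewrite subr_ge0.
  - by move=> o; rewrite !mulr_ge0 ?expR_ge0.
  - exact: measurable_funB.
  - exact: measurable_funM.
apply: (@le_trans _ _ (\int[Pr]_o (W o - V o * (I u o)%:R)%:E +
    \int[Pr]_o (V o * (I u o)%:R)%:E)%E).
  rewrite leeD2l//; apply: le_trans (lee_wpmul2l _ (HYu s V mV V0)) _.
    by rewrite lee_fin expR_ge0.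
  by rewrite muleA -EFinM -expRD addNr expR0 mul1e.
rewrite -ge0_real_integralD//.
- by under eq_integral do rewrite subrK.
- by move=> o; rewrite subr_ge0.
- by move=> o; rewrite mulr_ge0.
- exact: measurable_funB.
Qed.

(** If the count before episode [t] is [n], then before each earlier visit it is strictly smaller,
    so all of these are included; from [t] on it is at least [n], so nothing is added. *)
Lemma stopped_sum n s t o : (1 <= t <= T.+1)%N -> layer_visits t o = n ->
  \sum_(1 <= u < T.+1) xi n s u o =
  s * (\sum_(1 <= u < t) (I u o)%:R * (Y u o - p)) - n%:R * (s ^+ 2 / 8).
Proof.
move=> /andP[t1 tT] Nn.
rewrite (big_cat_nat t1 tT)/= [X in _ + X]big_nat [X in _ + X]big1 => [|u /andP[tu _]]; last first.
  rewrite /xi (_ : (_ < _)%N = false) ?andbF ?mul0r//.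
  by apply/negbTE; rewrite -leqNgt -Nn layer_visits_le// t1.
rewrite addr0 -Nn natr_sum mulr_suml mulr_sumr -sumrB !big_nat.
apply: eq_bigr => u /andP[u1 ut]; rewrite /xi.
case Iu : (I u o) => /=; last by rewrite !mul0r mulr0 subrr.
rewrite (_ : (_ < _)%N = true) ?mul1r//.
have : (layer_visits u.+1 o <= layer_visits t o)%N by apply: layer_visits_le.
by rewrite /layer_visits big_nat_recr//= Iu addn1.
Qed.

Lemma count_concentration (n : nat) (b : R) : (0 < n)%N -> 0 < b ->
  exists Bad : set Omega, [/\ measurable Bad,
    (Pr Bad <= (expR (- (2 * b ^+ 2 / n%:R)))%:E)%E &
    forall o t, ~ Bad o -> (1 <= t <= T.+1)%N -> layer_visits t o = n ->
      \sum_(1 <= u < t) (I u o)%:R * (Y u o - p) < b].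
Proof.
move=> n0 b0; have n0' : (0 : R) < n%:R by rewrite ltr0n.
(* The maximizer of [s * b - n * s ^+ 2 / 8], with maximum [2 * b ^+ 2 / n]. *)
pose s := 4 * b / n%:R.
have s0 : 0 < s by rewrite divr_gt0// mulr_gt0.
have [mB PB] := supermartingale_tail (2 * b ^+ 2 / n%:R) (@stopped_adapted n s)
  (@stopped_supermartingale n s).
exists [set o | 2 * b ^+ 2 / n%:R <= \sum_(1 <= u < T.+1) xi n s u o]; split=> //.
move=> o t /= /negP; rewrite -ltNge => Z tT Nn; move: Z.
rewrite (stopped_sum s tT Nn); set Z := \sum_(_ <= _ < _) _.
rewrite (_ : n%:R * (s ^+ 2 / 8) = 2 * b ^+ 2 / n%:R); last first.
  by rewrite /s; field; rewrite lt0r_neq0.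
rewrite ltrBlDr (_ : _ + _ = s * b); last by rewrite /s; field; rewrite lt0r_neq0.
by rewrite ltr_pM2l.
Qed.

End counts.
End concentration.

(** * The law of an episode and Azuma's inequality *)

Section episodes.
Context (R : realType) (S : layered_space) (M : layered_mdp R S) (T : nat)
  (d : measure_display) (Omega : measurableType d) (Pr : probability Omega R)
  (F : nat -> nat -> set (set Omega)) (w : Omega -> run R S)
  (mu : nat -> Omega -> state S -> action S -> R).
Hypothesis IM : interaction M T Pr F w mu.
Hypothesis mup : forall t o, (1 <= t <= T)%N -> is_policy (mu t o).

Local Notation P := (trans M).

Definition step_indic t h (x : state S) (a : action S) (x' : state S) o : bool :=
  visit w t h x a o && (run_st (w o) t h.+1 == x').

(** The last step is removed first, with the indicator of the preceding steps in the weight. The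
    policy of the episode is fixed at its start, so the factor it contributes is adapted to [F t 0]
    and can join [W] for the induction hypothesis. *)
Lemma prefix_law t (s : nat -> state S) (b : nat -> action S) k (W : Omega -> R) :
  (1 <= t <= T)%N -> (k <= len S)%N -> s 0%N = x_first S ->
  adapted (F t 0%N) W -> (forall o, 0 <= W o) ->
  (\int[Pr]_o (W o * \prod_(h < k) (step_indic t h (s h) (b h) (s h.+1) o)%:R)%:E =
   \int[Pr]_o (W o * \prod_(h < k) (mu t o (s h) (b h) * P (s h) (b h) (s h.+1)))%:E)%E.
Proof.
move=> tT + s0; have [P0 _ _] := trans_transition M.
have mu0 o x a : 0 <= mu t o x a by have [] := mup o tT.
elim: k W => [|k IHk] W kL mW W0.
  by apply: eq_integral => o _; rewrite !big_ord0.
have kL' := ltnW kL.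
pose V o := W o * \prod_(h < k) (step_indic t h (s h) (b h) (s h.+1) o)%:R.
have mV : adapted (F t k) V.
  apply: adaptedM.
    apply: adapted_sub mW; [exact: (F_sigma IM)|exact: (F_sigma IM)|].
    exact: (F_le_step IM).
  apply: adapted_prod => h _; have hk := ltn_ord h.
  have hL : (h < len S)%N by exact: leq_trans kL'.
  apply: (@adapted_sub _ _ _ (F t h.+1)).
  - exact: (F_sigma IM).
  - exact: (F_sigma IM).
  - by apply: (F_le_step IM) => //; rewrite hk.
  - by apply: adapted_bool; [exact: (F_sigma IM)|exact: (F_transition IM)].
have V0 o : 0 <= V o by rewrite mulr_ge0// prodr_ge0.
(* The prefix already forces the state at step [k]: by its last transition, or by the initial state
   if [k] is 0. *)
have Vk o : V o * (run_st (w o) t k == s k)%:R = V o.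
  rewrite /V; case: {mV V0 V} k IHk kL kL' => [|k] IHk kL kL'.
    by rewrite (interact_start IM)// s0 eqxx mulr1.
  rewrite big_ord_recr/= [step_indic t k _ _ _ o]/step_indic.
  by case: (_ == s k.+1); rewrite ?mulr1// andbF !mulr0.
transitivity (\int[Pr]_o (V o *
    ((run_st (w o) t k == s k)%:R * mu t o (s k) (b k) * P (s k) (b k) (s k.+1)))%:E)%E.
  rewrite -(visit_step_law IM mup _ _ _ tT kL mV V0).
  by apply: eq_integral => o _; rewrite big_ord_recr/= mulrA.
pose W' o := W o * (mu t o (s k) (b k) * P (s k) (b k) (s k.+1)).
transitivity (\int[Pr]_o (W' o * \prod_(h < k) (step_indic t h (s h) (b h) (s h.+1) o)%:R)%:E)%E.
  apply: eq_integral => o _; congr (_%:E).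
  by rewrite mulrA mulrA Vk /V /W'; ring.
rewrite IHk//.
- by apply: eq_integral => o _; rewrite big_ord_recr/= /W'; congr (_%:E); ring.
- apply: adaptedM => //; apply: adaptedM; last exact: adapted_cst.
  exact: (adapted_policy IM).
- by move=> o; rewrite !mulr_ge0.
Qed.

Definition episode (t : nat) (o : Omega) : traj S :=
  ([ffun h : 'I_(len S).+1 => run_st (w o) t h], [ffun h : 'I_(len S) => run_ac (w o) t h]).

Lemma episodeE t o (tau : traj S) : tau.1 ord0 = x_first S -> (1 <= t <= T)%N ->
  (episode t o == tau)%:R =
  \prod_(h < len S) (step_indic t h (st tau h) (ac tau h) (st_next tau h) o)%:R :> R.
Proof.
move=> tau0 tT; case: eqP => [<-|ne].
  rewrite big1// => h _; rewrite /step_indic /visit /st /ac /st_next !ffunE/=.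
  by rewrite !eqxx.
apply/esym/eqP; rewrite prodf_seq_eq0; apply/negPn/negP => /hasPn h.
have {}h (k : 'I_(len S)) : step_indic t k (st tau k) (ac tau k) (st_next tau k) o.
  by have /= := h k (mem_index_enum k); rewrite pnatr_eq0 eqb0 negbK.
apply: ne; rewrite /episode; case: tau tau0 h => s b /= s0 h; congr pair.
  apply/ffunP => k; rewrite ffunE; case: (unliftP ord0 k) => [j ->|->].
    by have /andP[_ /eqP] := h j.
  by rewrite s0 (interact_start IM).
by apply/ffunP => k; rewrite ffunE; have /andP[/andP[_ /eqP]] := h k.
Qed.

Lemma episode_law t (tau : traj S) (W : Omega -> R) : (1 <= t <= T)%N ->
  adapted (F t 0%N) W -> (forall o, 0 <= W o) ->
  (\int[Pr]_o (W o * (episode t o == tau)%:R)%:E =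
   \int[Pr]_o (W o * traj_prob P (mu t o) tau)%:E)%E.
Proof.
move=> tT mW W0.
have [tau0|tau0] := eqVneq (tau.1 ord0) (x_first S); last first.
  apply: eq_integral => o _; rewrite /traj_prob (negbTE tau0) mul0r.
  case: eqP => // et; rewrite -et ffunE (interact_start IM)//= in tau0.
  by rewrite eqxx in tau0.
pose s h := tau.1 (inord h).
(* [prefix_law] takes sequences indexed by [nat]. Values beyond the episode are irrelevant, but for
   an episode without steps a default action has to be extracted from the policy, whose
   probabilities sum to 1. *)
have [b bE] : exists b : nat -> action S, forall h : 'I_(len S), b h = tau.2 h.
  have [L0|L0] := posnP (len S).
    have [a] : inhabited (action S).
      have [_ p1] := mup point tT.
      case: (pickP (fun _ : action S => true)) => [a _|a0]; first by split.
      have := p1 (x_first S); rewrite big_pred0 => [/eqP|a].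
        by rewrite eq_sym oner_eq0.
      by have := a0 a.
    by exists (fun=> a) => -[h hL]; exfalso; move: hL; rewrite L0.
  exists (fun h => tau.2 (Ordinal (ltn_pmod h L0))) => h; congr (tau.2 _).
  by apply: val_inj; rewrite /= modn_small.
have s1 (h : 'I_(len S)) : s h = st tau h.
  by rewrite /s /st; congr (tau.1 _); apply: val_inj; rewrite /= inordK// ltnS ltnW.
have s2 (h : 'I_(len S)) : s h.+1 = st_next tau h.
  by rewrite /s /st_next; congr (tau.1 _); apply: val_inj; rewrite /= inordK// ltnS.
have s0 : s 0%N = x_first S.
  by rewrite -tau0; congr (tau.1 _); apply: val_inj; rewrite /= inordK.
have := prefix_law b tT (leqnn (len S)) s0 mW W0.
have <- : (\int[Pr]_o (W o * (episode t o == tau)%:R)%:E =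
   \int[Pr]_o (W o * \prod_(h < len S) (step_indic t h (s h) (b h) (s h.+1) o)%:R)%:E)%E.
  apply: eq_integral => o _; rewrite episodeE//; congr (_ * _)%:E.
  by apply: eq_bigr => h _; rewrite s1 s2 bE.
move=> ->; apply: eq_integral => o _; rewrite /traj_prob tau0 eqxx mul1r; congr (_ * _)%:E.
by apply: eq_bigr => h _; rewrite s1 s2 bE.
Qed.

Lemma F_episode t (tau : traj S) : (1 <= t <= T)%N -> measurable [set o | episode t o == tau].
Proof.
move=> tT; rewrite (_ : [set _ | _] =
  (\bigcap_(h in [set: 'I_(len S).+1]) [set o | run_st (w o) t h = tau.1 h]) `&`
  (\bigcap_(h in [set: 'I_(len S)]) [set o | run_ac (w o) t h = tau.2 h])); last first.
  apply/seteqP; split=> o /=.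
    by move=> /eqP <-; split=> h _ /=; rewrite ffunE.
  move=> [h1 h2]; apply/eqP; rewrite /episode; case: tau h1 h2 => s b /= h1 h2.
  by congr pair; apply/ffunP => h; rewrite ffunE; [exact: h1|exact: h2].
apply: measurableI; apply: fin_bigcap_measurable => // h _.
  apply: (@F_measurable _ _ _ _ _ _ _ _ _ _ IM t h) => //; first by rewrite -ltnS.
  by apply: (interact_state IM) => //; rewrite -ltnS.
apply: (@F_measurable _ _ _ _ _ _ _ _ _ _ IM t h.+1) => //.
exact: (interact_action IM).
Qed.

Lemma episode_sum t (o : Omega) (f : state S -> action S -> R) :
  \sum_(h < len S) f (st (episode t o) h) (ac (episode t o) h) =
  \sum_(h < len S) f (run_st (w o) t h) (run_ac (w o) t h).
Proof. by apply: eq_bigr => h _; rewrite /st /ac !ffunE. Qed.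

Lemma adapted_value_to_go t (G : set (set Omega)) (g : Omega -> state S -> action S -> R) n x :
  (forall y b, adapted G (fun o => mu t o y b)) -> (forall y b, adapted G (fun o => g o y b)) ->
  adapted G (fun o => value_to_go P (mu t o) (g o) n x).
Proof.
move=> mmu mg; elim: n x => [|n IHn] x /=; first exact: adapted_cst.
apply: adapted_sum => a _; apply: adaptedM => //; apply: adaptedD => //.
by apply: adapted_sum => x' _; apply: adaptedM => //; exact: adapted_cst.
Qed.

Section azuma.
Variables (g : nat -> Omega -> state S -> action S -> R) (c : R).
Hypothesis c0 : 0 < c.
Hypothesis L0 : (0 < len S)%N.
Hypothesis T1 : (1 <= T)%N.
Hypothesis g01 : forall t o x a, 0 <= g t o x a <= c.
Hypothesis mg : forall t x a, (1 <= t <= T)%N -> adapted (F t 0%N) (fun o => g t o x a).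

Let m t o := value_to_go P (mu t o) (g t o) (len S) (x_first S).
Let Gs t o (tau : traj S) := \sum_(h < len S) g t o (st tau h) (ac tau h).

(** The total of [g] over an episode lies in [[0, c * len S]]; the last term is the compensator that
    Hoeffding's lemma gives for this range. *)
Let xi s t o : R := s * (m t o - \sum_(h < len S) g t o (run_st (w o) t h) (run_ac (w o) t h))
  - s ^+ 2 * (c * (len S)%:R) ^+ 2 / 8.

Let adapted_m t : (1 <= t <= T)%N -> adapted (F t 0%N) (m t).
Proof.
move=> tT; apply: adapted_value_to_go => y b; last exact: mg.
exact: (adapted_policy IM).
Qed.

Let sum_episode t o (k : traj S -> R) :
  k (episode t o) = \sum_tau (episode t o == tau)%:R * k tau.
Proof.
rewrite (bigD1 (episode t o))//= eqxx mul1r big1 ?addr0// => tau.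
by rewrite eq_sym => /negbTE ->; rewrite mul0r.
Qed.

Let xiE s t o : xi s t o = s * (m t o - Gs t o (episode t o))
  - s ^+ 2 * (c * (len S)%:R) ^+ 2 / 8.
Proof. by rewrite /xi /Gs episode_sum. Qed.

Lemma azuma_adapted s t : (1 <= t <= T)%N -> adapted (history S T F t.+1) (xi s t).
Proof.
move=> /[dup] tT /andP[t1 tT'].
have tt : (1 <= t < t.+1)%N by rewrite t1 ltnSn.
have mh (W : Omega -> R) h : (h <= len S)%N -> adapted (F t h) W ->
    adapted (history S T F t.+1) W.
  by move=> hL; exact: (adapted_F_history IM T1 tt tT' hL).
apply: adaptedB; last exact: adapted_cst.
apply: adaptedM; first exact: adapted_cst.
apply: adaptedB; first by apply: mh (adapted_m tT).
apply: adapted_sum => h _.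
(* [g] is evaluated at a random pair; summing over all pairs reduces this to fixed pairs, where [mg]
   applies. *)
rewrite (_ : (fun o => _) = fun o => \sum_(p : state S * action S)
    ((visit w t h p.1 p.2 o)%:R * g t o p.1 p.2)); last first.
  apply/funext => o; rewrite (bigD1 (run_st (w o) t h, run_ac (w o) t h))//=.
  rewrite /visit !eqxx mul1r big1 ?addr0// => -[y b] /=.
  by rewrite xpair_eqE ![_ == y]eq_sym ![_ == b]eq_sym => /negbTE ->; rewrite mul0r.
apply: adapted_sum => p _; apply: adaptedM.
  by apply: (mh _ h.+1) => //; exact: (adapted_visit IM).
by apply: (mh _ 0%N) => //; exact: mg.
Qed.

(** Given the past, the trajectory has the finite law [traj_prob], so the conditional expectation is
    a sum over trajectories. Its mean total is [m t o], and [hoeffding_sum] applies for each outcome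
    separately. *)
Lemma azuma_supermartingale s t W : (1 <= t <= T)%N -> adapted (F t 0%N) W ->
  (forall o, 0 <= W o) ->
  (\int[Pr]_o (W o * expR (xi s t o))%:E <= \int[Pr]_o (W o)%:E)%E.
Proof.
move=> tT mW W0.
have tM := trans_transition M.
pose cL := c * (len S)%:R.
have cL0 : 0 < cL by rewrite mulr_gt0// ltr0n.
pose V (tau : traj S) o := W o * expR (s * (m t o - Gs t o tau) - s ^+ 2 * cL ^+ 2 / 8).
have V0 tau o : 0 <= V tau o by rewrite mulr_ge0 ?expR_ge0.
have mV tau : adapted (F t 0%N) (V tau).
  apply: adaptedM => //; apply: adapted_expR; apply: adaptedB; last exact: adapted_cst.
  apply: adaptedM; first exact: adapted_cst.
  apply: adaptedB; first exact: adapted_m.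
  by apply: adapted_sum => h _; exact: mg.
have mVm tau : measurable_fun setT (V tau) := adapted_mfun IM tT (leq0n _) (mV tau).
have tp0 tau o : 0 <= traj_prob P (mu t o) tau by apply: traj_prob_ge0 => //; exact: mup.
have mtp tau : adapted (F t 0%N) (fun o => traj_prob P (mu t o) tau).
  apply: adaptedM; first exact: adapted_cst.
  apply: adapted_prod => h _; apply: adaptedM; last exact: adapted_cst.
  exact: (adapted_policy IM).
have -> : (\int[Pr]_o (W o * expR (xi s t o))%:E =
    \sum_tau \int[Pr]_o (V tau o * (episode t o == tau)%:R)%:E)%E.
  rewrite -ge0_real_integral_sum.
  - apply: eq_integral => o _; congr (_%:E); rewrite xiE.
    rewrite (sum_episode t o (fun tau => expR (s * (m t o - Gs t o tau) - _))) mulr_sumr.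
    by apply: eq_bigr => tau _; rewrite /V mulrCA mulrC.
  - by move=> tau o; rewrite mulr_ge0.
  - by move=> tau; apply: measurable_funM => //; apply: measurable_boolR; exact: F_episode.
under eq_bigr do rewrite episode_law//.
rewrite -ge0_real_integral_sum; last 2 first.
- by move=> tau o; rewrite mulr_ge0.
- by move=> tau; apply: (adapted_mfun IM tT (leq0n _)); exact: adaptedM.
apply: ge0_le_real_integral => [r|r||].
- by apply: sumr_ge0 => tau _; rewrite mulr_ge0.
- move: r => o; have muo := mup o tT.
  have := @hoeffding_sum R _ (traj_prob P (mu t o)) (Gs t o) cL s (tp0 ^~ o)
    (traj_prob_sum1 tM muo) cL0 _.
  have mE : \sum_tau traj_prob P (mu t o) tau * Gs t o tau = m t o by exact: traj_value.
  rewrite mE => hs.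
  have Gc tau : 0 <= Gs t o tau <= cL.
    rewrite sumr_ge0/= => [|h _]; last by have /andP[] := g01 t o (st tau h) (ac tau h).
    rewrite /cL -[X in _ <= _ * X%:R]card_ord mulr_natr -sumr_const ler_sum// => h _.
    by have /andP[] := g01 t o (st tau h) (ac tau h).
  have {}hs := hs Gc.
  set B := s ^+ 2 * cL ^+ 2 / 8 in V V0 mV mVm hs *.
  have -> : \sum_tau V tau o * traj_prob P (mu t o) tau = W o * expR (- B) *
      \sum_tau traj_prob P (mu t o) tau * expR (s * (m t o - Gs t o tau)).
    by rewrite mulr_sumr; apply: eq_bigr => tau _; rewrite /V expRD; ring.
  apply: le_trans (ler_wpM2l _ hs) _; first by rewrite mulr_ge0 ?expR_ge0.
  by rewrite -mulrA -expRD addNr expR0 mulr1.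
- apply: (adapted_mfun IM tT (leq0n _)); apply: adapted_sum => tau _.
  exact: adaptedM.
- exact: (adapted_mfun IM tT (leq0n _)).
Qed.

Lemma azuma (l : R) : 0 < l ->
  exists Bad : set Omega, [/\ measurable Bad, (Pr Bad <= (expR (- l))%:E)%E &
    forall o, ~ Bad o -> \sum_(1 <= t < T.+1) m t o <=
      \sum_(1 <= t < T.+1) \sum_(h < len S) g t o (run_st (w o) t h) (run_ac (w o) t h)
      + c * (len S)%:R * Num.sqrt (T%:R * l)].
Proof.
move=> l0.
have cL0 : 0 < c * (len S)%:R by rewrite mulr_gt0// ltr0n.
set cL := c * (len S)%:R in cL0 *.
have T0 : (0 : R) < T%:R by rewrite ltr0n.
set r := Num.sqrt (T%:R * l).
have r0 : 0 < r by rewrite sqrtr_gt0 mulr_gt0.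
have r2 : r ^+ 2 = T%:R * l by rewrite sqr_sqrtr// mulr_ge0// ltW.
(* The optimal factor is [2 * sqrt 2] in place of 4. This choice avoids a further root and gives a
   deviation of [3 / 4 * cL * r], below the claimed [cL * r]. *)
clearbody r; pose s := 4 * r / (T%:R * cL).
have s0 : 0 < s by rewrite divr_gt0// mulr_gt0.
have [mB PB] := supermartingale_tail IM T1 l (@azuma_adapted s) (@azuma_supermartingale s).
exists [set o | l <= \sum_(1 <= u < T.+1) xi s u o]; split=> //.
move=> o /= /negP; rewrite -ltNge /xi.
rewrite sumrB -mulr_sumr sumr_const_nat subn1 /= -/cL sumrB.
set A := \sum_(1 <= t < T.+1) m t o; set D := \sum_(_ <= _ < _) \sum_(_ < _) _.
have lE : l = r ^+ 2 / T%:R by rewrite r2 mulrC mulKf// lt0r_neq0.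
rewrite (_ : (s ^+ 2 * cL ^+ 2 / 8) *+ T = 2 * l); last first.
  by rewrite -mulr_natr /s lE; field; rewrite !lt0r_neq0.
rewrite ltrBlDr (_ : l + 2 * l = s * (3 / 4 * cL * r)); last first.
  by rewrite /s lE; field; rewrite !lt0r_neq0.
rewrite ltr_pM2l// => h; rewrite -lerBlDl; apply: ltW; apply: (lt_le_trans h).
have : 0 <= cL * r by rewrite mulr_ge0// ltW.
lra.
Qed.


End azuma.
End episodes.

(** Only the exceptional sets are required to be measurable, not the properties that hold outside
    them; this allows properties quantified over episodes and sets without a measurability proof. *)
Lemma union_bound d (T : measurableType d) (R : realType) (mu : {measure set T -> \bar R})
    (I : finType) (prop : I -> T -> Prop) (e : I -> R) :
  (forall i, exists B : set T, [/\ measurable B, (mu B <= (e i)%:E)%E &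
     forall o, ~ B o -> prop i o]) ->
  exists Bad : set T, [/\ measurable Bad, (mu Bad <= (\sum_i e i)%:E)%E &
     forall o, ~ Bad o -> forall i, prop i o].
Proof.
move=> /choice[B BP].
have mB i : measurable (B i) by have [] := BP i.
have mb i : measurable [set o | `[< B i o >]].
  by rewrite (_ : [set _ | _] = B i)//; apply/seteqP; split=> o /= /asboolP.
exists (\bigcup_(i in [set: I]) B i); split.
- exact: fin_bigcup_measurable.
- have mU : measurable [set o | `[< (\bigcup_(i in [set: I]) B i) o >]].
    rewrite (_ : [set _ | _] = \bigcup_(i in [set: I]) B i); first exact: fin_bigcup_measurable.
    by apply/seteqP; split=> o /= /asboolP.
  apply: (@le_trans _ _ (\sum_i mu (B i))%E); last first.
    by rewrite -sumEFin; apply: lee_sum => i _; have [] := BP i.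
  rewrite (_ : (\bigcup_(i in [set: I]) B i) =
      setT `&` [set o | `[< (\bigcup_(i in [set: I]) B i) o >]]); last first.
    by rewrite setTI; apply/seteqP; split=> o /= /asboolP.
  rewrite -(integral_bool (R := R))//.
  apply: (@le_trans _ _ (\int[mu]_o (\sum_i (`[< B i o >])%:R)%:E)%E).
    apply: ge0_le_real_integral => //.
    + move=> o; case: asboolP => [[i _ Bi]|_]; last by apply: sumr_ge0.
      by rewrite (bigD1 i)//= asboolT// lerDl sumr_ge0.
    + exact: measurable_boolR.
    + by apply: measurable_sum => i; exact: measurable_boolR.
  rewrite ge0_real_integral_sum// => [|i]; last exact: measurable_boolR.
  apply: lee_sum => i _; rewrite integral_bool// setTI.
  rewrite (_ : [set _ | _] = B i)//; apply/seteqP; split=> o /= /asboolP //.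
- move=> o nB i; have [_ _] := BP i; apply => Bi; apply: nB.
  by exists i.
Qed.

(** * Runs that respect the layers *)

Section layered_runs.
Variables (R : realType) (S : layered_space) (T : nat).
Implicit Types w : run R S.

Definition layered_run w := forall t h, (1 <= t <= T)%N -> (h <= len S)%N ->
  layer (run_st w t h) = h :> nat.

Definition visit_at w (x : state S) (a : action S) t : bool :=
  (run_st w t (layer x) == x) && (run_ac w t (layer x) == a).

(** Connects the counts of the algorithm, which run over all steps, with the single step [layer x]
    at which the concentration bounds are proved. *)
Lemma layered_visit w t x a (phi : nat -> R) : layered_run w -> (1 <= t <= T)%N ->
  \sum_(h < len S) ((run_st w t h == x) && (run_ac w t h == a))%:R * phi h =
  if (layer x < len S)%N then (visit_at w x a t)%:R * phi (layer x) else 0.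
Proof.
move=> lw tT; case: ltnP => [xL|Lx].
  rewrite (bigD1 (Ordinal xL))//= big1 ?addr0// => h hx.
  case: eqP => [e|]; rewrite ?mul0r//=; case/negP: hx; apply/eqP/val_inj => /=.
  by rewrite -(lw t h tT (ltnW (ltn_ord h))) e.
rewrite big1// => h _; case: eqP => [e|]; rewrite ?mul0r//.
by move: Lx; rewrite -e (lw t h tT (ltnW (ltn_ord h))) leqNgt ltn_ord.
Qed.

(** [layer_visits] read off a single run: the two unfold to the same sum. *)
Definition layer_count w x a t : nat := \sum_(1 <= u < t) visit_at w x a u.

Lemma layered_visits2 w t x a : layered_run w -> (1 <= t <= T.+1)%N ->
  visits2 w 1 t x a = if (layer x < len S)%N then layer_count w x a t else 0%N.
Proof.
move=> lw /andP[t1 tT]; apply/eqP; rewrite -(eqr_nat R) /visits2 natr_sum.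
rewrite big_nat (eq_bigr (fun u => if (layer x < len S)%N then (visit_at w x a u)%:R else 0)).
  rewrite -big_nat /layer_count; case: ifP => _; last by rewrite big1.
  by rewrite natr_sum.
move=> u /andP[u1 ut]; rewrite natr_sum.
have uT : (1 <= u <= T)%N by rewrite u1/=; lia.
have /= := layered_visit x a (fun=> 1) lw uT; under eq_bigr do rewrite mulr1.
by rewrite mulr1 => ->.
Qed.

Lemma layered_visits3 w t x a x' : layered_run w -> (1 <= t <= T.+1)%N -> (layer x < len S)%N ->
  (visits3 w 1 t x a x')%:R =
  \sum_(1 <= u < t) (visit_at w x a u)%:R * (run_st w u (layer x).+1 == x')%:R :> R.
Proof.
move=> lw /andP[t1 tT] xL; rewrite /visits3 natr_sum !big_nat.
apply: eq_bigr => u /andP[u1 ut]; rewrite natr_sum.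
have uT : (1 <= u <= T)%N by rewrite u1/=; lia.
have := layered_visit x a (fun h => (run_st w u h.+1 == x')%:R) lw uT.
rewrite xL => <-.
by apply: eq_bigr => h _; rewrite -natrM mulnb -andbA.
Qed.

Lemma layered_reward_sum w t x a : layered_run w -> (1 <= t <= T.+1)%N -> (layer x < len S)%N ->
  reward_sum w 1 t x a = \sum_(1 <= u < t) (visit_at w x a u)%:R * run_rw w u (layer x).
Proof.
move=> lw /andP[t1 tT] xL; rewrite /reward_sum !big_nat.
apply: eq_bigr => u /andP[u1 ut].
have uT : (1 <= u <= T)%N by rewrite u1/=; lia.
have := layered_visit x a (fun h => run_rw w u h) lw uT.
rewrite xL => <-.
rewrite big_mkcond/=; apply: eq_bigr => h _.
by case: (_ && _); rewrite ?mul1r ?mul0r.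
Qed.

Lemma layer_count_le w x a t : (1 <= t)%N -> (layer_count w x a t <= t.-1)%N.
Proof.
move=> t1; rewrite /layer_count -(subn1 t) -[leqRHS]muln1 -sum_nat_const_nat leq_sum// => u _.
by case: (visit_at _ _ _ _).
Qed.

End layered_runs.

Section layered_event.
Context (R : realType) (S : layered_space) (M : layered_mdp R S) (T : nat)
  (d : measure_display) (Omega : measurableType d) (Pr : probability Omega R)
  (F : nat -> nat -> set (set Omega)) (w : Omega -> run R S)
  (mu : nat -> Omega -> state S -> action S -> R).
Hypothesis IM : interaction M T Pr F w mu.

(** By [interact_law], each transition between non-consecutive layers at a given episode and step
    has probability zero, and there are finitely many. Outside their union the layer increases by
    one at each step. *)
Lemma layered_almost_surely : exists Bad : set Omega,
  [/\ measurable Bad, (Pr Bad <= 0)%E & forall o, ~ Bad o -> layered_run T (w o)].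
Proof.
have [|Bad [mB PB BP]] := @union_bound _ _ _ Pr _
  (fun (i : 'I_T * 'I_(len S) * state S * action S * state S) o =>
    let: (t, h, x, a, x') := i in
    ~~ next_layer x x' -> ~~ (visit w t.+1 h x a o && (run_st (w o) t.+1 h.+1 == x')))
  (fun=> 0).
  move=> [[[[t h] x] a] x'].
  have tT : (1 <= t.+1 <= T)%N by rewrite /=.
  have [xx'|xx'] := boolP (next_layer x x').
    by exists set0; split=> //; rewrite measure0.
  exists [set o | visit w t.+1 h x a o && (run_st (w o) t.+1 h.+1 == x')]; split.
  - by apply: (F_measurable IM tT (ltn_ord h)); exact: (F_transition IM).
  - have := interact_law IM x a x' tT (ltn_ord h)
      (_ : F t.+1 h setT) (@measurableT _ (measurableTypeR R)).
    have sF := F_sigma IM tT (ltnW (ltn_ord h)).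
    have FT : F t.+1 h setT.
      by rewrite -(measurable_g_measurableTypeE sF); exact: measurableT.
    have P0 : trans M x a x' = 0.
      apply/eqP; apply: contraNT xx' => Pn0.
      by rewrite /next_layer (trans_next (trans_transition M) Pn0).
    move=> /(_ FT); rewrite P0 mule0 setTI => h0.
    rewrite le_eqVlt; apply/orP; left; apply/eqP; rewrite -[RHS]h0; congr (Pr _).
    apply/seteqP; split=> o /=; rewrite /visit.
      by move=> /andP[/andP[/eqP ? /eqP ?] /eqP ?].
    by move=> [-> -> _ ->]; rewrite !eqxx.
  - by move=> o /negP.
exists Bad; split=> //; first by rewrite big1// in PB.
move=> o nB t h tT; elim: h => [|h IHh] hL.
  by rewrite (interact_start IM)// layer_x_first.
have /andP[t1 tT'] := tT.
have tm : (t.-1 < T)%N by rewrite prednK.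
have := BP o nB (Ordinal tm, Ordinal hL, run_st (w o) t h, run_ac (w o) t h, run_st (w o) t h.+1).
rewrite /= prednK// /visit !eqxx /= => h'.
have : next_layer (run_st (w o) t h) (run_st (w o) t h.+1) by apply/negPn/negP => /h'.
by rewrite /next_layer IHh 1?ltnW// => /eqP.
Qed.

End layered_event.

(** * Counting visits *)

(** A visit raises the root of the count from [p] to [q] with [q - p = 1 / (q + p)], and
    [q <= 2 * p] gives [1 / p <= 3 * (q - p)]. Only the first visit, whose count is replaced by 1,
    is treated apart. *)
Lemma sum_inv_sqrt_count (R : realType) (b : nat -> bool) (t : nat) : (1 <= t)%N ->
  \sum_(1 <= u < t) (b u)%:R / Num.sqrt ((maxn 1 (\sum_(1 <= v < u) b v)%N)%:R) <=
  3 * Num.sqrt ((\sum_(1 <= u < t) b u)%N%:R) :> R.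
Proof.
elim: t => // t IHt _; have [->|t1] := posnP t.
  by rewrite !big_nil sqrtr0 mulr0.
rewrite !big_nat_recr//=; apply: le_trans (lerD (IHt t1) (lexx _)) _.
set N := (\sum_(1 <= u < t) b u)%N; case: (b t); last by rewrite mul0r addr0 addn0.
rewrite mul1r addn1; case: N => [|n].
  by rewrite sqrtr0 mulr0 add0r (_ : maxn 1 0 = 1%N)// sqrtr1 invr1 mulr1 ler1n.
rewrite (_ : maxn 1 n.+1 = n.+1); last by lia.
set p := Num.sqrt n.+1%:R; set q := Num.sqrt n.+2%:R.
have p0 : 0 < p by rewrite sqrtr_gt0 ltr0n.
have q0 : 0 < q by rewrite sqrtr_gt0 ltr0n.
have p2 : p ^+ 2 = n.+1%:R by rewrite sqr_sqrtr// ler0n.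
have q2 : q ^+ 2 = p ^+ 2 + 1 by rewrite sqr_sqrtr ?ler0n// p2 -natr1.
have p1 : 1 <= p ^+ 2 by rewrite p2 ler1n.
have qp : q <= 2 * p by rewrite -(ler_pXn2r (n := 2)) ?nnegrE// ?mulr_ge0 ?ltW// exprMn q2; lra.
rewrite -(ler_pM2r p0) mulrDl mulVf ?lt0r_neq0//.
have : (q - p) * (q + p) = 1 by rewrite -subr_sqr q2; ring.
nra.
Qed.

(** A linearized Cauchy-Schwarz inequality: the bound is linear in [v], which will be a visit count,
    so it can be summed over a layer, and [c] is chosen afterwards. *)
Lemma sqrtrM_le_amgm (R : realType) (c u v : R) : 0 < c -> 0 <= u -> 0 <= v ->
  Num.sqrt (u * v) <= (c * v + u / c) / 2.
Proof.
move=> c0 u0 v0.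
have h0 : 0 <= (c * v + u / c) / 2.
  by rewrite divr_ge0// addr_ge0//; [exact: mulr_ge0 (ltW c0) v0|exact: divr_ge0 u0 (ltW c0)].
rewrite -[leRHS]ger0_norm// -sqrtr_sqr ler_wsqrtr//.
have -> : u * v = (c * v) * (u / c) by field; rewrite lt0r_neq0.
have := sqr_ge0 (c * v - u / c); rewrite !expr2.
set A := c * v; set B := u / c; nra.
Qed.

(** * Layer sizes and visits per layer *)

Section layer_sizes.
Variables (R : realType) (S : layered_space).

Lemma layer_sizeE k : layer_size S k = #|[pred x : state S | layer x == k :> nat]|.
Proof.
apply: eq_card => x; rewrite !inE.
by apply/idP/idP => [/asboolP|] xk; [exact: xk|exact/asboolP].
Qed.

Lemma sum_layer_size : (\sum_(k < (len S).+1) layer_size S k = #|state S|)%N.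
Proof.
rewrite -sum1_card (partition_big (@layer S) predT)//=.
by apply: eq_bigr => k _; rewrite layer_sizeE sum1_card.
Qed.

Lemma sum_layer_mean :
  \sum_(k < len S) (((layer_size S k)%:R + (layer_size S k.+1)%:R) / 2) <= #|state S|%:R :> R.
Proof.
rewrite -mulr_suml big_split/= ler_pdivrMr// mulr_natr mulr2n -sum_layer_size natr_sum.
apply: lerD.
  by rewrite big_ord_recr/= lerDl.
by rewrite big_ord_recl/= lerDr.
Qed.

(** A [layered_space] by itself may have empty intermediate layers. A transition function excludes
    them: its probabilities sum to 1 at each state before the last, so every layer has a
    successor. *)
Lemma layer_gt0 (P : state S -> action S -> state S -> R) (a : action S) :
  is_transition P -> forall k, (k <= len S)%N -> exists x : state S, layer x = k :> nat.
Proof.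
move=> tP; elim=> [|k IHk] kL; first by exists (x_first S); rewrite layer_x_first.
have [x xk] := IHk (ltnW kL).
have := trans_sum1 (x := x) a tP; rewrite xk => /(_ kL).
case: (pickP (fun x' => P x a x' != 0)) => [x' /(trans_next tP)|P0].
  by rewrite xk => <- _; exists x'.
by rewrite big1 => [/eqP|x' _]; [rewrite eq_sym oner_eq0|apply/eqP; rewrite -[_ == _]negbK P0].
Qed.

Lemma layer_size_gt0 (P : state S -> action S -> state S -> R) (a : action S) k :
  is_transition P -> (k <= len S)%N -> (0 < layer_size S k)%N.
Proof.
move=> tP kL; have [x xk] := layer_gt0 a tP kL.
by rewrite layer_sizeE; apply/card_gt0P; exists x; rewrite inE xk.
Qed.

Lemma len_lt_card (P : state S -> action S -> state S -> R) (a : action S) :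
  is_transition P -> (len S < #|state S|)%N.
Proof.
move=> tP; rewrite -sum_layer_size -[X in (X <= _)%N]card_ord -sum1_card.
apply: leq_sum => k _; apply: (layer_size_gt0 a tP); exact: (leq_ord k).
Qed.

End layer_sizes.

Lemma sum_by_layer (R : realType) (S : layered_space) (f : state S -> R) :
  \sum_(x | (layer x < len S)%N) f x =
  \sum_(k < len S) \sum_(x | layer x == k :> nat) f x.
Proof.
rewrite (exchange_big_dep (fun x => layer x < len S)%N)/= => [|k x _ /eqP ->//].
apply: eq_bigr => x xL; rewrite (big_pred1 (Ordinal xL))//.
Qed.

Section total_visits.
Variables (R : realType) (S : layered_space) (T : nat) (w : run R S).
Hypothesis lw : layered_run T w.

Lemma layer_count_total (k : 'I_(len S)) :
  (\sum_(x | layer x == k :> nat) \sum_a layer_count w x a T.+1 = T)%N.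
Proof.
transitivity (\sum_(1 <= u < T.+1) 1)%N; last by rewrite sum_nat_const_nat muln1 subn1.
under eq_bigr do rewrite exchange_big/=.
rewrite exchange_big/= !big_nat; apply: eq_bigr => u uT.
have kL := ltn_ord k.
have lk : layer (run_st w u k) = k :> nat by rewrite lw// ltnW.
rewrite (bigD1 (run_st w u k))/= ?lk// (bigD1 (run_ac w u k))//=.
rewrite /visit_at lk !eqxx/= !big1//=.
  by move=> x /andP[/eqP xk /negbTE xs]; rewrite big1// => a _; rewrite xk eq_sym xs.
by move=> a; rewrite eq_sym => /negbTE ->.
Qed.

Lemma sum_sqrt_layer_count (A0 : (0 < #|action S|)%N) (T1 : (1 <= T)%N)
    (X0 : forall k, (k <= len S)%N -> (0 < layer_size S k)%N) :
  \sum_(x | (layer x < len S)%N) \sum_a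
    Num.sqrt ((layer_size S (layer x).+1)%:R * (layer_count w x a T.+1)%:R) <=
  #|state S|%:R * Num.sqrt (#|action S|%:R * T%:R) :> R.
Proof.
have A0' : (0 : R) < #|action S|%:R by rewrite ltr0n.
have T0' : (0 : R) < T%:R by rewrite ltr0n.
set r := Num.sqrt (#|action S|%:R * T%:R).
have r0 : 0 < r by rewrite sqrtr_gt0 mulr_gt0.
have r2 : r ^+ 2 = #|action S|%:R * T%:R by rewrite sqr_sqrtr// mulr_ge0// ltW.
clearbody r.
apply: le_trans (ler_wpM2r (ltW r0) (sum_layer_mean R S)).
rewrite mulr_suml.
rewrite sum_by_layer; apply: ler_sum => k _; have kL := ltn_ord k.
set m := (_ + _) / 2.
have Xk0 : (0 : R) < (layer_size S k)%:R by rewrite ltr0n X0// ltnW.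
have Xk1 : (0 : R) < (layer_size S k.+1)%:R by rewrite ltr0n X0.
have m0 : 0 < m by rewrite divr_gt0// addr_gt0.
(* The visits of a layer add up to [T], so the two halves of the bound become [c * T = m * r] and
   [X_k * X_(k+1) * r / m]. Since [m] is the mean of the two sizes, the second is at most the
   first. *)
pose c := m * r / T%:R.
have c0 : 0 < c by rewrite divr_gt0// mulr_gt0.
apply: (@le_trans _ _ (\sum_(x | layer x == k :> nat) \sum_a
    (c * (layer_count w x a T.+1)%:R + (layer_size S k.+1)%:R / c) / 2)).
  by apply: ler_sum => x /eqP ->; apply: ler_sum => a _; exact: sqrtrM_le_amgm.
under eq_bigr do rewrite -mulr_suml big_split/= -mulr_sumr sumr_const -natr_sum.
rewrite -mulr_suml big_split/= -mulr_sumr -natr_sum layer_count_total sumr_const.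
rewrite -layer_sizeE.
rewrite -[_ *+ layer_size S k]mulr_natr -[_ *+ #|_|]mulr_natr ler_pdivrMr// /c.
rewrite (_ : m * r / T%:R * T%:R = m * r); last by field; rewrite lt0r_neq0.
rewrite (_ : (layer_size S k.+1)%:R / _ * _ * _ =
    (layer_size S k)%:R * (layer_size S k.+1)%:R * r / m); last first.
  rewrite (_ : #|action S|%:R = r ^+ 2 / T%:R); last by rewrite r2 mulfK// lt0r_neq0.
  by field; rewrite !lt0r_neq0.
rewrite (_ : m * r * 2 = m * r + m * r); last by ring.
rewrite lerD2l mulrAC ler_pM2r// ler_pdivrMr// /m.
set u := (layer_size S k)%:R; set v := (layer_size S k.+1)%:R.
have := sqr_ge0 (u - v); rewrite expr2; lra.
Qed.

End total_visits.

(** * Regret of UCRL-LP *)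

Section epochs.
Variables (R : realType) (S : layered_space) (w : run R S).

Lemma visits2_nil s x a : visits2 w s s x a = 0%N.
Proof. by rewrite /visits2 big_geq. Qed.

Lemma epoch_invariant n : let: (i, s) := epoch_rec w n in
  [/\ (1 <= i)%N, (1 <= s <= n.+1)%N, (i = 1 -> s = 1)%N &
      forall x a, (visits2 w s n.+1 x a < maxn 1 (visits2 w 1 s x a))%N].
Proof.
elim: n => [|n]; first by split=> // x a; rewrite visits2_nil leq_max.
move=> /=; case: (epoch_rec w n) => i s [i1 /andP[s1 sn] is1 inv].
case: ifPn => [_|].
  split=> //; [by rewrite ltnSn|by move=> [i0]; rewrite i0 in i1|].
  by move=> x a; rewrite visits2_nil leq_max.
move=> nover; split=> //; first by rewrite s1/= ltnW.
move=> x a; rewrite ltnNge; apply: contra nover => h.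
by apply/existsP; exists x; apply/existsP; exists a.
Qed.

Lemma epoch_start_le t : (1 <= t)%N -> (1 <= epoch_start w t <= t)%N.
Proof.
move=> t1; have := epoch_invariant t.-1; rewrite /epoch_start.
by case: epoch_rec => i s [_ + _ _]; rewrite prednK.
Qed.

Lemma epoch_ge1 t : (1 <= epoch w t)%N.
Proof.
have := epoch_invariant t.-1; rewrite /epoch.
by case: epoch_rec => i s [].
Qed.

Lemma epoch1_start t : epoch w t = 1%N -> epoch_start w t = 1%N.
Proof.
have := epoch_invariant t.-1; rewrite /epoch /epoch_start.
by case: epoch_rec => i s [].
Qed.

(** As long as the epoch has not ended, it has brought fewer than [maxn 1 N] new visits on top of
    the [N] made before it started. *)
Lemma visits2_epoch_doubling t x a : (1 <= t)%N ->
  (visits2 w 1 t x a <= 2 * maxn 1 (visits2 w 1 (epoch_start w t) x a))%N.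
Proof.
move=> t1; have /andP[s1 st] := epoch_start_le t1.
have := epoch_invariant t.-1; move: s1 st; rewrite /epoch_start.
case: epoch_rec => i s /= s1 st [_ _ _ /(_ x a)]; rewrite prednK// => inv.
rewrite {1}/visits2 (big_cat_nat s1 st)/= -/(visits2 w 1 s x a) -/(visits2 w s t x a).
by move: inv; rewrite maxnE; lia.
Qed.

Lemma visits2_0_reward_sum s t x a : visits2 w s t x a = 0%N -> reward_sum w s t x a = 0.
Proof.
move=> v0; rewrite /reward_sum big_nat big1// => u su; rewrite big1// => h hxa.
move: v0; rewrite /visits2 => /eqP; rewrite sum_nat_seq_eq0 => /allP /(_ u).
by rewrite mem_index_iota => /(_ su) /=; rewrite sum_nat_eq0 => /forallP /(_ h) /=; rewrite hxa.
Qed.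

Lemma visits3_le_visits2 s t x a x' : (visits3 w s t x a x' <= visits2 w s t x a)%N.
Proof.
apply: leq_sum => u _; apply: leq_sum => h _.
by case: (_ == x); case: (_ == a); case: (_ == x').
Qed.

End epochs.

(** * Confidence sets and bonuses on a good run *)

Section good_runs.
Variables (R : realType) (S : layered_space) (M : layered_mdp R S) (T : nat) (delta : R).

Local Notation l := (log_term S T delta).
Local Notation L := ((len S)%:R : R).

Definition next_size (x : state S) : R := (layer_size S (layer x).+1)%:R.

(** Everything that the confidence sets need from probability, as inequalities for one run. The
    radii are those of the algorithm times the count, halved for sets of states because the L1
    distance is twice an excess; pairs without visits are dealt with by hand. *)
Definition good_run (w : run R S) : Prop :=
  [/\ layered_run T w,
      forall x a t, (layer x < len S)%N -> (1 <= t <= T)%N ->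
        let n := layer_count w x a t in (0 < n)%N ->
        \sum_(1 <= u < t) (visit_at w x a u)%:R * (run_rw w u (layer x) - reward M x a)
          < n%:R * Num.sqrt (2 * l / n%:R),
      forall x a t, (layer x < len S)%N -> (1 <= t <= T)%N ->
        let n := layer_count w x a t in (0 < n)%N ->
        \sum_(1 <= u < t) (visit_at w x a u)%:R * (- run_rw w u (layer x) - - reward M x a)
          < n%:R * Num.sqrt (2 * l / n%:R) &
      forall x a (B : {set state S}) t, (layer x < len S)%N -> (1 <= t <= T)%N ->
        {in B, forall x', next_layer x x'} ->
        let n := layer_count w x a t in (0 < n)%N ->
        \sum_(1 <= u < t) (visit_at w x a u)%:R *
            ((run_st w u (layer x).+1 \in B)%:R - \sum_(x' in B) trans M x a x')
          < n%:R * Num.sqrt (2 * next_size x * l / n%:R) / 2].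

Variable (w : run R S).
Hypothesis gw : good_run w.
Hypothesis l2 : 1 <= 2 * l.
Hypothesis X0 : forall k, (k <= len S)%N -> (0 < layer_size S k)%N.

Let tM := trans_transition M.

Let next_size_ge1 x : (layer x < len S)%N -> 1 <= next_size x.
Proof. by move=> xL; rewrite ler1n X0. Qed.

Lemma trans_conf_set s : (1 <= s <= T)%N -> conf_set T delta w s (trans M).
Proof.
move=> /[dup] sT' /andP[s1 sT]; have [lw _ _ gT] := gw; split=> // x a xl.
have [P0 _ _] := tM.
have sTS : (1 <= s <= T.+1)%N by rewrite s1 ltnW.
have xL : (layer x < len S)%N.
  rewrite ltn_neqAle -ltnS ltn_ord andbT; apply: contra xl => /eqP xL.
  by rewrite -layer_last -val_eqE/= xL.
have v2 := layered_visits2 x a lw sTS; rewrite xL in v2.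
set n := layer_count w x a s in v2.
rewrite /trans_radius /trans_est v2.
(* Without visits the estimate is zero, not a distribution; the distance is then exactly 1, and [l2]
   makes the radius at least 1. *)
have [n0|n0] := posnP n.
  rewrite n0 (_ : maxn 1 0 = 1%N)//.
  have -> : \sum_x' `|trans M x a x' - (visits3 w 1 s x a x')%:R / 1%:R| = 1.
    rewrite -(trans_sum1 a tM xL); apply: eq_bigr => x' _.
    rewrite (_ : visits3 w 1 s x a x' = 0%N) ?mul0r ?subr0 ?ger0_norm//.
    by apply/eqP; rewrite -leqn0 (leq_trans (visits3_le_visits2 _ _ _ _ _ _))// v2 n0.
  rewrite -[X in X <= _]sqrtr1 ler_wsqrtr// divr1.
  rewrite -/(next_size x) mulrAC; apply: le_trans l2 _.
  by rewrite ler_peMr ?next_size_ge1// (le_trans ler01 l2).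
have n0' : (0 : R) < n%:R by rewrite ltr0n.
rewrite (_ : maxn 1 n = n); last by lia.
pose Ph x' : R := (visits3 w 1 s x a x')%:R / n%:R.
have PhE x' : n%:R * Ph x' = \sum_(1 <= u < s) (visit_at w x a u)%:R * (run_st w u (layer x).+1 == x')%:R.
  by rewrite /Ph mulrC divfK ?lt0r_neq0// (layered_visits3 _ _ lw sTS xL).
have nE : n%:R = \sum_(1 <= u < s) (visit_at w x a u)%:R :> R by rewrite /n natr_sum.
have Ph0 x' : ~~ next_layer x x' -> Ph x' = 0.
  move=> xx'; apply/eqP; rewrite -[_ == 0](mulrI_eq0 _ (mulfI (lt0r_neq0 n0'))) PhE.
  rewrite big_nat big1// => u /andP[u1 us]; case: eqP => [e|]; rewrite ?mulr0//.
  case/negP: xx'; rewrite /next_layer -e lw//; rewrite u1/=; lia.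
have PhB (B : {set state S}) : n%:R * (\sum_(x' in B) (Ph x' - trans M x a x')) =
    \sum_(1 <= u < s) (visit_at w x a u)%:R *
            ((run_st w u (layer x).+1 \in B)%:R - \sum_(x' in B) trans M x a x').
  rewrite sumrB mulrBr; under [RHS]eq_bigr do rewrite mulrBr.
  rewrite [RHS]sumrB; congr (_ - _); last by rewrite nE mulr_suml.
  rewrite mulr_sumr; under eq_bigr do rewrite PhE.
  rewrite exchange_big/=; apply: eq_bigr => u _; rewrite -mulr_sumr; congr (_ * _).
  case: (boolP (_ \in B)) => uB.
    rewrite (bigD1 (run_st w u (layer x).+1))//= eqxx big1 ?addr0// => x' /andP[_].
    by rewrite eq_sym => /negbTE ->.
  by rewrite big1// => x' x'B; case: eqP => // e; rewrite e x'B in uB.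
(* The states whose probability is overestimated. Restricting to the next layer loses nothing,
   because the estimate vanishes elsewhere, and it keeps the number of sets in the union bound at 2
   to the size of that layer. *)
pose B := [set x' | next_layer x x' & trans M x a x' < Ph x']%SET.
have PhT : \sum_x' (Ph x' - trans M x a x') = 0.
  have := PhB [set: state S]%SET; rewrite (eq_bigl xpredT); last by move=> x'; rewrite inE.
  rewrite (eq_bigl xpredT (trans M x a)); last by move=> x'; rewrite inE.
  rewrite trans_sum1//; under [in X in _ = X -> _]eq_bigr do rewrite inE subrr mulr0.
  rewrite [X in _ = X -> _]big1// => /eqP.
  by rewrite mulf_eq0 (negbTE (lt0r_neq0 n0'))/= => /eqP.
have absE : \sum_x' `|trans M x a x' - Ph x'| = 2 * \sum_(x' in B) (Ph x' - trans M x a x').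
  have sgn x' : `|trans M x a x' - Ph x'| =
      2 * (if x' \in B then Ph x' - trans M x a x' else 0) - (Ph x' - trans M x a x').
    rewrite inE; case: ltP => [lt|le].
      case: (boolP (next_layer x x')) => [_|/Ph0 Phx'] /=.
        by rewrite ltr0_norm ?subr_lt0//; ring.
      by move: lt; rewrite Phx' ltNge P0.
    by rewrite andbF ger0_norm ?subr_ge0//; ring.
  rewrite (eq_bigr _ (fun x' _ => sgn x')) sumrB PhT subr0 -mulr_sumr.
  by rewrite -big_mkcond.
have Bnext : {in B, forall x', next_layer x x'} by move=> x'; rewrite inE => /andP[].
have := gT x a B s xL sT' Bnext n0; rewrite -/n -PhB => h.
rewrite absE; move: h; rewrite -mulrA ltr_pM2l// ltr_pdivlMr// mulrC => /ltW.
by rewrite /next_size.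
Qed.

Lemma reward_ucb_bounds s x a : (1 <= s <= T)%N ->
  reward M x a <= reward_ucb T delta w s x a <= 1 /\
  reward_ucb T delta w s x a - reward M x a <=
    2 * Num.sqrt (2 * l / (maxn 1 (visits2 w 1 s x a))%:R).
Proof.
move=> /[dup] sT' /andP[s1 sT]; have [lw gR gR' _] := gw.
have sTS : (1 <= s <= T.+1)%N by rewrite s1 ltnW.
have /andP[r0 r1] := reward01 M x a.
have v2 := layered_visits2 x a lw sTS.
rewrite /reward_ucb; set n := visits2 w 1 s x a in v2 *.
have [n0|n0] := posnP n.
  rewrite visits2_0_reward_sum// n0 (_ : maxn 1 0 = 1%N)// mul0r add0r divr1.
  have b1 : 1 <= Num.sqrt (2 * l) by rewrite -[X in X <= _]sqrtr1 ler_wsqrtr.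
  by rewrite min_l// r1 lexx; split=> //; lra.
rewrite (_ : maxn 1 n = n); last by lia.
have n0' : (0 : R) < n%:R by rewrite ltr0n.
have xL : (layer x < len S)%N.
  by apply: contraTT n0; rewrite v2 => /negbTE ->.
rewrite xL in v2; rewrite (layered_reward_sum _ lw sTS xL).
have := gR x a s xL sT'; have := gR' x a s xL sT'; rewrite /= -v2 => /(_ n0) hN /(_ n0).
set b := Num.sqrt _ in hN *; set rs := \sum_(1 <= u < s) _ * run_rw w u (layer x).
have nE : n%:R = \sum_(1 <= u < s) (visit_at w x a u)%:R :> R by rewrite v2 natr_sum.
have b0 : 0 <= b by rewrite sqrtr_ge0.
have -> : \sum_(1 <= u < s) (visit_at w x a u)%:R * (run_rw w u (layer x) - reward M x a) =
    rs - n%:R * reward M x a.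
  by rewrite nE mulr_suml -sumrB; apply: eq_bigr => u _; rewrite mulrBr.
move: hN; have -> : \sum_(1 <= u < s) (visit_at w x a u)%:R *
    (- run_rw w u (layer x) - - reward M x a) = n%:R * reward M x a - rs.
  by rewrite nE mulr_suml -sumrB; apply: eq_bigr => u _; ring.
move=> h1 h2.
have rsE : rs = n%:R * (rs / n%:R) by rewrite mulrC divfK// lt0r_neq0.
move: h1 h2; rewrite rsE -!mulrBr !ltr_pM2l// -rsE => h1 h2.
split; last by rewrite lerBlDr ge_min; apply/orP; right; lra.
by rewrite le_min r1 ge_min lexx orTb andbT/=; lra.
Qed.

(* 3 comes from the trivial bounds 1 on the error in the rewards and 2 on the L1
   error in the transitions; 8 absorbs the doubling of the counts within an
   epoch, so that the bonus depends on the current count [n] and not on the count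
   at the start of the epoch. *)
Definition bonus (n : nat) (x : state S) : R :=
  L * Num.min 3 (8 * Num.sqrt (next_size x * l / (maxn 1 n)%:R)).

Lemma bonus01 n x : 0 <= bonus n x <= 3 * L.
Proof.
apply/andP; split; rewrite /bonus.
  by rewrite mulr_ge0// le_min ler0n mulr_ge0// sqrtr_ge0.
by rewrite mulrC ler_wpM2r// ge_min lexx.
Qed.

Lemma bonus_ge n m x (g : R) : (layer x < len S)%N -> (n <= 2 * maxn 1 m)%N ->
  g <= 3 * L -> g <= 2 * Num.sqrt (2 * l / (maxn 1 m)%:R) +
    L * (2 * Num.sqrt (2 * next_size x * l / (maxn 1 m)%:R)) -> g <= bonus n x.
Proof.
move=> xL nm g3 gb; have L1 : 1 <= L by rewrite ler1n (leq_ltn_trans _ xL).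
have Sx := next_size_ge1 xL.
have l0 : 0 < l by have := lt_le_trans ltr01 l2; rewrite pmulr_rgt0.
set m' := (maxn 1 m)%:R in gb.
have m0 : 0 < m' by rewrite ltr0n leq_max.
set y := Num.sqrt (next_size x * l / (maxn 1 n)%:R).
have N0 : (0 : R) < (maxn 1 n)%:R by rewrite ltr0n leq_max.
have Nm : (maxn 1 n)%:R <= 2 * m' :> R by rewrite /m' -natrM ler_nat; move: nm; rewrite !maxnE; lia.
have key : Num.sqrt (2 * next_size x * l / m') <= 2 * y.
  have -> : 2 * y = Num.sqrt (2 ^+ 2 * (next_size x * l / (maxn 1 n)%:R)).
    by rewrite sqrtrM ?sqr_ge0// sqrtr_sqr ger0_norm.
  have z0 : 0 < next_size x * l by rewrite mulr_gt0// (lt_le_trans ltr01).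
  rewrite ler_wsqrtr// -[2 * _ * l]mulrA; set z := next_size x * l in z0 *.
  have q0 : 0 < z / (maxn 1 n)%:R by rewrite divr_gt0.
  have zE : z / (maxn 1 n)%:R * (maxn 1 n)%:R = z by rewrite divfK// lt0r_neq0.
  rewrite ler_pdivrMr// -{1}zE; set q := z / _ in q0 *.
  have := ler_wpM2l (ltW q0) Nm; rewrite expr2; lra.
have key1 : Num.sqrt (2 * l / m') <= 2 * y.
  apply: le_trans key; rewrite ler_wsqrtr// ler_pM2r ?invr_gt0// -mulrA ler_pM2l//.
  by rewrite ler_peMl// ltW.
rewrite /bonus -/y; have y0 : 0 <= y by rewrite sqrtr_ge0.
have [h|h] := leP 3 (8 * y); first by rewrite mulrC.
(* With the doubled counts, the rewards contribute [4 * y] and the transitions [4 * L * y]; they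
   merge into [8 * L * y] because [1 <= L]. *)
apply: le_trans gb _; nra.
Qed.

End good_runs.

Lemma value_to_go1 (R : realType) (S : layered_space) (P : state S -> action S -> state S -> R)
    (pi : state S -> action S -> R) n x : is_transition P -> is_policy pi ->
  (layer x + n = len S)%N -> value_to_go P pi (fun _ _ => 1) n x = n%:R.
Proof.
move=> tP [p0 p1]; elim: n x => [//|n IHn] x xn.
rewrite -natr1 -[RHS]mul1r -[X in X * _](p1 x) mulr_suml /=.
apply: eq_bigr => a _; congr (_ * _); rewrite addrC; congr (_ + _).
rewrite -[RHS]mul1r -[X in X * _](trans_sum1 (x := x) a tP) ?mulr_suml; last by move: xn; lia.
apply: eq_bigr => x' _.
have [->|/(trans_next tP) xx'] := eqVneq (P x a x') 0; first by rewrite !mul0r.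
by rewrite IHn// xx' addSnnS.
Qed.

Lemma trans_dist_le2 (R : realType) (S : layered_space) (P P' : state S -> action S -> state S -> R)
    x a : is_transition P -> is_transition P' -> \sum_x' `|P x a x' - P' x a x'| <= 2.
Proof.
move=> tP tP'; have [P0 _ _] := tP; have [P0' _ _] := tP'.
apply: le_trans (lerD (trans_sum_le1 x a tP) (trans_sum_le1 x a tP')).
rewrite -big_split/=; apply: ler_sum => x' _; apply: le_trans (ler_normB _ _) _.
by rewrite !ger0_norm.
Qed.

Section run_regret.
Variables (R : realType) (S : layered_space) (M : layered_mdp R S) (T : nat) (delta : R).
Local Notation l := (log_term S T delta).
Local Notation L := ((len S)%:R : R).
Variables (w : run R S) (qhat : nat -> state S -> action S -> state S -> R)
  (pol : nat -> state S -> action S -> R) (pistar : state S -> action S -> R).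
Hypothesis gw : good_run M T delta w.
Hypothesis l2 : 1 <= 2 * l.
Hypothesis X0 : forall k, (k <= len S)%N -> (0 < layer_size S k)%N.
Hypothesis ucrl : ucrl_lp T delta w qhat pol.
Hypothesis opt : optimal_policy M pistar.

Let bonus_at t x (a : action S) : R := bonus T delta (layer_count w x a t) x.

Lemma value_to_goE pi : is_policy pi ->
  value M pi = value_to_go (trans M) pi (reward M) (len S) (x_first S).
Proof. by move=> pip; rewrite -traj_value//; exact: trans_transition. Qed.

(** Later epochs are optimistic. The policy of the first one does not come from a maximization, but
    there the trivial bound [L] on the regret is enough: no count preceded the epoch, so each step
    carries a bonus of at least 1. *)
Lemma episode_regret t : (1 <= t <= T)%N ->
  value M pistar - value M (pol (epoch w t)) <=
  value_to_go (trans M) (pol (epoch w t)) (bonus_at t) (len S) (x_first S).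
Proof.
move=> /[dup] tT /andP[t1 tT']; have tM := trans_transition M.
have [_ qopt qpol] := ucrl tT.
have [polp _] := qpol.
have /andP[s1 st] := epoch_start_le w t1.
have sT : (1 <= epoch_start w t <= T)%N by rewrite s1 (leq_trans st).
have [lw _ _ _] := gw.
have tTS : (1 <= t <= T.+1)%N by rewrite t1 ltnW.
have countE x a : (layer x < len S)%N ->
    (layer_count w x a t <= 2 * maxn 1 (visits2 w 1 (epoch_start w t) x a))%N.
  move=> xL; have := layered_visits2 x a lw tTS; rewrite xL => <-.
  exact: visits2_epoch_doubling.
have xlL x : x != x_last S -> (layer x < len S)%N.
  move=> xl; rewrite ltn_neqAle -ltnS ltn_ord andbT; apply: contra xl => /eqP xL.
  by rewrite -layer_last -val_eqE/= xL.
have [e1|e1] := eqVneq (epoch w t) 1%N; last first.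
  have e2 : (2 <= epoch w t)%N by rewrite ltn_neqAle eq_sym e1 epoch_ge1.
  have [qin qmax] := qopt e2.
  have ucb x a := reward_ucb_bounds gw l2 x a sT.
  apply: (optimistic_regret opt (trans_conf_set gw l2 X0 sT) _ _ qin qmax qpol).
    by move=> x a; have [] := ucb x a.
  move=> P x a [tP PT] xl; have xL := xlL x xl.
  have [/andP[r1 r2] r3] := ucb x a; have /andP[r4 _] := reward01 M x a.
  have [_ PT'] := trans_conf_set gw l2 X0 sT.
  have L1 : 1 <= L by rewrite ler1n (leq_ltn_trans _ xL).
  apply: (bonus_ge l2 X0 xL (countE x a xL)).
    have := trans_dist_le2 x a tP tM; set D := \sum_x' _ => D2.
    by have := ler_wpM2l (ler0n R (len S)) D2; lra.
  rewrite lerD// ler_wpM2l// mulr_natl mulr2n.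
  apply: le_trans (lerD (PT x a xl) (PT' x a xl)); rewrite -big_split/=.
  apply: ler_sum => x' _; rewrite [X in _ <= _ + X]distrC.
  by rewrite -[X in `|X|](subrKA (trans_est w (epoch_start w t) x a x')) ler_normD.
have V1 : value M pistar <= L.
  rewrite value_to_goE; last by have [] := opt.
  apply: value_to_go_le => //; first by have [] := opt.
  by move=> y b; have /andP[] := reward01 M y b.
have V2 : 0 <= value M (pol (epoch w t)).
  rewrite value_to_goE//; apply: value_to_go_ge0 => // y b.
  by have /andP[] := reward01 M y b.
have xf : (layer (x_first S) + len S = len S)%N by rewrite layer_x_first.
apply: (@le_trans _ _ L); first by lra.
rewrite -(value_to_go1 tM polp xf).
(* The bonus is at least 1 only off [x_last]. [simulation], with equal transitions and reward 0
   against reward 1, compares the values under exactly this weaker assumption. *)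
have -> : value_to_go (trans M) (pol (epoch w t)) (bonus_at t) (len S) (x_first S) =
    value_to_go (trans M) (pol (epoch w t)) (fun _ _ => 0) (len S) (x_first S) +
    value_to_go (trans M) (pol (epoch w t)) (bonus_at t) (len S) (x_first S).
  suff -> : forall n x, value_to_go (trans M) (pol (epoch w t)) (fun _ _ => 0) n x = 0.
    by rewrite add0r.
  elim=> //= n IHn x; rewrite big1// => a _; rewrite add0r big1 ?mulr0// => x' _.
  by rewrite IHn mulr0.
apply: simulation => // [y b|y b yl]; first by rewrite ler01 lexx.
have yL := xlL y yl; have L1 : 1 <= L by rewrite ler1n (leq_ltn_trans _ yL).
rewrite big1 => [|x' _]; last by rewrite subrr normr0.
rewrite mulr0 addr0 subr0; apply: (bonus_ge l2 X0 yL (countE y b yL)); first by lra.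
rewrite (epoch1_start e1) visits2_nil (_ : maxn 1 0 = 1%N)// divr1.
have : 1 <= Num.sqrt (2 * l) by rewrite -[X in X <= _]sqrtr1 ler_wsqrtr.
have : 0 <= L * (2 * Num.sqrt (2 * next_size R y * l / 1)).
  by rewrite !mulr_ge0 ?sqrtr_ge0// (le_trans ler01).
lra.
Qed.

Lemma sum_bonus : (1 <= T)%N -> (0 < #|action S|)%N ->
  \sum_(1 <= t < T.+1) \sum_(h < len S)
     bonus_at t (run_st w t h) (run_ac w t h) <=
  24 * L * #|state S|%:R * Num.sqrt (T%:R * #|action S|%:R * l).
Proof.
move=> T1 A0; have [lw _ _ _] := gw.
have l0 : 0 <= l by have := le_trans ler01 l2; rewrite pmulr_rge0.
have L0 : 0 <= L by rewrite ler0n.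
have -> : \sum_(1 <= t < T.+1) \sum_(h < len S) bonus_at t (run_st w t h) (run_ac w t h) =
    \sum_(x | (layer x < len S)%N) \sum_a \sum_(1 <= t < T.+1)
      (visit_at w x a t)%:R * bonus_at t x a.
  rewrite [RHS](eq_bigr (fun x => \sum_(1 <= t < T.+1) \sum_a
      (visit_at w x a t)%:R * bonus_at t x a)); last by move=> x _; rewrite exchange_big.
  rewrite [RHS]exchange_big/= !big_nat; apply: eq_bigr => t tT.
  rewrite [RHS]big_mkcond/=.
  transitivity (\sum_x \sum_a \sum_(h < len S)
      ((run_st w t h == x) && (run_ac w t h == a))%:R * bonus_at t x a).
    under [RHS]eq_bigr do rewrite exchange_big/=.
    rewrite [RHS]exchange_big/=; apply: eq_bigr => h _.
    rewrite [RHS](bigD1 (run_st w t h))//= (bigD1 (run_ac w t h))//= !eqxx mul1r.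
    rewrite !big1 ?addr0// => [x /negbTE xs|a /negbTE as_].
      by rewrite big1// => a _; rewrite eq_sym xs mul0r.
    by rewrite [_ == a]eq_sym as_ mul0r.
  apply: eq_bigr => x _; case: ifPn => xL; last first.
    apply: big1 => a _; have := layered_visit x a (fun=> bonus_at t x a) lw tT.
    by rewrite (negbTE xL).
  apply: eq_bigr => a _; have := layered_visit x a (fun=> bonus_at t x a) lw tT.
  by rewrite xL.
(* 24 is the 8 of the bonus times the 3 of [sum_inv_sqrt_count]. *)
apply: (@le_trans _ _ (\sum_(x | (layer x < len S)%N) \sum_a (24 * L * Num.sqrt l *
    Num.sqrt ((layer_size S (layer x).+1)%:R * (layer_count w x a T.+1)%:R)))).
  apply: ler_sum => x xL; apply: ler_sum => a _.
  have S0 : (0 : R) <= (layer_size S (layer x).+1)%:R by rewrite ler0n.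
  apply: (@le_trans _ _ (8 * L * Num.sqrt l * Num.sqrt (next_size R x) *
     \sum_(1 <= t < T.+1) (visit_at w x a t)%:R / Num.sqrt (maxn 1 (layer_count w x a t))%:R)).
    rewrite mulr_sumr; apply: ler_sum => t _.
    rewrite [leRHS]mulrCA ler_wpM2l//; set N := (maxn 1 _)%:R.
    have N0 : 0 <= N by rewrite ler0n.
    apply: (@le_trans _ _ (L * (8 * Num.sqrt (next_size R x * l / N)))).
      by rewrite ler_wpM2l// ge_min lexx orbT.
    have -> : Num.sqrt (next_size R x * l / N) =
        Num.sqrt l * Num.sqrt (next_size R x) / Num.sqrt N.
      by rewrite sqrtrM ?mulr_ge0// sqrtrV// [next_size R x * l]mulrC sqrtrM.
    by rewrite le_eqVlt; apply/orP; left; apply/eqP; ring.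
  apply: le_trans (ler_wpM2l _ (sum_inv_sqrt_count R (visit_at w x a) (ltn0Sn T))) _.
    by rewrite !mulr_ge0 ?sqrtr_ge0.
  rewrite sqrtrM// -/(layer_count w x a T.+1) /next_size; lra.
under eq_bigr do rewrite -mulr_sumr.
rewrite -mulr_sumr; apply: le_trans (ler_wpM2l _ (sum_sqrt_layer_count lw A0 T1 X0)) _.
  by rewrite !mulr_ge0 ?sqrtr_ge0.
have -> : Num.sqrt (T%:R * #|action S|%:R * l) =
    Num.sqrt l * Num.sqrt (#|action S|%:R * T%:R).
  by rewrite [T%:R * _]mulrC [_ * T%:R * l]mulrC [LHS]sqrtrM.
by rewrite le_eqVlt; apply/orP; left; apply/eqP; ring.
Qed.

End run_regret.

Section union_two.
Context d (T : measurableType d) (R : realType) (mu : {measure set T -> \bar R}).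

Lemma union_bound2 (Q1 Q2 : T -> Prop) (e1 e2 : R) :
  (exists B : set T, [/\ measurable B, (mu B <= e1%:E)%E & forall o, ~ B o -> Q1 o]) ->
  (exists B : set T, [/\ measurable B, (mu B <= e2%:E)%E & forall o, ~ B o -> Q2 o]) ->
  exists B : set T, [/\ measurable B, (mu B <= (e1 + e2)%:E)%E &
    forall o, ~ B o -> Q1 o /\ Q2 o].
Proof.
move=> h1 h2.
have [|B [mB muB BQ]] := @union_bound _ _ _ mu bool (fun b => if b then Q1 else Q2)
  (fun b => if b then e1 else e2); first by case.
exists B; split=> // [|o nB]; first by move: muB; rewrite big_bool.
by split; [exact: (BQ o nB true)|exact: (BQ o nB false)].
Qed.

End union_two.

Lemma count_sum (R : realType) (I : finType) (e : R) : \sum_(i : I) e = #|I|%:R * e.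
Proof. by rewrite sumr_const mulr_natl. Qed.

(** * Probability of the concentration bounds *)

Section good_event.
Context (R : realType) (S : layered_space) (M : layered_mdp R S) (T : nat) (delta : R)
  (d : measure_display) (Omega : measurableType d) (Pr : probability Omega R)
  (F : nat -> nat -> set (set Omega)) (w : Omega -> run R S)
  (mu : nat -> Omega -> state S -> action S -> R).
Hypothesis IM : interaction M T Pr F w mu.
Hypothesis mup : forall t o, (1 <= t <= T)%N -> is_policy (mu t o).
Hypothesis T1 : (1 <= T)%N.
Hypothesis L0 : (0 < len S)%N.
Hypothesis delta01 : 0 < delta < 1.

Local Notation l := (log_term S T delta).
Local Notation K := (T%:R * #|state S|%:R * #|action S|%:R : R).

(** [layered_space] does not say that there is an action; a policy does, since its probabilities sum
    to 1 at the first state. *)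
Lemma action_inhabited : inhabited (action S).
Proof.
have T11 : (1 <= 1 <= T)%N by [].
have [_ p1] := mup point T11.
case: (pickP (fun _ : action S => true)) => [a _|a0]; first by split.
have := p1 (x_first S); rewrite big_pred0 => [/eqP|a]; last by have := a0 a.
by rewrite eq_sym oner_eq0.
Qed.

Lemma action_gt0 : (0 < #|action S|)%N.
Proof. by have [a] := action_inhabited; apply/card_gt0P; exists a. Qed.

Lemma len_lt_states : (len S < #|state S|)%N.
Proof. by have [a] := action_inhabited; exact: (len_lt_card a (trans_transition M)). Qed.

Lemma layers_nonempty k : (k <= len S)%N -> (0 < layer_size S k)%N.
Proof. by have [a] := action_inhabited; exact: (layer_size_gt0 a (trans_transition M)). Qed.

(** An episode with at least one step has two distinct states. The resulting [expR (- l) <= 1 / 2]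
    yields both [1 <= 2 * l], which covers unvisited pairs, and the summation over sets of next
    states. *)
Lemma K_ge2 : 2 <= K.
Proof.
rewrite -!natrM ler_nat.
have X2 : (2 <= #|state S|)%N by exact: leq_ltn_trans L0 len_lt_states.
exact: leq_mul (leq_mul T1 X2) action_gt0.
Qed.

Lemma expR_log_term : expR (- l) = delta / K.
Proof.
have /andP[d0 _] := delta01; have K0 := lt_le_trans (ltr0n R 2) K_ge2.
by rewrite expRN /log_term lnK ?invf_div// posrE divr_gt0.
Qed.

Lemma expR_log_term_le : 2 * expR (- l) <= 1.
Proof.
have /andP[d0 d1] := delta01; have K0 : 0 < K := lt_le_trans (ltr0n R 2) K_ge2.
by rewrite expR_log_term mulrA ler_pdivrMr// mul1r; have := K_ge2; lra.
Qed.

Lemma log_term_ge : 1 <= 2 * l.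
Proof. by have := expR_ge1Dx (- l); have := expR_log_term_le; lra. Qed.

Let l0 : 0 < l.
Proof. by have := lt_le_trans ltr01 log_term_ge; rewrite pmulr_rgt0. Qed.

Lemma observable_concentration (Y : state S -> action S -> nat -> Omega -> R)
    (p : state S -> action S -> R) :
  (forall x a, (layer x < len S)%N -> hoeffding_observable T Pr F w x a (Y x a) (p x a)) ->
  exists Bad : set Omega, [/\ measurable Bad, (Pr Bad <= delta%:E)%E &
    forall o, ~ Bad o -> forall x a t, (layer x < len S)%N -> (1 <= t <= T)%N ->
      let n := layer_count (w o) x a t in (0 < n)%N ->
      \sum_(1 <= u < t) (visit_at (w o) x a u)%:R * (Y x a u o - p x a)
        < n%:R * Num.sqrt (2 * l / n%:R)].
Proof.
move=> HY; have K0 : 0 < K := lt_le_trans (ltr0n R 2) K_ge2.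
(* [n : 'I_T] stands for [n.+1] visits. There are [K] triples, and each is allowed the probability
   [expR (- l) = delta / K]. *)
have [|B [mB PB BP]] := @union_bound _ _ _ Pr (state S * action S * 'I_T)%type
  (fun i o => let: (x, a, n) := i in
    forall t, (layer x < len S)%N -> (1 <= t <= T)%N -> layer_count (w o) x a t = n.+1 ->
      \sum_(1 <= u < t) (visit_at (w o) x a u)%:R * (Y x a u o - p x a)
        < n.+1%:R * Num.sqrt (2 * l / n.+1%:R))
  (fun=> expR (- l)).
  move=> [[x a] n]; have [xL|Lx] := ltnP (layer x) (len S); last first.
    by exists set0; split; rewrite ?measure0 ?lee_fin ?expR_ge0// => o _ t xL; rewrite ltnNge Lx in xL.
  have n0 : (0 : R) < n.+1%:R by rewrite ltr0n.
  have q0 : 0 < 2 * l / n.+1%:R by rewrite divr_gt0// mulr_gt0.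
  have b0 : 0 < n.+1%:R * Num.sqrt (2 * l / n.+1%:R) by rewrite mulr_gt0// sqrtr_gt0.
  have [B [mB PB BP]] := count_concentration IM T1 xL (HY x a xL) (ltn0Sn n) b0.
  exists B; split=> //.
    (* The radius of the algorithm gives the exponent [4 * l], more than the [l] that is asked
       for. *)
    apply: le_trans PB _; rewrite lee_fin ler_expR lerN2 exprMn sqr_sqrtr ?ltW//.
    rewrite (_ : _ / _ = 4 * l); last by field; rewrite lt0r_neq0.
    by have := l0; lra.
  move=> o nB t _ /andP[t1 tT] ln; apply: BP => //; by rewrite t1 ltnW.
exists B; split=> //.
  apply: le_trans PB _; rewrite count_sum !card_prod card_ord expR_log_term lee_fin.
  rewrite !natrM (_ : _ * _ * T%:R = K); last by ring.
  by rewrite mulrC divfK// lt0r_neq0.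
move=> o nB x a t xL /[dup] tT /andP[t1 tT'] n n0.
have nT : (n.-1 < T)%N.
  by rewrite prednK// (leq_trans (layer_count_le _ _ _ t1))// (leq_trans (leq_pred _)).
have := BP o nB (x, a, Ordinal nT) t xL tT; rewrite /= prednK//; exact.
Qed.

(** Let [m] be the size of the next layer. Half the radius gives each set the exponent [m * l], and
    there are [2 ^ m] sets, so a pair and a count cost [(2 * expR (- l)) ^+ m]. As the base is at
    most 1 and [m] is positive, this is at most [2 * expR (- l)], whence [2 * delta] in total. *)
Lemma transition_concentration :
  exists Bad : set Omega, [/\ measurable Bad, (Pr Bad <= (2 * delta)%:E)%E &
    forall o, ~ Bad o ->
      forall x a (B : {set state S}) t, (layer x < len S)%N -> (1 <= t <= T)%N ->
        {in B, forall x', next_layer x x'} ->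
        let n := layer_count (w o) x a t in (0 < n)%N ->
        \sum_(1 <= u < t) (visit_at (w o) x a u)%:R *
            ((run_st (w o) u (layer x).+1 \in B)%:R - \sum_(x' in B) trans M x a x')
          < n%:R * Num.sqrt (2 * next_size R x * l / n%:R) / 2].
Proof.
have K0 : 0 < K := lt_le_trans (ltr0n R 2) K_ge2.
pose N (x : state S) : {set state S} := [set x' | next_layer x x']%SET.
have NE x : #|N x| = layer_size S (layer x).+1.
  by rewrite layer_sizeE; apply: eq_card => x'; rewrite !inE.
(* The index type contains all sets of states; those not inside the next layer get the empty bad
   event and weight 0. *)
pose e (i : state S * action S * 'I_T * {set state S}) : R := let: (x, a, n, B) := i in
  if (layer x < len S)%N && (B \subset N x) then expR (- (next_size R x * l)) else 0.
have [|B [mB PB BP]] := @union_bound _ _ _ Pr (state S * action S * 'I_T * {set state S})%type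
  (fun i o => let: (x, a, n, B) := i in
    forall t, (layer x < len S)%N -> (1 <= t <= T)%N -> B \subset N x ->
      layer_count (w o) x a t = n.+1 ->
        \sum_(1 <= u < t) (visit_at (w o) x a u)%:R *
            ((run_st (w o) u (layer x).+1 \in B)%:R - \sum_(x' in B) trans M x a x')
          < n.+1%:R * Num.sqrt (2 * next_size R x * l / n.+1%:R) / 2)
  e.
  move=> [[[x a] n] B]; rewrite /e; case: ifPn => [/andP[xL BN]|xB]; last first.
    exists set0; split; rewrite ?measure0// => o _ t xL tT BN.
    by rewrite xL BN in xB.
  have S0 : 0 < next_size R x by rewrite ltr0n layers_nonempty.
  have n0 : (0 : R) < n.+1%:R by rewrite ltr0n.
  have q0 : 0 < 2 * next_size R x * l / n.+1%:R by rewrite divr_gt0// !mulr_gt0.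
  have b0 : 0 < n.+1%:R * Num.sqrt (2 * next_size R x * l / n.+1%:R) / 2.
    by rewrite divr_gt0// mulr_gt0// sqrtr_gt0.
  have [B' [mB PB BP]] := count_concentration IM T1 xL
    (next_observable IM mup a (mem B) xL) (ltn0Sn n) b0.
  exists B'; split=> //.
    apply: le_trans PB _; rewrite lee_fin ler_expR lerN2.
    rewrite expr_div_n exprMn (sqr_sqrtr (ltW q0)).
    by rewrite le_eqVlt; apply/orP; left; apply/eqP; field; rewrite lt0r_neq0.
  move=> o nB t _ /andP[t1 tT] _ ln; apply: BP => //; by rewrite t1 ltnW.
exists B; split=> //.
  apply: le_trans PB _; rewrite lee_fin.
  rewrite (eq_bigr (fun p => e (p.1, p.2))); last by case.
  rewrite -(pair_bigA _ (fun i B => e (i, B)))/=.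
  apply: (@le_trans _ _ (\sum_(i : state S * action S * 'I_T) (2 * expR (- l)))).
    apply: ler_sum => -[[x a] n] _; rewrite /e.
    have [xL|_] := ltnP (layer x) (len S); last by rewrite big1// mulr_ge0 ?expR_ge0.
    rewrite -big_mkcond/= (eq_bigl (fun B => B \in powerset (N x))); last first.
      by move=> B'; rewrite powersetE.
    rewrite sumr_const card_powerset NE /next_size -mulrN.
    rewrite expRM_natl -[_ *+ (_ ^ _)%N]mulr_natl natrX -exprMn.
    have /prednK <- : (0 < layer_size S (layer x).+1)%N by exact: layers_nonempty.
    have q0 : 0 <= 2 * expR (- l) by rewrite mulr_ge0 ?expR_ge0.
    by rewrite exprS ler_piMr// exprn_ile1// expR_log_term_le.
  rewrite count_sum !card_prod card_ord expR_log_term.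
  rewrite !natrM (_ : _ * _ * T%:R = K); last by ring.
  by rewrite mulrCA [K * _]mulrC divfK// lt0r_neq0.
move=> o nB x a B0 t xL /[dup] tT /andP[t1 tT'] BN n n0.
have nT : (n.-1 < T)%N.
  by rewrite prednK// (leq_trans (layer_count_le _ _ _ t1))// (leq_trans (leq_pred _)).
have BN' : B0 \subset N x by apply/fintype.subsetP => x' /BN; rewrite inE.
have := BP o nB (x, a, Ordinal nT, B0) t xL tT BN'; rewrite /= prednK//; exact.
Qed.

End good_event.

(** * The regret bound *)

Section regret_bound.
Context (R : realType) (S : layered_space) (M : layered_mdp R S) (T : nat) (delta : R)
  (pistar : state S -> action S -> R)
  (d : measure_display) (Omega : measurableType d) (Pr : probability Omega R)
  (F : nat -> nat -> set (set Omega)) (w : Omega -> run R S)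
  (qhat : Omega -> nat -> state S -> action S -> state S -> R)
  (pol : Omega -> nat -> state S -> action S -> R).
Hypothesis T1 : (1 <= T)%N.
Hypothesis delta01 : 0 < delta < 1.
Hypothesis opt : optimal_policy M pistar.
Hypothesis ucrl : forall o, ucrl_lp T delta (w o) (qhat o) (pol o).
Hypothesis IM : interaction M T Pr F w (fun t o => pol o (epoch (w o) t)).

Local Notation l := (log_term S T delta).
Local Notation mu := (fun t o => pol o (epoch (w o) t)).

Lemma executed_policy t o : (1 <= t <= T)%N -> is_policy (mu t o).
Proof. by move=> tT; have [_ _ []] := ucrl o tT. Qed.

(** The budget is 0 for the layers, [delta] for each side of the reward bounds and [2 * delta] for
    the transitions. *)
Lemma good_run_probability : (0 < len S)%N ->
  exists Bad : set Omega, [/\ measurable Bad, (Pr Bad <= (4 * delta)%:E)%E &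
    forall o, ~ Bad o -> good_run M T delta (w o)].
Proof.
move=> L0; have mup := executed_policy.
have [B [mB PB BP]] := union_bound2 (layered_almost_surely IM)
  (union_bound2 (observable_concentration IM mup T1 L0 delta01 (fun x a => reward_observable IM a))
  (union_bound2
    (observable_concentration IM mup T1 L0 delta01 (fun x a => reward_opp_observable IM a))
    (transition_concentration IM mup T1 L0 delta01))).
exists B; split=> //; first by apply: le_trans PB _; rewrite lee_fin; lra.
by move=> o /BP[? [? [? ?]]].
Qed.

Let g t o x (a : action S) : R := bonus T delta (layer_count (w o) x a t) x.

(** No layer follows the last one, so [next_size] is 0 there. This handles the one state to which
    [adapted_layer_visits] does not apply. *)
Lemma bonus_last n (x : state S) : layer x = len S :> nat -> bonus T delta n x = 0 :> R.
Proof.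
move=> xL; rewrite /bonus /next_size xL layer_sizeE eq_card0; last first.
  by move=> y; rewrite inE; apply: ltn_eqF; exact: ltn_ord.
by rewrite !mul0r sqrtr0 mulr0 min_r// mulr0.
Qed.

Lemma adapted_bonus t x a : (1 <= t <= T)%N -> adapted (F t 0%N) (fun o => g t o x a).
Proof.
move=> /[dup] tT /andP[t1 tT']; have [xL|Lx] := ltnP (layer x) (len S); last first.
  rewrite (_ : (fun o => _) = fun=> 0); first exact: adapted_cst.
  apply/funext => o; rewrite /g bonus_last//.
  by apply/eqP; rewrite eqn_leq Lx -ltnS ltn_ord.
rewrite -(historyE S F tT'); apply: (adapted_nat (fun n => bonus T delta n x)).
  exact: (history_sigma IM).
by apply: (adapted_layer_visits IM T1 a xL); rewrite t1 ltnW.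
Qed.

(** The regret depends on the outcome only through the executed policies, which [interact_policy]
    makes adapted. Measurability is needed to bound the probability from below by that of a smaller
    event. *)
Lemma regret_measurable (c : R) :
  measurable [set o | regret M T pistar (fun t => pol o (epoch (w o) t)) <= c].
Proof.
pose v t o := value_to_go (trans M) (mu t o) (reward M) (len S) (x_first S).
have mv : adapted (history S T F T.+1) (fun o => \sum_(1 <= t < T.+1) v t o).
  apply: (adapted_history_sum IM T1); first by rewrite leqnn.
  move=> u /[dup] uT /andP[u1 uT']; apply: (@adapted_F_history _ _ _ _ _ _ _ _ _ _ IM T1 u u.+1 0) => //.
    by rewrite u1 ltnSn.
  apply: adapted_value_to_go => y b; last exact: adapted_cst.
  exact: (adapted_policy IM).
have mr : measurable_fun setT (fun o => T%:R * value M pistar - \sum_(1 <= t < T.+1) v t o).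
  apply: (adapted_measurable (history_sigma IM T1 (ltn0Sn T)) (history_measurable IM T1 (ltn0Sn T))).
  by apply: adaptedB => //; exact: adapted_cst.
have := mr measurableT `]-oo, c]%classic (measurable_itv _); rewrite setTI.
congr measurable; apply/seteqP; split=> o /=; rewrite in_itv/= /regret;
  congr (_ - _ <= _); rewrite !big_nat; apply: eq_bigr => t tT;
  by rewrite /v value_to_goE//; exact: executed_policy.
Qed.

Lemma regret_bound :
  ((1 - 5 * delta)%:E <=
      Pr [set o | (regret M T pistar (fun t => pol o (epoch (w o) t))
                   <= 27 * (len S)%:R * #|state S|%:R
                      * Num.sqrt (T%:R * #|action S|%:R * l))%R])%E.
Proof.
have /andP[d0 d1] := delta01; have mup := executed_policy.
(* With no steps [K] can be 1 and the lower bound on [log_term] may fail, but all values are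
   zero. *)
have [L0|L0] := posnP (len S).
  have value0 pi : value M pi = 0.
    rewrite /value big1// => tau _; rewrite big1 ?mulr0// => h _.
    by have := ltn_ord h; rewrite {2}L0.
  rewrite (_ : [set _ | _] = setT).
    by rewrite probability_setT lee_fin; lra.
  apply/seteqP; split=> // o _ /=; rewrite /regret value0 mulr0 big1 => [|t _]; last exact: value0.
  by rewrite subrr L0 mulr0 !mul0r.
have Lr0 : (0 : R) < (len S)%:R by rewrite ltr0n.
have l2 := log_term_ge M mup T1 L0 delta01.
have l0 : 0 < l by have := lt_le_trans ltr01 l2; rewrite pmulr_rgt0.
have A0 := action_gt0 mup T1.
have LX := len_lt_states M mup T1.
have c0 : 0 < 3 * (len S)%:R :> R by rewrite mulr_gt0.
have azumaB : exists Bad : set Omega, [/\ measurable Bad, (Pr Bad <= delta%:E)%E &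
    forall o, ~ Bad o -> \sum_(1 <= t < T.+1)
        value_to_go (trans M) (mu t o) (g t o) (len S) (x_first S) <=
      \sum_(1 <= t < T.+1) \sum_(h < len S) g t o (run_st (w o) t h) (run_ac (w o) t h)
      + 3 * (len S)%:R * (len S)%:R * Num.sqrt (T%:R * l)].
  have [B [mB PB BP]] := azuma IM mup c0 L0 T1 (fun t o x a => bonus01 T delta _ x)
    adapted_bonus l0.
  exists B; split=> //; apply: le_trans PB _; rewrite lee_fin (expR_log_term M mup T1 L0 delta01).
  rewrite ler_pdivrMr; last by apply: lt_le_trans (K_ge2 M mup T1 L0); rewrite ltr0n.
  by apply: ler_peMr; [exact: ltW|apply: le_trans (K_ge2 M mup T1 L0); rewrite ler1n].
have [B [mB PB BP]] := union_bound2 (good_run_probability L0) azumaB.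
have PC : (Pr (~` B) <= Pr [set o | (regret M T pistar (fun t => pol o (epoch (w o) t))
                   <= 27 * (len S)%:R * #|state S|%:R
                      * Num.sqrt (T%:R * #|action S|%:R * l))%R])%E.
  apply: le_measure; rewrite ?inE; [exact: measurableC|exact: regret_measurable|].
  move=> o nB /=; have [gw Az] := BP o nB.
  have X0 k : (k <= len S)%N -> (0 < layer_size S k)%N by exact: (layers_nonempty M mup T1).
  have regretE : regret M T pistar (fun t => pol o (epoch (w o) t)) =
      \sum_(1 <= t < T.+1) (value M pistar - value M (mu t o)).
    by rewrite sumrB sumr_const_nat subn1 /= -mulr_natl.
  rewrite regretE.
  apply: (@le_trans _ _ (\sum_(1 <= t < T.+1)
      value_to_go (trans M) (mu t o) (g t o) (len S) (x_first S))).
    rewrite !big_nat; apply: ler_sum => t tT.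
    exact: (episode_regret gw l2 X0 (ucrl o) opt tT).
  apply: le_trans Az _; apply: le_trans (lerD (sum_bonus gw l2 X0 T1 A0) (lexx _)) _.
  set q := Num.sqrt (T%:R * #|action S|%:R * l).
  have q0 : 0 <= q by rewrite sqrtr_ge0.
  have ql : Num.sqrt (T%:R * l) <= q.
    rewrite ler_wsqrtr// mulrAC ler_peMr ?ler1n// mulr_ge0// ltW//.
  (* Azuma's term carries [len S] twice, once from the bound on the bonus and once from the length
     of an episode; one of the two is exchanged for the number of states. *)
  have LX' : (len S)%:R <= #|state S|%:R :> R by rewrite ler_nat ltnW.
  have h1 : 3 * (len S)%:R * (len S)%:R * Num.sqrt (T%:R * l) <= 3 * (len S)%:R * #|state S|%:R * q.
    by rewrite ler_pM ?sqrtr_ge0 ?mulr_ge0// ler_wpM2l// ltW.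
  lra.
apply: le_trans PC; rewrite probability_setC//.
have PBf : Pr B \is a fin_num by exact: fin_num_measure.
rewrite -(fineK PBf) -EFinB lee_fin lerB//.
have : fine (Pr B) <= 4 * delta + delta by rewrite -lee_fin fineK.
lra.
Qed.

End regret_bound.

Theorem theorem4 (R : realType) :
  exists2 C : R, 0 < C &
    forall (S : layered_space) (M : layered_mdp R S) (T : nat) (delta : R)
      (pistar : state S -> action S -> R)
      (d : measure_display) (Omega : measurableType d)
      (Pr : probability Omega R) (F : nat -> nat -> set (set Omega))
      (w : Omega -> run R S)
      (qhat : Omega -> nat -> state S -> action S -> state S -> R)
      (pol : Omega -> nat -> state S -> action S -> R),
    (1 <= T)%N -> 0 < delta < 1 ->
    optimal_policy M pistar ->
    (forall o, ucrl_lp T delta (w o) (qhat o) (pol o)) ->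
    interaction M T Pr F w (fun t o => pol o (epoch (w o) t)) ->
    ((1 - 5 * delta)%:E <=
      Pr [set o | (regret M T pistar (fun t => pol o (epoch (w o) t))
                   <= C * (len S)%:R * #|state S|%:R
                      * Num.sqrt (T%:R * #|action S|%:R * log_term S T delta))%R])%E.
Proof.
exists 27; first by rewrite ltr0n.
by move=> S M T delta pistar d Omega Pr F w qhat pol; exact: regret_bound.
Qed.
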